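(* Consider the impacting hybrid system $\dot x = F(x;\mu,\eta)$ for $C^{\top}x>0$, $x\mapsto R(x;\mu,\eta)$ for $C^{\top}x=0$, with $x\in\mathbb{R}^n$ and $(\mu,\eta)\in\mathbb{R}^2$, satisfying the standing assumptions listed in the context, and let $P(u;\mu,\eta)$, $u\in\mathbb{R}^{n-1}$, be the Poincaré map of the blown-up system defined in the context. Suppose $F$ and $R$ are $C^k$ with $k\ge 3$, and suppose $P(u;0,0)$ has a fixed point $\hat u$. Suppose the Jacobian matrix $\mathrm{D}P(\hat u;0,0)$ (derivative with respect to $u$) has an eigenvalue $1$ of algebraic multiplicity one and no other eigenvalues with unit modulus. Let $w\in\mathbb{R}^{n-1}$ and $v\in\mathbb{R}^{n-1}$ be left and right eigenvectors, respectively, for the eigenvalue $1$ with $w^{\top}v=1$, and suppose $$w^{\top}\frac{\partial P}{\partial\eta}\neq 0,\qquad w^{\top}\big[(\mathrm{D}^2P)(v,v)\big]\neq 0,$$ where the derivatives are evaluated at $(\hat u;0,0)$ and $\mathrm{D}^2P$ is the second derivative with respect to $u$. Then there exist $\delta>0$ and a $C^{k-2}$ function $g:(-\delta,\delta)\to\mathbb{R}$ with $g(0)=0$ such that the hybrid system has saddle-node bifurcations of single-impact limit cycles on $\eta=g(\mu)$ for all $0<\mu<\delta$.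
   Context: **Impacting hybrid system.** The system is $$\dot x=F(x;\mu,\eta)\ \text{ for } H(x)>0,\qquad x\mapsto R(x;\mu,\eta)\ \text{ for } H(x)=0,$$ with $x\in\mathbb{R}^n$, parameters $(\mu,\eta)\in\mathbb{R}^2$, and $H(x)=C^{\top}x$ for a constant nonzero vector $C\in\mathbb{R}^n$. Smoothness of $F$ and $R$ is joint in $(x,\mu,\eta)$. The switching surface is $\Sigma=\{x: C^{\top}x=0\}$. Put $v_H(x)=C^{\top}F(x;\mu,\eta)$ (the velocity relative to $\Sigma$), and $\Sigma^-=\{x\in\Sigma: v_H(x)<0\}$ (incoming set), $\Sigma^+=\{x\in\Sigma: v_H(x)>0\}$ (outgoing set), $\Sigma^0=\{x\in\Sigma: v_H(x)=0\}$ (grazing set). **Standing assumptions.** The reset law has the form $R(x)=x+W(x)v_H(x)$ with $W=W(x;\mu,\eta)$ a smooth vector field, and $R$ maps $\Sigma$ into $\Sigma$. Writing $v_H(R(x))=-r(x)v_H(x)$, it is assumed that $r(x)>0$ for all $x\in\Sigma^-\cup\Sigma^0$ (so $R$ maps $\Sigma^-$ to $\Sigma^+$). Furthermore $F(0;0,\eta)=0$ for all $\eta$ (a boundary equilibrium bifurcation occurs at $\mu=0$ for all $\eta$), so that $$F(x;\mu,\eta)=A(\eta)x+M(\eta)\mu+\mathcal{O}\big((\|x\|+|\mu|)^2\big),\qquad W(x;\mu,\eta)=-B(\eta)+\mathcal{O}(\|x\|+|\mu|),$$ where $A\in\mathbb{R}^{n\times n}$ and $B,M\in\mathbb{R}^n$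 are smooth functions of $\eta$. **Blown-up system.** With $y=x/\mu$ set $\tilde F(y;\mu,\eta)=\frac1\mu F(\mu y;\mu,\eta)$ and $\tilde R(y;\mu,\eta)=\frac1\mu R(\mu y;\mu,\eta)$ for $\mu\ne0$, extended smoothly to $\mu=0$ by $\tilde F(y;0,\eta)=Ay+M$ and $\tilde R(y;0,\eta)=(I-BC^{\top}A)y-BC^{\top}M$. The blown-up system is $\dot y=\tilde F(y;\mu,\eta)$ for $C^{\top}y>0$, $y\mapsto\tilde R(y;\mu,\eta)$ for $C^{\top}y=0$; it is considered for all $\mu$ in a neighbourhood of $0$, though it corresponds to the original system only for $\mu>0$. Let $\tilde\Sigma=\{y: C^{\top}y=0\}$ and $\tilde\Sigma^{\pm}=\{y\in\tilde\Sigma: \pm C^{\top}\tilde F(y;\mu,\eta)>0\}$. **Poincaré map.** Let $Q$ be an $(n-1)\times n$ matrix such that $\begin{bmatrix}C^{\top}\\ Q\end{bmatrix}$ is invertible; then $\zeta(y)=Qy$ is a bijection from $\tilde\Sigma$ to $\mathbb{R}^{n-1}$. Let $\Pi^{\pm}=\zeta(\tilde\Sigma^{\pm})$. For $u\in\Pi^+$ define $$P(u;\mu,\eta)=\zeta\big(\tilde R(y^-;\mu,\eta)\big),$$ where $y^-$ is the first point (at positive time) at which the forward orbit of $\zeta^{-1}(u)\in\tilde\Sigma^+$ under $\tilde F$ returns to $\tilde\Sigma$, this point being required to belong to $\tilde\Sigma^-$; $P$ is well-defined at $(u;\mu,\eta)$ if such a point exists. **Limit cycles.** A single-impact limit cycle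 of the hybrid system is a periodic orbit with exactly one impact with $\Sigma$ per period. If $\hat u$ is a fixed point of $P(\cdot;\mu,\eta)$ with $\mu>0$, then $\mu\zeta^{-1}(\hat u)\in\Sigma^+$ belongs to a single-impact periodic orbit of the hybrid system, and the eigenvalues of $\mathrm{D}P(\hat u;\mu,\eta)$ are its non-trivial Floquet multipliers. A saddle-node bifurcation of single-impact limit cycles at a parameter point with $\mu>0$ means that the corresponding fixed point of $P(\cdot;\mu,\eta)$ undergoes a (standard, generic) saddle-node bifurcation for maps as $\eta$ is varied through that point with $\mu$ fixed. *)

(* Defs.v *)
From HB Require Import structures.
From mathcomp Require Import all_boot all_order all_algebra.
From mathcomp Require Import all_classical all_reals all_analysis.
From mathcomp Require Import complex.

Set Implicit Arguments.
Unset Strict Implicit.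
Unset Printing Implicit Defensive.

Import Order.TTheory GRing.Theory Num.Theory.
Import numFieldNormedType.Exports.

Local Open Scope classical_set_scope.
Local Open Scope ring_scope.

(* The phase space is 'cV[R]_m.+1, that is n = m.+1 (n >= 1 because C is a
   nonzero vector), and sections have dimension n - 1 = m. *)

Section Calculus.
Context {R : realType}.

(* Class C^k on U, meant for open U: for finite-dimensional V this is the usual
   notion of k-fold continuous differentiability. *)
Fixpoint Ck {V W : normedModType R} (k : nat) (U : set V) (f : V -> W) : Prop :=
  match k with
  | 0 => forall x, U x -> {for x, continuous f}
  | j.+1 => (forall x, U x -> differentiable f x) /\
            (forall v : V, Ck j U ('D_v f))
  end.

(* The library's [jacobian] acts on row vectors; here vectors are columns and
   the Jacobian acts by left multiplication. *)
Definition jac {p q : nat} (f : 'cV[R]_p -> 'cV[R]_q) (x : 'cV[R]_p) :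
    'M[R]_(q, p) :=
  \matrix_(i, j) ('d f x (delta_mx j 0)) i 0.

Definition dotv {p : nat} (a b : 'cV[R]_p) : R := (a^T *m b) 0 0.

Definition is_solution {p : nat} (f : 'cV[R]_p -> 'cV[R]_p) (T : R)
    (y : R -> 'cV[R]_p) : Prop :=
  {within `[0, T], continuous y} /\
  (forall t : R, 0 < t < T -> is_derive t 1 y (f (y t))).

End Calculus.

Section SaddleNode.
Context {R : realType} {m : nat}.

Definition simple_unit_eigenvalue (J : 'M[R]_m) : Prop :=
  mup 1 (char_poly J) = 1%N /\
  (forall z : R[i], eigenvalue (map_mx (real_complex R) J) z ->
     `|z| = 1 -> z = 1).

Definition unit_eigenvectors (J : 'M[R]_m) (w v : 'cV[R]_m) : Prop :=
  [/\ w^T *m J = w^T, J *m v = v & dotv w v = 1].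

(* Transversality in the parameter and nondegeneracy of the quadratic term:
   'D_v ('D_v _) u is the second derivative applied to (v, v). *)
Definition fold_coefficients (f : 'cV[R]_m -> R -> 'cV[R]_m)
    (u : 'cV[R]_m) (e : R) (w v : 'cV[R]_m) : Prop :=
  dotv w ('D_1 (fun s : R => f u s) e) != 0 /\
  dotv w ('D_v ('D_v (f^~ e)) u) != 0.

(* Near (u, e) the fixed points unfold as in the normal form x + e + x ^+ 2:
   two on one side of e, one at e and none on the other side. As N0 is
   arbitrary, the two fixed points converge to u when the parameter tends
   to e. *)
Definition fold_unfolding (D : 'cV[R]_m -> R -> Prop)
    (f : 'cV[R]_m -> R -> 'cV[R]_m) (u : 'cV[R]_m) (e : R) : Prop :=
  exists s : R, (s = 1 \/ s = -1) /\
  forall N0 : set 'cV[R]_m, nbhs u N0 ->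
  exists (N : set 'cV[R]_m) (h0 : R),
    let fixpts (e' : R) := [set x | [/\ N x, D x e' & f x e' = x]] in
    [/\ nbhs u N, N `<=` N0, 0 < h0, fixpts e = [set u] &
        forall h : R, 0 < h < h0 ->
          (exists u1 u2 : 'cV[R]_m, u1 <> u2 /\
             fixpts (e + s * h) = [set u1; u2]) /\
          fixpts (e - s * h) = set0].

(* Generic saddle-node bifurcation of the one-parameter family of partial maps
   f^~ e with domains D^~ e. *)
Definition saddle_node (D : 'cV[R]_m -> R -> Prop)
    (f : 'cV[R]_m -> R -> 'cV[R]_m) (u : 'cV[R]_m) (e : R) : Prop :=
  [/\ (exists U : set ('cV[R]_m * R)%type,
         [/\ open U, U (u, e), (forall p, U p -> D p.1 p.2) &
             Ck 2 U (fun p => f p.1 p.2)]),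
      f u e = u,
      simple_unit_eigenvalue (jac (f^~ e) u),
      (exists w v : 'cV[R]_m,
         unit_eigenvectors (jac (f^~ e) u) w v /\
         fold_coefficients f u e w v) &
      fold_unfolding D f u e].

End SaddleNode.

Section Hybrid.
Context {R : realType} {m : nat}.

(* State-dependent quantities take the state, then mu, then eta. *)
Notation state := 'cV[R]_m.+1.
Notation field := (state -> R -> R -> state).

Definition surface (C : state) : set state := [set x | dotv C x = 0].

Definition velocity (F : field) (C : state) (x : state) (mu eta : R) : R :=
  dotv C (F x mu eta).

Definition incoming (F : field) (C : state) (mu eta : R) : set state :=
  [set x | surface C x /\ velocity F C x mu eta < 0].

Definition outgoing (F : field) (C : state) (mu eta : R) : set state :=
  [set x | surface C x /\ 0 < velocity F C x mu eta].

Definition grazing (F : field) (C : state) (mu eta : R) : set state :=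
  [set x | surface C x /\ velocity F C x mu eta = 0].

(* The periodic orbit leaves the surface at x0, flows with C^T x > 0 for a time
   T and is then mapped back to x0 by the reset law. *)
Definition single_impact_limit_cycle (F Reset : field) (C : state)
    (mu eta : R) (x0 : state) : Prop :=
  exists (T : R) (x : R -> state),
    [/\ 0 < T, is_solution (fun z => F z mu eta) T x &
        x 0 = x0] /\
    [/\ outgoing F C mu eta x0,
        (forall t : R, 0 < t < T -> 0 < dotv C (x t)),
        incoming F C mu eta (x T) &
        Reset (x T) mu eta = x0].

(* Coefficients of the expansions F = A x + M mu + O((|x| + |mu|)^2) and
   W = - B + O(|x| + |mu|) at (0; 0, eta). *)
Definition coefA (F : field) (eta : R) : 'M[R]_m.+1 :=
  jac (fun x => F x 0 eta) 0.

Definition coefM (F : field) (eta : R) : state :=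
  'D_1 (fun mu : R => F 0 mu eta) 0.

Definition coefB (W : field) (eta : R) : state := - W 0 0 eta.

Definition blowup_field (F : field) : field := fun y mu eta =>
  if mu == 0 then coefA F eta *m y + coefM F eta
  else mu^-1 *: F (mu *: y) mu eta.

Definition blowup_reset (F W Reset : field) (C : state) : field :=
  fun y mu eta =>
  if mu == 0 then
    (1%:M - coefB W eta *m C^T *m coefA F eta) *m y
      - coefB W eta *m C^T *m coefM F eta
  else mu^-1 *: Reset (mu *: y) mu eta.

Definition frame (C : state) (Q : 'M[R]_(m, m.+1)) : 'M[R]_m.+1 :=
  (col_mx C^T Q : 'M[R]_(1 + m, m.+1)).

(* The point y of the surface with Q *m y = u. *)
Definition zeta_inv (C : state) (Q : 'M[R]_(m, m.+1)) (u : 'cV[R]_m) : state :=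
  invmx (frame C Q) *m (col_mx 0 u : 'cV[R]_(1 + m)).

(* Graph of the Poincare map. For the fields considered here it is functional,
   by uniqueness of solutions, and [tau] is the first return time. *)
Definition poincare_graph (F W Reset : field) (C : state)
    (Q : 'M[R]_(m, m.+1)) (mu eta : R) (u u' : 'cV[R]_m) : Prop :=
  let Ft := blowup_field F in
  let Rt := blowup_reset F W Reset C in
  outgoing Ft C mu eta (zeta_inv C Q u) /\
  exists (tau : R) (y : R -> state),
    [/\ 0 < tau, is_solution (fun z => Ft z mu eta) tau y &
        y 0 = zeta_inv C Q u] /\
    [/\ (forall t : R, 0 < t < tau -> ~ surface C (y t)),
        incoming Ft C mu eta (y tau) &
        u' = Q *m Rt (y tau) mu eta].

Definition poincare_defined (F W Reset : field) (C : state)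
    (Q : 'M[R]_(m, m.+1)) (u : 'cV[R]_m) (mu eta : R) : Prop :=
  exists u', poincare_graph F W Reset C Q mu eta u u'.

(* Total version, with the arbitrary value 0 outside [poincare_defined]. *)
Definition poincare (F W Reset : field) (C : state) (Q : 'M[R]_(m, m.+1))
    (u : 'cV[R]_m) (mu eta : R) : 'cV[R]_m :=
  xget 0 (poincare_graph F W Reset C Q mu eta u).

Definition saddle_node_of_limit_cycles (F W Reset : field) (C : state)
    (Q : 'M[R]_(m, m.+1)) (mu eta : R) : Prop :=
  exists u : 'cV[R]_m,
    single_impact_limit_cycle F Reset C mu eta (mu *: zeta_inv C Q u) /\
    saddle_node (fun x e => poincare_defined F W Reset C Q x mu e)
      (fun x e => poincare F W Reset C Q x mu e) u eta.

End Hybrid.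

(* Main.v *)
Require Import Defs.
From HB Require Import structures.
From mathcomp Require Import all_boot all_order all_algebra.
From mathcomp Require Import all_classical all_reals all_analysis.
From mathcomp Require Import complex.
From mathcomp Require Import ring lra.

Set Implicit Arguments.
Unset Strict Implicit.
Unset Printing Implicit Defensive.

Import Order.TTheory GRing.Theory Num.Theory.
Import numFieldNormedType.Exports.

Local Open Scope classical_set_scope.
Local Open Scope ring_scope.

(** The theorem is true because, after blowing up, nothing singular happens at
    mu = 0: the return map P(u; mu, eta) is smooth on a full neighbourhood of
    (uhat; 0, 0), and a generic saddle-node of a family of maps is not
    destroyed by an additional smooth parameter.

    Smoothness.  The blown-up field F(mu y; mu, eta) / mu is given at mu = 0 by
    a separate formula, namely the derivative of F along the ray through y.
    Both cases are the time-one value of one differential equation, the one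
    solved by t |-> F(t mu y; t mu, eta) / mu, so that smooth dependence of
    solutions on their data gives class C^(k-1) in all variables
    ([blowup_Ck]).  The return time solves the equation C^T y(t) = 0, whose
    time derivative is the incoming velocity and hence nonzero; the implicit
    function theorem makes it smooth, and a compactness argument on the orbit
    excludes earlier returns for nearby data.  So the return map is C^(k-1) and
    defined on an open set ([return_map_smooth]).

    Persistence.  Since 1 is a simple eigenvalue and w^T P_eta <> 0, the
    equations P(u; mu, eta) = u and w^T (u - uhat) = s can be solved for
    (u, eta) = h(s, mu) ([fixed_point_curve]).  For fixed mu the fixed points
    thus form a curve parametrized by s, and a saddle-node is a critical point
    of the parameter eta along that curve.  Differentiating the fixed point
    equation once shows that at such a point the velocity of u is a right
    eigenvector for the eigenvalue 1; differentiating it twice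
    ([curve_second]) gives
      w'^T D2P(v', v') = - eta_ss w'^T P_eta
    for the corresponding left eigenvector w'.  At mu = 0 the hypotheses say
    that eta_ss <> 0, and the equation eta_s = 0 has a solution s = sigma(mu)
    ([fold_branch]); then g(mu) = eta(sigma(mu), mu), and the derivative used
    in eta_s accounts for the class C^(k-2).  The eigenvalue 1 stays simple
    and alone on the unit circle ([simple_unit_eigenvalue_near]);
    w'^T P_eta stays nonzero because the linearized equations for (u, eta)
    stay injective, and then so does the quadratic coefficient by the displayed
    identity; and eta behaves like a parabola in s, which counts the fixed
    points on the two sides ([curve_fold_unfolding]).  All this is [fold_persistence].

    Return to the original system.  For mu > 0, multiplying the blown-up orbit
    of a fixed point by mu gives the limit cycle ([fixed_point_cycle]).

    The calculus behind this, namely C^k maps between finite-dimensional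
    spaces, implicit functions and flows, follows one pattern: the case k = 1
    is proved by estimates, in the form of strict differentiability, and the
    derivative of the object (implicit function or flow) is again an object of
    the same kind for an extended equation on a product space, which drives an
    induction on k. *)

(** * Finite-dimensional normed spaces *)

Section Coordinates.
Context {R : realType}.

(** A basis in which the norm is the largest modulus of a coordinate. Real numbers, matrices and
    products have one; the inductions on k below need a notion that is stable
    under products. *)
Class coords (V : normedModType R) := Coords {
  cidx : finType;
  cbasis : cidx -> V;
  cco : cidx -> V -> R;
  cco_is_linear : forall i, linear (cco i : V -> R^o);
  cco_sum : forall x, x = \sum_i cco i x *: cbasis i;
  cco_basis : forall i j, cco i (cbasis j) = (i == j)%:R;
  cco_le : forall i x, `|cco i x| <= `|x|;
  norm_le_cco : forall x r, 0 <= r -> (forall i, `|cco i x| <= r) -> `|x| <= r }.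

#[global] Instance coordsR : coords R.
Proof.
exists unit (fun=> 1) (fun _ x => x) => //.
- by move=> x; rewrite (bigD1 tt) //= big1 ?addr0; [rewrite [_ *: _]mulr1|case].
- by move=> x r _ /(_ tt).
Defined.

#[global] Instance coords_prod (V W : normedModType R) (cV : coords V)
  (cW : coords W) : coords (V * W)%type.
Proof.
exists (cidx (V:=V) + cidx (V:=W))%type
  (fun i => match i with inl j => (cbasis j, 0) | inr j => (0, cbasis j) end)
  (fun i x => match i with inl j => cco j x.1 | inr j => cco j x.2 end).
- by move=> [] i a x y /=; rewrite cco_is_linear.
- case=> x y; rewrite big_sumType [RHS]surjective_pairing; congr pair.
  + rewrite raddfD /= !(raddf_sum (@fst V W)) /= {1}(cco_sum x).
    by rewrite [X in _ = _ + X]big1 ?addr0// => i _; rewrite scaler0.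
  + rewrite raddfD /= !(raddf_sum (@snd V W)) /= {1}(cco_sum y).
    by rewrite [X in _ = X + _]big1 ?add0r// => i _; rewrite scaler0.
- move=> [] i [] j /=.
  + by rewrite cco_basis.
  + by have := cco_is_linear i (-1) 0 0; rewrite !scaleN1r !addNr.
  + by have := cco_is_linear i (-1) 0 0; rewrite !scaleN1r !addNr.
  + by rewrite cco_basis.
- move=> [] i [x y] /=; apply: (le_trans (cco_le _ _)).
  + by rewrite prod_normE /= le_max lexx.
  + by rewrite prod_normE /= le_max lexx orbT.
- move=> [x y] r r0 H; rewrite prod_normE /= ge_max; apply/andP; split.
  + by apply: norm_le_cco => // i; apply: (H (inl i)).
  + by apply: norm_le_cco => // i; apply: (H (inr i)).
Defined.

#[global] Instance coords_mx p q : coords 'M[R]_(p, q).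
Proof.
exists ('I_p * 'I_q)%type (fun i : 'I_p * 'I_q => delta_mx i.1 i.2)
  (fun (i : 'I_p * 'I_q) (x : 'M[R]_(p, q)) => x i.1 i.2).
- by move=> i a x y /=; rewrite !mxE.
- by move=> x; rewrite {1}(matrix_sum_delta x) pair_big.
- by move=> [i i'] [j j'] /=; rewrite mxE xpair_eqE.
- move=> i x; rewrite /Num.norm /= mx_normrE.
  by apply: le_bigmax.
- move=> x r r0 H; rewrite /Num.norm /= mx_normrE.
  by apply: bigmax_le => // i _; apply: H.
Defined.

End Coordinates.

(** * Maps of class C^k *)

Section CoordLinear.
Context {R : realType}.

HB.instance Definition _ (V : normedModType R) (c : coords V) (i : cidx (V:=V)) :=
  GRing.isLinear.Build R V R^o *:%R (cco i) (cco_is_linear i).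

Context {V W : normedModType R} {cV : coords V}.

Lemma lin_cco (f : {linear V -> W}) x :
  f x = \sum_i cco i x *: f (cbasis i).
Proof.
rewrite {1}(cco_sum x) linear_sum; apply: eq_bigr => i _.
by rewrite linearZ.
Qed.

Lemma lin_bound (f : {linear V -> W}) x :
  `|f x| <= (\sum_i `|f (cbasis i)|) * `|x|.
Proof.
rewrite lin_cco; apply: (le_trans (ler_norm_sum _ _ _)).
rewrite mulr_suml; apply: ler_sum => i _.
by rewrite normrZ mulrC ler_wpM2l// cco_le.
Qed.

Lemma lin_boundW (f : {linear V -> W}) : exists2 C : R, 0 < C & forall x, `|f x| <= C * `|x|.
Proof.
exists (\sum_i `|f (cbasis i)| + 1) => [|x].
  by rewrite ltr_wpDl// sumr_ge0.
by apply: (le_trans (lin_bound f x)); rewrite ler_wpM2r// lerDl.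
Qed.

Lemma lin_continuous (f : {linear V -> W}) : continuous f.
Proof.
apply: bounded_linear_continuous; apply/ linear_boundedP.
near=> M => x; apply: (le_trans (lin_bound f x)).
by rewrite ler_wpM2r//; near: M; apply: nbhs_pinfty_ge; rewrite num_real.
Unshelve. all: by end_near. Qed.

End CoordLinear.

Section CkBasic.
Context {R : realType}.
Implicit Types (U V W : normedModType R).

Lemma Ck_sub V W k (A B : set V) (f : V -> W) : A `<=` B -> Ck k B f -> Ck k A f.
Proof.
move=> AB; elim: k f => [|k IH] f /=; first by move=> H x /AB /H.
by move=> [d H]; split=> [x /AB /d //|v]; apply: IH.
Qed.

Lemma Ck_S V W k (A : set V) (f : V -> W) : Ck k.+1 A f -> Ck k A f.
Proof.
elim: k f => [|k IH] f /=; first by move=> [d _] x /d; exact: differentiable_continuous.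
by move=> [d H]; split=> // v; apply: IH; apply: H.
Qed.

Lemma Ck_le V W j k (A : set V) (f : V -> W) : (j <= k)%N -> Ck k A f -> Ck j A f.
Proof.
move=> /subnK <-; elim: (k - j)%N => // n IH; rewrite addSn => /Ck_S; exact: IH.
Qed.

Lemma Ck_cont V W k (A : set V) (f : V -> W) x : Ck k A f -> A x -> {for x, continuous f}.
Proof. by move=> /(@Ck_le _ _ 0 k _ _ isT) /= H /H. Qed.

Lemma Ck_diff V W k (A : set V) (f : V -> W) x : Ck k.+1 A f -> A x -> differentiable f x.
Proof. by move=> [H _] /H. Qed.

Lemma differentiable_eps V W (f : V -> W) x (e : R) : 0 < e -> differentiable f x ->
  \forall y \near x, `|f y - f x - 'd f x (y - x)| <= e * `|y - x|.
Proof.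
move=> e0 /diff_locallyP[_ /eqaddoP/(_ _ e0)].
rewrite [X in _ -> X](near_shift 0 x) subr0.
by apply: filterS => h /=; rewrite addrK opprD addrA.
Qed.

(** The estimates below produce the little-o condition in this form, with the
    increments taken at the point. *)
Lemma eps_is_diff V W (f : V -> W) x (L : {linear V -> W}) : continuous L ->
  (forall e, 0 < e -> \forall y \near x, `|f y - f x - L (y - x)| <= e * `|y - x|) ->
  is_diff x f L.
Proof.
move=> cL H.
have E : f \o shift x = cst (f x) + L +o_ 0 id.
  apply/eqaddoP => e /H; rewrite [X in X -> _](near_shift 0 x) subr0.
  by apply: filterS => h /=; rewrite addrK opprD addrA.
have dE := diff_unique cL E.
by split => //; apply/diff_locallyP; rewrite dE.
Qed.

Lemma near_eq_differentiable V W (f g : V -> W) x : (\forall y \near x, f y = g y) ->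
  differentiable f x -> differentiable g x.
Proof.
move=> fg df; suff: is_diff x g ('d f x) by case.
apply: eps_is_diff; first exact: diff_continuous.
move=> e e0; have fgx := nbhs_singleton fg.
by near=> y; rewrite -fgx -(near fg y)//; near: y; exact: differentiable_eps.
Unshelve. all: by end_near. Qed.

(** Derivatives at a point depend only on the values nearby; here it matters that
    A is open. *)
Lemma Ck_ext V W k (A : set V) (f g : V -> W) : open A ->
  (forall x, A x -> f x = g x) -> Ck k A f -> Ck k A g.
Proof.
move=> oA; elim: k f g => [|k IH] f g fg /=.
  move=> H x Ax; have fgx : \forall y \near x, f y = g y.
    by apply: filterS (open_nbhs_nbhs (conj oA Ax)) => y /fg.
  rewrite /prop_for /continuous_at -(fg x Ax).
  by apply: cvg_trans (H x Ax); apply: near_eq_cvg.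
move=> [d H].
have nfg x : A x -> \forall y \near x, f y = g y.
  by move=> Ax; apply: filterS (open_nbhs_nbhs (conj oA Ax)) => y /fg.
split=> [x Ax|v]; first by apply: near_eq_differentiable (d x Ax); exact: nfg.
apply: IH (H v) => x Ax; apply: near_eq_derive; exact: nfg.
Qed.

End CkBasic.

Section CkAlgebra.
Context {R : realType}.
Implicit Types (U V W : normedModType R).

Lemma scale_is_bilinear W :
  bilinear_for
    (GRing.Scale.Law.clone _ _ *:%R _) (GRing.Scale.Law.clone _ _ *:%R _)
    (@GRing.scale R W : R -> W -> W).
Proof.
split=> [u|a] b x y /=.
- by rewrite scalerDl -scalerA.
- by rewrite scalerDr !scalerA mulrC.
Qed.

HB.instance Definition _ W := bilinear_isBilinear.Build R R W W _ _
  (@GRing.scale R W : R -> W -> W) (@scale_is_bilinear W).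

Lemma is_diff_scale V W (f : V -> R) (g : V -> W) x :
  differentiable f x -> differentiable g x ->
  is_diff x (fun y => f y *: g y) (fun v => f x *: 'd g x v + 'd f x v *: g x).
Proof.
move=> df dg.
have c : continuous (fun p : R * W => (@GRing.scale R W : R -> W -> W) p.1 p.2).
  by move=> p; exact: (@scale_continuous R W).
have ds := @differentiable_bilin R R W W (@GRing.scale R W : R -> W -> W) (f x, g x) c.
have es := @diff_bilin R R W W (@GRing.scale R W : R -> W -> W) (f x, g x) c.
have dp := differentiable_pair df dg.
have -> : (fun y => f y *: g y) = (fun p : R * W => p.1 *: p.2) \o (fun y => (f y, g y)) by [].
split; first exact: differentiable_comp.
by rewrite diff_comp // es diff_pair.
Qed.

Lemma derive_scale V W (f : V -> R) (g : V -> W) x v :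
  differentiable f x -> differentiable g x ->
  'D_v (fun y => f y *: g y) x = f x *: 'D_v g x + 'D_v f x *: g x.
Proof.
move=> df dg; have [d e] := is_diff_scale df dg.
by rewrite deriveE // e !deriveE.
Qed.

Lemma derive_comp U V W (f : U -> V) (g : V -> W) x v :
  differentiable f x -> differentiable g (f x) ->
  'D_v (g \o f) x = 'D_('D_v f x) g (f x).
Proof.
move=> df dg; have dc := differentiable_comp df dg.
by rewrite (deriveE v dc) (deriveE ('D_v f x) dg) (deriveE v df) diff_comp.
Qed.

Lemma derive_pair V W U (f : U -> V) (g : U -> W) x v :
  differentiable f x -> differentiable g x ->
  'D_v (fun y => (f y, g y)) x = ('D_v f x, 'D_v g x).
Proof.
move=> df dg; have dc := differentiable_pair df dg.
by rewrite (deriveE v dc) (deriveE v df) (deriveE v dg) diff_pair.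
Qed.

Lemma derive_linear V W (f : {linear V -> W}) x v : continuous f -> 'D_v f x = f v.
Proof. by move=> cf; rewrite deriveE ?diff_lin//; exact: linear_differentiable. Qed.

Lemma derive_cco V W {cV : coords V} (f : V -> W) x v : differentiable f x ->
  'D_v f x = \sum_i cco i v *: 'D_(cbasis i) f x.
Proof.
by move=> df; rewrite deriveE // lin_cco; under eq_bigr do rewrite -deriveE//.
Qed.

Lemma Ck_cst V W k (A : set V) (c : W) : Ck k A (fun _ => c).
Proof.
elim: k c => [|k IH] c /=; first by move=> x _; exact: cvg_cst.
split=> [x _|v]; first exact: differentiable_cst.
by rewrite (_ : 'D_v _ = fun=> 0); [exact: IH | apply/funext => x; exact: derive_cst].
Qed.

Lemma Ck_lin V W k (A : set V) (f : {linear V -> W}) : continuous f -> Ck k A f.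
Proof.
move=> cf; case: k => [|k] /=; first by move=> x _; exact: cf.
split=> [x _|v]; first exact: linear_differentiable.
rewrite (_ : 'D_v _ = fun=> f v); first exact: Ck_cst.
by apply/funext => x; exact: derive_linear.
Qed.

Lemma Ck_id V k (A : set V) : Ck k A (fun x => x).
Proof. by apply: (Ck_lin _ _ (f := idfun)) => x; exact: cvg_id. Qed.

Lemma Ck_add V W k (A : set V) (f g : V -> W) : open A ->
  Ck k A f -> Ck k A g -> Ck k A (fun x => f x + g x).
Proof.
move=> oA; elim: k f g => [|k IH] f g /=.
  by move=> cf cg x Ax; apply: continuousD; [exact: cf|exact: cg].
move=> [df hf] [dg hg]; split=> [x Ax|v].
  by apply: differentiableD; [exact: df|exact: dg].
apply: (Ck_ext oA _ (IH _ _ (hf v) (hg v))) => x Ax.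
by rewrite deriveD//; apply: diff_derivable; [exact: df|exact: dg].
Qed.

Lemma Ck_scale V W k (A : set V) (f : V -> R) (g : V -> W) : open A ->
  Ck k A f -> Ck k A g -> Ck k A (fun x => f x *: g x).
Proof.
move=> oA; elim: k f g => [|k IH] f g.
  by move=> cf cg x Ax; apply: continuousZ; [exact: cf|exact: cg].
move=> kf kg; have [df hf] := kf; have [dg hg] := kg; split=> [x Ax|v].
  by case: (is_diff_scale (df x Ax) (dg x Ax)).
apply: (Ck_ext (f := fun x => f x *: 'D_v g x + 'D_v f x *: g x) oA) => [x Ax|].
  by rewrite derive_scale//; [exact: df|exact: dg].
by apply: Ck_add => //; apply: IH; [exact: Ck_S kf|exact: hg|exact: hf|exact: Ck_S kg].
Qed.

Lemma Ck_sum V W k (A : set V) (I : Type) (s : seq I) (f : I -> V -> W) : open A ->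
  (forall i, Ck k A (f i)) -> Ck k A (fun x => \sum_(i <- s) f i x).
Proof.
move=> oA H; elim: s => [|i s IH].
  apply: (Ck_ext oA _ (@Ck_cst V W k A 0)) => x _; by rewrite big_nil.
apply: (Ck_ext oA _ (Ck_add oA (H i) IH)) => x _; by rewrite big_cons.
Qed.

Lemma Ck_linl U V W k (A : set U) (L : {linear V -> W}) (f : U -> V) :
  open A -> continuous L -> Ck k A f -> Ck k A (fun x => L (f x)).
Proof.
move=> oA cL; elim: k f => [|k IH] f.
  move=> cf x Ax; apply: (continuous_comp (f := f) (g := L)); [exact: cf|exact: cL].
move=> [df hf]; split=> [x Ax|v].
  apply: (differentiable_comp (f := f) (g := L)); first exact: df.
  exact: linear_differentiable.
apply: (Ck_ext oA _ (IH _ (hf v))) => x Ax.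
rewrite (derive_comp (g := L)) ?derive_linear//; [exact: df|exact: linear_differentiable].
Qed.

Lemma Ck_pair U V W k (A : set U) (f : U -> V) (g : U -> W) : open A ->
  Ck k A f -> Ck k A g -> Ck k A (fun x => (f x, g x)).
Proof.
move=> oA; elim: k f g => [|k IH] f g.
  by move=> cf cg x Ax; apply: cvg_pair; [exact: cf|exact: cg].
move=> [df hf] [dg hg]; split=> [x Ax|v].
  by apply: differentiable_pair; [exact: df|exact: dg].
apply: (Ck_ext oA _ (IH _ _ (hf v) (hg v))) => x Ax.
by rewrite derive_pair//; [exact: df|exact: dg].
Qed.

(** In coordinates the chain rule writes the derivative of g o f as the sum over
    i of (D_v f)_i times (D_i g) o f; the induction hypothesis applies to each
    factor, and finite dimension of the middle space is what makes the sum
    finite. *)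
Lemma Ck_comp U V W {cV : coords V} k (A : set U) (B : set V) (f : U -> V) (g : V -> W) :
  open A -> (forall x, A x -> B (f x)) ->
  Ck k A f -> Ck k B g -> Ck k A (fun x => g (f x)).
Proof.
move=> oA AB; elim: k f g AB => [|k IH] f g AB.
  by move=> cf cg x Ax; apply: (continuous_comp (f := f) (g := g));
    [exact: cf|exact/cg/AB].
move=> kf kg; have [df hf] := kf; have [dg hg] := kg; split=> [x Ax|v].
  by apply: (differentiable_comp (f := f) (g := g)); [exact: df|exact/dg/AB].
apply: (Ck_ext (f := fun x => \sum_i cco i ('D_v f x) *: 'D_(cbasis i) g (f x)) oA).
  move=> x Ax; rewrite (derive_comp (g := g)); [|exact: df|exact/dg/AB].
  by rewrite [RHS]derive_cco//; exact/dg/AB.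
apply: Ck_sum => // i; apply: Ck_scale => //.
  apply: (Ck_linl (L := cco i)) => //; [exact: lin_continuous|exact: hf].
by apply: (IH f ('D_(cbasis i) g)) => //; [exact: Ck_S kf|exact: hg].
Qed.

Lemma Ck_fst U V W k (A : set U) (f : U -> V * W) : open A ->
  Ck k A f -> Ck k A (fun x => (f x).1).
Proof. by move=> oA; apply: (Ck_linl (L := @fst V W)) => // x; exact: cvg_fst. Qed.

Lemma Ck_snd U V W k (A : set U) (f : U -> V * W) : open A ->
  Ck k A f -> Ck k A (fun x => (f x).2).
Proof. by move=> oA; apply: (Ck_linl (L := @snd V W)) => // x; exact: cvg_snd. Qed.

Lemma openT_prod V W (A : set V) : open A -> open (A `*` [set: W]).
Proof.
move=> oA; rewrite (_ : _ `*` _ = @fst V W @^-1` A).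
  by apply: open_comp => // x _; exact: cvg_fst.
by apply/seteqP; split=> x; [case|].
Qed.

(** Joint regularity in point and direction: the dependence on the direction is
    linear, so that only finitely many partial derivatives enter. *)
Lemma Ck_dir V W {cV : coords V} k (A : set V) (f : V -> W) : open A -> Ck k.+1 A f ->
  Ck k (A `*` [set: V]) (fun p : V * V => 'D_(p.2) f p.1).
Proof.
move=> oA [df hf]; have oAT : open (A `*` [set: V]) by exact: openT_prod.
apply: (Ck_ext (f := fun p : V * V => \sum_i cco i p.2 *: 'D_(cbasis i) f p.1) oAT).
  by move=> [x v] [Ax _] /=; rewrite [RHS]derive_cco//; exact: df.
apply: Ck_sum => // i; apply: Ck_scale => //.
  apply: (Ck_linl (L := cco i)) => //; first exact: lin_continuous.
  by apply: Ck_snd => //; exact: Ck_id.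
apply: (Ck_comp (B := A) (f := fst) (g := 'D_(cbasis i) f)) => //.
- by move=> [x v] [].
- by apply: Ck_fst => //; exact: Ck_id.
- exact: hf.
Qed.

End CkAlgebra.

(** * Mean value inequality and strict differentiability *)

Section MeanValue.
Context {R : realType}.
Implicit Types (V W : normedModType R).

Lemma within_comp V W (T : topologicalType) (A : set T) (y : T -> V) (g : V -> W) :
  {within A, continuous y} -> continuous g -> {within A, continuous (fun t => g (y t))}.
Proof. by move=> cy cg x; apply: (@continuous_comp (subspace A) V W y g x); [exact: cy|exact: cg]. Qed.

Lemma is_derive_curve V W (f : V -> W) (y : R -> V) (t : R) (dy : V) :
  differentiable f (y t) -> is_derive t 1 y dy ->
  is_derive t 1 (fun s => f (y s)) ('D_dy f (y t)).
Proof.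
move=> df [dy1 dy2]; have dy3 : differentiable y t by exact/derivable1_diffP.
split; last by rewrite -dy2 -(derive_comp (f := y)).
by apply/derivable1_diffP; apply: (differentiable_comp (f := y)).
Qed.

Lemma is_derive_lin V W (f : {linear V -> W}) (y : R -> V) (t : R) (dy : V) :
  continuous f -> is_derive t 1 y dy -> is_derive t 1 (fun s => f (y s)) (f dy).
Proof.
move=> cf dy1; rewrite -(derive_linear (y t) dy cf).
by apply: is_derive_curve dy1; exact: linear_differentiable.
Qed.

Lemma is_derive_line V (b v : V) (t : R) : is_derive t 1 (fun s => b + s *: v) v.
Proof.
apply: (is_derive_eq (f' := 0 + v)); last by rewrite add0r.
apply: is_deriveD; split; first exact/derivable1_diffP.
by rewrite deriveE // diff_val scale1r.
Qed.

(** The real mean value theorem makes psi + y_i and psi - y_i nondecreasing for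
    every coordinate y_i. A variable majorant psi, rather than a constant, is
    needed for exponential weights. *)
Lemma mean_value_le V {cV : coords V} (y dy : R -> V) (psi dpsi : R -> R) (a b : R) :
  a <= b -> {within `[a, b], continuous y} -> {within `[a, b], continuous psi} ->
  (forall t, a < t < b -> is_derive t 1 y (dy t)) ->
  (forall t, a < t < b -> is_derive t 1 psi (dpsi t)) ->
  (forall t, a < t < b -> `|dy t| <= dpsi t) ->
  `|y b - y a| <= psi b - psi a.
Proof.
move=> ab cy cpsi hy hpsi le.
have mono (g dg : R -> R) : {within `[a, b], continuous g} ->
    (forall t, a < t < b -> is_derive t 1 g (dg t)) ->
    (forall t, a < t < b -> 0 <= dg t) -> g a <= g b.
  move=> cg hg pg; move: ab; rewrite le_eqVlt => /predU1P[->//|ab'].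
  have hg' x : x \in `]a, b[ -> is_derive x 1 g (dg x) by rewrite in_itv => /hg.
  have [c] := MVT ab' hg' cg.
  by rewrite in_itv /= => /pg c0 E; rewrite -subr_ge0 E mulr_ge0 ?subr_ge0 ?(ltW ab').
have psi0 : psi a <= psi b.
  apply: (mono _ dpsi) => // t /le; exact: le_trans.
apply: norm_le_cco; first by rewrite subr_ge0.
move=> i; rewrite linearB /= ler_norml; apply/andP; split.
- rewrite -subr_ge0 opprK.
  have /= := mono (fun t => cco i (y t) + psi t) (fun t => cco i (dy t) + dpsi t).
  suff H : [/\ {within `[a, b], continuous (fun t => cco i (y t) + psi t)},
    (forall t, a < t < b -> is_derive t 1 (fun t => cco i (y t) + psi t) (cco i (dy t) + dpsi t)) &
    (forall t, a < t < b -> 0 <= cco i (dy t) + dpsi t)].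
    by case: H => H1 H2 H3 /(_ H1 H2 H3); lra.
  split.
  + move=> x; apply: (continuousD (f := (fun t => cco i (y t)) : subspace `[a, b] -> R^o) (g := psi : subspace `[a, b] -> R^o)).
      apply: (within_comp (g := cco i) cy); exact: (lin_continuous (W := R^o)).
    exact: cpsi.
  + move=> t tab; apply: is_deriveD; last exact: hpsi.
    by apply: (is_derive_lin (W := R^o) (f := cco i)); [exact: lin_continuous|exact: hy].
  + move=> t tab; have := le_trans (cco_le i (dy t)) (le t tab).
    by rewrite ler_norml; lra.
- have /= := mono (fun t => psi t - cco i (y t)) (fun t => dpsi t - cco i (dy t)).
  suff H : [/\ {within `[a, b], continuous (fun t => psi t - cco i (y t))},
    (forall t, a < t < b -> is_derive t 1 (fun t => psi t - cco i (y t)) (dpsi t - cco i (dy t))) &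
    (forall t, a < t < b -> 0 <= dpsi t - cco i (dy t))].
    by case: H => H1 H2 H3 /(_ H1 H2 H3); lra.
  split.
  + move=> x; apply: (continuousB (f := psi : subspace `[a, b] -> R^o) (g := (fun t => cco i (y t)) : subspace `[a, b] -> R^o)); first exact: cpsi.
    by apply: (within_comp (g := cco i) cy); exact: (lin_continuous (W := R^o)).
  + move=> t tab; apply: is_deriveB; first exact: hpsi.
    by apply: (is_derive_lin (W := R^o) (f := cco i)); [exact: lin_continuous|exact: hy].
  + move=> t tab; have := le_trans (cco_le i (dy t)) (le t tab).
    by rewrite ler_norml; lra.
Qed.

End MeanValue.

Section Strict.
Context {R : realType}.
Context {V W : normedModType R} {cV : coords V} {cW : coords W}.

(** Two moving points instead of one: this passes to implicit functions and to
    flows by direct estimates, and on an open set it amounts to class C^1. *)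
Definition strict_diff (f : V -> W) (p : V) (L : V -> W) :=
  forall e, 0 < e -> \forall a \near p & b \near p,
    `|f a - f b - L (a - b)| <= e * `|a - b|.

Lemma strict_ball f p L : strict_diff f p L -> forall e, 0 < e ->
  exists2 d, 0 < d & forall a b, `|p - a| < d -> `|p - b| < d ->
    `|f a - f b - L (a - b)| <= e * `|a - b|.
Proof.
move=> H e /H [[P Q]] /= [/nbhs_normP[d1 d10 PH] /nbhs_normP[d2 d20 QH]] PQ.
exists (Num.min d1 d2) => [|a b]; first by rewrite lt_min; apply/andP.
rewrite !lt_min => /andP[a1 a2] /andP[b1 b2]; apply: (PQ (a, b)); split => /=.
  exact: PH.
exact: QH.
Qed.

Lemma Ck_diff_near (A : set V) (f : V -> W) p : open A -> Ck 1 A f -> A p ->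
  forall e, 0 < e -> \forall q \near p, A q /\
    forall v, `|'D_v f q - 'D_v f p| <= e * `|v|.
Proof.
move=> oA kf Ap e e0; have [df hf] := kf.
pose n := #|@cidx R V cV|; pose e' := e / n.+1%:R.
have e'0 : 0 < e' by rewrite divr_gt0.
have H i : \forall q \near p, `|'D_(cbasis i) f q - 'D_(cbasis i) f p| <= e'.
  have /cvgrPdist_le/(_ _ e'0) := hf (cbasis i) p Ap.
  by apply: filterS => q; rewrite distrC.
have HA : \forall q \near p, A q by exact: open_nbhs_nbhs.
have Hall : \forall q \near p, forall i, `|'D_(cbasis i) f q - 'D_(cbasis i) f p| <= e'.
  exact: filter_forall.
near=> q; have Aq : A q by near: q.
split => // v.
rewrite (derive_cco v (df q Aq)) (derive_cco v (df p Ap)) -sumrB.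
apply: (le_trans (ler_norm_sum _ _ _)).
apply: (@le_trans _ _ (\sum_(i : cidx (V:=V)) e' * `|v|)).
  apply: ler_sum => i _; rewrite -scalerBr normrZ mulrC ler_pM//; last exact: cco_le.
  by move: i; near: q.
rewrite sumr_const -/n -mulrnAl ler_wpM2r// -mulr_natr /e' -mulrA ler_piMr ?(ltW e0)//.
by rewrite mulrC ler_pdivrMr// mul1r ler_nat.
Unshelve. all: by end_near. Qed.

(** Apply the mean value inequality to f minus its linear part along the segment
    from b to a. *)
Lemma Ck_strict (A : set V) (f : V -> W) p : open A -> Ck 1 A f -> A p ->
  strict_diff f p ('d f p).
Proof.
move=> oA kf Ap e e0; have [df _] := kf.
have /nbhs_normP[d /= d0 H] := Ck_diff_near oA kf Ap e0.
have B : \forall a \near p, `|p - a| < d by apply/nbhs_normP; exists d.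
near=> a b.
have ad : `|p - a| < d by near: a.
have bd : `|p - b| < d by near: b.
pose q (t : R) := b + t *: (a - b).
have Hq (t : R) : 0 <= t <= 1 -> A (q t) /\ forall v, `|'D_v f (q t) - 'D_v f p| <= e * `|v|.
  move=> /andP[t0 t1]; apply: H; rewrite /=.
  have -> : p - q t = (1 - t) *: (p - b) + t *: (p - a).
    rewrite scalerBl scale1r -addrA [in RHS](addrC (- _)) -scalerBr opprB.
    by rewrite [X in _ *: X]addrC subrKA /q opprD addrA -scalerN opprB.
  apply: (le_lt_trans (ler_normD _ _)); rewrite !normrZ !ger0_norm ?subr_ge0//.
  move: t0; rewrite le_eqVlt => /predU1P[<-|t0].
    by rewrite subr0 mul1r mul0r addr0.
  rewrite [ltRHS](_ : d = (1 - t) * d + t * d); last by ring.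
  by rewrite ler_ltD// ?ltr_pM2l// ler_wpM2l ?subr_ge0// ltW.
pose y (t : R) := f (q t) - t *: 'd f p (a - b).
have dy (t : R) : 0 <= t <= 1 -> is_derive t 1 y ('D_(a - b) f (q t) - 'D_(a - b) f p).
  move=> /Hq[Aq _]; apply: is_deriveB.
    apply: (is_derive_curve (y := q)); first exact: df.
    exact: is_derive_line.
  have := is_derive_line 0 ('d f p (a - b)) t.
  by under eq_fun do rewrite add0r; rewrite (deriveE _ (df _ Ap)).
have := @mean_value_le R W cW y (fun t => 'D_(a - b) f (q t) - 'D_(a - b) f p)
  (fun t => t * (e * `|a - b|)) (fun=> e * `|a - b|) 0 1 ler01 _ _ _ _ _.
rewrite /y /q scale1r scale0r addr0 subrKC scale1r scale0r subr0 mul0r subr0 mul1r addrAC.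
apply.
- apply: derivable_within_continuous => t; rewrite in_itv /= => /dy [].
  by [].
- move=> t; apply: continuous_subspaceT => x; apply: mulrr_continuous.
- by move=> t /andP[t0 t1]; apply: dy; rewrite !ltW.
- move=> t _; have := is_derive_line (0 : R) (e * `|a - b|) t.
  by under eq_fun do rewrite add0r.
- by move=> t /andP[t0 t1]; apply: (Hq t _).2; rewrite !ltW.
Unshelve. all: by end_near. Qed.

End Strict.

(** * Contractions and inverses of linear maps *)

Section GeoLimit.
Context {R : realType}.
Local Notation h := (2^-1 : R).

(** Lets the index tend to infinity in a bound with a geometric error. *)
Lemma geo_small (x a M : R) : (forall n, x <= a + M * h ^+ n) -> x <= a.
Proof.
move=> H; rewrite leNgt; apply/negP => ax.
have h1 : `|h| < 1 by rewrite ger0_norm// invf_lt1// ltr1n.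
have /cvgrPdist_lt/(_ (x - a)) := @cvg_geometric R M h h1.
rewrite subr_gt0 => /(_ ax)[n _ /(_ n (leqnn n))] /=; rewrite sub0r normrN => Hn.
have := le_lt_trans (ler_norm _) Hn; have := H n; lra.
Qed.

(** The limit is the supremum of the lower bounds u n - 2 M / 2^n, which increase
    while the corresponding upper bounds decrease. *)
Lemma geo_limR (u : nat -> R) (M : R) : 0 <= M ->
  (forall n, `|u n.+1 - u n| <= M * h ^+ n) ->
  exists l, forall n, `|u n - l| <= 2 * M * h ^+ n.
Proof.
move=> M0 H.
pose a n := u n - 2 * M * h ^+ n; pose b n := u n + 2 * M * h ^+ n.
have Hn n : u n - M * h ^+ n <= u n.+1 <= u n + M * h ^+ n.
  by have := H n; rewrite ler_norml; lra.
have aS n : a n <= a n.+1 by have := Hn n; rewrite /a exprS; lra.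
have bS n : b n.+1 <= b n by have := Hn n; rewrite /b exprS; lra.
have ha : {homo a : n m / (n <= m)%N >-> n <= m}
  by apply: (homo_leq (r := fun x y => x <= y)) => // y x z; exact: le_trans.
have hb : {homo b : n m / (n <= m)%N >-> m <= n}.
  by apply: (homo_leq (r := fun x y => y <= x)) => // y x z xy yz; exact: le_trans yz xy.
have ab n m : a n <= b m.
  apply: (le_trans (ha _ _ (leq_maxl n m))); apply: le_trans (hb _ _ (leq_maxr n m)).
  rewrite /a /b; set k := maxn n m; have : 0 <= M * h ^+ k by rewrite mulr_ge0// exprn_ge0.
  lra.
have aub m : ubound (range a) (b m) by move=> _ [n _ <-].
exists (sup (range a)) => n; rewrite ler_distl; apply/andP; split.
  have : sup (range a) <= b n by apply: ge_sup => //; exists (a 0); exists 0.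
  by rewrite /b; lra.
have : a n <= sup (range a) by apply: ub_le_sup; [exists (b 0)|exists n].
by rewrite /a; lra.
Qed.

Context {V : normedModType R} {cV : coords V}.

Lemma cco_comb (l : cidx (V:=V) -> R) i :
  cco i (\sum_j l j *: cbasis j) = l i.
Proof.
rewrite linear_sum (bigD1 i) //= big1 ?addr0.
  by rewrite linearZ /= cco_basis eqxx [_ *: _]mulr1.
by move=> j ji; rewrite linearZ /= cco_basis eq_sym (negbTE ji) [_ *: _]mulr0.
Qed.

Lemma geo_lim (u : nat -> V) (M : R) : 0 <= M ->
  (forall n, `|u n.+1 - u n| <= M * h ^+ n) ->
  exists l, forall n, `|u n - l| <= 2 * M * h ^+ n.
Proof.
move=> M0 H.
have /choice[l Hl] : forall i, exists li, forall n, `|cco i (u n) - li| <= 2 * M * h ^+ n.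
  move=> i; apply: (geo_limR (u := fun n => cco i (u n))) => // n.
  by rewrite -[X in `|X|](linearB (cco i)); apply: le_trans (cco_le _ _) (H n).
exists (\sum_j l j *: cbasis j) => n; apply: norm_le_cco.
  by rewrite !mulr_ge0// exprn_ge0.
by move=> i; rewrite linearB /= cco_comb.
Qed.

Lemma contraction_fixed (T : V -> V) (v0 : V) (r : R) : 0 <= r ->
  (forall v, `|v - v0| <= r -> `|T v - v0| <= r) ->
  (forall v v', `|v - v0| <= r -> `|v' - v0| <= r -> `|T v - T v'| <= h * `|v - v'|) ->
  exists2 v, `|v - v0| <= r & T v = v.
Proof.
move=> r0 TB TC; pose x n := iter n T v0.
have xB n : `|x n - v0| <= r by elim: n => [|n /TB//]; rewrite /x /= subrr normr0.
have xC n : `|x n.+1 - x n| <= r * h ^+ n.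
  elim: n => [|n IH]; first by rewrite expr0 mulr1 /x/=; apply: TB; rewrite subrr normr0.
  apply: (le_trans (TC _ _ (xB n.+1) (xB n))).
  by rewrite exprS mulrCA ler_pM2l// invr_gt0.
have [l Hl] := geo_lim r0 xC.
have lB : `|l - v0| <= r.
  apply: (@geo_small _ _ (2 * r)) => n; have := xB n; have := Hl n.
  have := ler_normD (l - x n) (x n - v0); rewrite subrKA (distrC l (x n)); lra.
exists l => //; apply/eqP; rewrite -subr_eq0 -normr_le0.
apply: (@geo_small _ _ (2 * r)) => n; rewrite add0r.
have := TC _ _ lB (xB n); have := Hl n.+1; have := Hl n.
have := ler_normD (T l - T (x n)) (x n.+1 - l); rewrite subrKA exprS (distrC l (x n)); lra.
Qed.

(** Rank argument on row vectors, transported by the coordinates. *)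
Lemma linear_inverse (T : {linear V -> V}) : (forall z, T z = 0 -> z = 0) ->
  exists S : {linear V -> V}, cancel T S /\ cancel S T.
Proof.
move=> inj; pose I := @cidx R V cV.
pose rv (z : V) : 'rV[R]_#|I| := \row_j cco (enum_val j) z.
pose vr (r : 'rV[R]_#|I|) : V := \sum_i r 0 (enum_rank i) *: cbasis i.
have rvK : cancel rv vr.
  move=> z; rewrite /vr [RHS]cco_sum; apply: eq_bigr => i _.
  by rewrite mxE enum_rankK.
have vrK : cancel vr rv.
  by move=> r; apply/rowP => j; rewrite mxE cco_comb enum_valK.
have lrv : linear rv by move=> a x y; apply/rowP => j; rewrite !mxE linearP.
have lvr : linear vr.
  move=> a x y; rewrite /vr scaler_sumr -big_split /=; apply: eq_bigr => i _.
  by rewrite !mxE scalerDl scalerA.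
pose rvL : {linear V -> 'rV[R]_#|I|} := HB.pack rv (GRing.isLinear.Build _ _ _ _ _ lrv).
pose vrL : {linear 'rV[R]_#|I| -> V} := HB.pack vr (GRing.isLinear.Build _ _ _ _ _ lvr).
pose M := lin1_mx (rvL \o T \o vrL).
have MU : M \in unitmx.
  rewrite -row_free_unit -kermx_eq0; apply/eqP/row_matrixP => i.
  rewrite row0; set u := row i _.
  have : u *m M = 0 by rewrite -row_mul mulmx_ker row0.
  rewrite mul_rV_lin1 /= => /(congr1 vr); rewrite rvK.
  rewrite (_ : vr 0 = 0); last exact: (linear0 vrL).
  move=> /inj /(congr1 rv); rewrite vrK => ->; exact: (linear0 rvL).
have lS : linear (fun z => vr (rv z *m invmx M)).
  move=> a x y; rewrite -[rv (_ + _)]/(rvL _) linearP mulmxDl -scalemxAl.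
  by rewrite -[LHS]/(vrL _) linearP.
pose S : {linear V -> V} := HB.pack (fun z => vr (rv z *m invmx M)) (GRing.isLinear.Build _ _ _ _ _ lS).
exists S.
have EM r : r *m M = rv (T (vr r)) by rewrite mul_rV_lin1.
split => z /=.
  by rewrite -{1}(rvK z) -EM mulmxK.
by rewrite -[T _]rvK -EM mulmxKV// rvK.
Qed.

End GeoLimit.

(** * Implicit functions *)

Section StrictC1.
Context {R : realType} {V W : normedModType R} {cV : coords V} {cW : coords W}.

Lemma strict_is_diff (f : V -> W) p (L : {linear V -> W}) : strict_diff f p L ->
  is_diff p f L.
Proof.
move=> H; apply: eps_is_diff; first exact: lin_continuous.
move=> e e0; have [d d0 Hd] := strict_ball H e0.
apply/nbhs_normP; exists d => // y /= yd; apply: Hd => //.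
by rewrite subrr normr0.
Qed.

(** The derivatives at two nearby points q and p are compared through a common
    small increment t v at q: there the difference quotient is close to the
    derivative at q, by differentiability, and to the one at p, by strict
    differentiability. *)
Lemma strict_Ck1 (A : set V) (f : V -> W) : open A ->
  (forall p, A p -> exists L : {linear V -> W}, strict_diff f p L) -> Ck 1 A f.
Proof.
move=> oA H; have df p : A p -> differentiable f p.
  by move=> /H[L /strict_is_diff]; case.
split=> [|v p Ap] //; have [L HL] := H p Ap.
have [dfp eL] := strict_is_diff HL.
apply/cvgrPdist_le => e e0.
pose e' := e / 2 / (`|v| + 1).
have v1 : 0 < `|v| + 1 by rewrite ltr_wpDl.
have e'0 : 0 < e' by rewrite !divr_gt0.
have ev : e' * `|v| <= e / 2.
  by rewrite /e' mulrAC ler_pdivrMr// ler_wpM2l ?divr_ge0 ?(ltW e0)//; lra.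
have [d d0 Hd] := strict_ball HL e'0.
near=> q.
have Aq : A q by near: q; exact: open_nbhs_nbhs.
have qd : `|p - q| < d by near: q; apply/nbhs_normP; exists d.
have [r /= r0 Hr] : exists2 r, 0 < r & ball_ Num.norm q r `<=`
   (fun x => `|f x - f q - 'd f q (x - q)| <= e' * `|x - q| /\ `|p - x| < d).
  apply/nbhs_normP; apply: filterI; first exact: differentiable_eps (df q Aq).
  suff H2 : open [set x | `|p - x| < d] by apply: open_nbhs_nbhs.
  rewrite (_ : [set x | _] = ball p d); first exact: ball_open.
  by rewrite -ball_normE.
pose t := r / 2 / (`|v| + 1).
have t0 : 0 < t by rewrite !divr_gt0.
have tv : `|t *: v| < r.
  rewrite normrZ gtr0_norm//; apply: (@le_lt_trans _ _ (t * (`|v| + 1))).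
    by rewrite ler_wpM2l ?(ltW t0)//; lra.
  by rewrite /t divfK ?gt_eqF//; lra.
have /Hr[] : ball_ Num.norm q r (q + t *: v).
  by rewrite /= opprD addrA subrr add0r normrN.
rewrite [q + _]addrC addrK => E1 E2.
have E3 := Hd _ _ E2 qd; rewrite addrK in E3.
rewrite (deriveE v dfp) (deriveE v (df q Aq)) eL.
have: t * `|L v - 'd f q v| <= t * e; last by rewrite ler_pM2l.
rewrite -{1}(gtr0_norm t0) -normrZ scalerBr -!linearZ /=.
have := ler_normB (f (t *: v + q) - f q - 'd f q (t *: v)) (f (t *: v + q) - f q - L (t *: v)).
rewrite (_ : _ - _ - (_ - _ - _) = L (t *: v) - 'd f q (t *: v)); last first.
  by rewrite opprB addrC subrKA.
move=> /le_trans; apply; apply: (le_trans (lerD E1 E3)).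
by rewrite normrZ gtr0_norm// mulrCA -mulrDr ler_wpM2l ?(ltW t0)//; lra.
Unshelve. all: by end_near. Qed.

End StrictC1.

Section ImplicitBase.
Context {R : realType} {E V : normedModType R} {cE : coords E} {cV : coords V}.

Let inlP (a : E) : E * V := (a, 0).
Let inrP (z : V) : E * V := (0, z).

(** With S the inverse of the partial derivative, v |-> v - S (G (e, v)) contracts
    by 1/2 near the base point; its fixed point is g e. The contraction estimate
    is part of the conclusion because it also shows that the partial derivative
    stays injective and that g is continuous. *)
Lemma implicit_base (G : E * V -> V) (e0 : E) (v0 : V) (L : {linear (E * V)%type -> V})
    (N : set (E * V)) :
  strict_diff G (e0, v0) L -> {for (e0, v0), continuous G} -> G (e0, v0) = 0 ->
  (forall z, L (0, z) = 0 -> z = 0) -> nbhs (e0, v0) N ->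
  exists (A : set E) (B : set V) (g : E -> V),
    [/\ open A, A e0, open B, B v0 & forall e v, A e -> B v -> N (e, v)] /\
    [/\ forall e, A e -> B (g e),
       forall e v, A e -> B v -> (G (e, v) = 0 <-> v = g e),
       (exists S : {linear V -> V}, forall e v v', A e -> B v -> B v' ->
          `|v - v' - S (G (e, v) - G (e, v'))| <= 2^-1 * `|v - v'|) &
       exists Lg : {linear E -> V}, strict_diff g e0 Lg].
Proof.
move=> sG cG G0 inj nN.
have linr : linear inrP by move=> a x y; apply: injective_projections => //=; rewrite scaler0 addr0.
have linl : linear inlP by move=> a x y; apply: injective_projections => //=; rewrite scaler0 addr0.
pose Ir : {linear V -> (E * V)%type} := HB.pack inrP (GRing.isLinear.Build _ _ _ _ _ linr).
pose Il : {linear E -> (E * V)%type} := HB.pack inlP (GRing.isLinear.Build _ _ _ _ _ linl).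
have [S [TS ST]] := linear_inverse (T := L \o Ir) inj.
have [CS CS0 SC] := lin_boundW S.
have CSi0 : 0 < CS^-1 / 2 by rewrite divr_gt0 ?invr_gt0.
have [d0 d00 Hd0] := strict_ball sG CSi0.
have /nbhs_normP[d1 /= d10 Hd1] := nN.
(* half the radius: closed balls of radius r lie in both open balls *)
pose r := Num.min d0 d1 / 2.
have r0 : 0 < r by rewrite divr_gt0// lt_min d00.
have rd : 2 * r <= d0 /\ 2 * r <= d1 by rewrite /r mulrC divfK// !ge_min !lexx orbT.
have nE (e : E) (v : V) (c : R) : `|e0 - e| < c -> `|v0 - v| < c -> `|(e0, v0) - (e, v)| < c.
  by move=> H1 H2; rewrite prod_normE /= gt_max H1.
have key e v v' : `|e0 - e| < d0 -> `|v0 - v| < d0 -> `|v0 - v'| < d0 ->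
    `|v - v' - S (G (e, v) - G (e, v'))| <= 2^-1 * `|v - v'|.
  move=> ee vv vv'; have := Hd0 (e, v) (e, v') (nE _ _ _ ee vv) (nE _ _ _ ee vv').
  have -> : (e, v) - (e, v') = Ir (v - v') by apply: injective_projections => //=; rewrite subrr.
  have -> : `|Ir (v - v')| = `|v - v'| by rewrite prod_normE /= normr0 max_r.
  move=> H; have -> : v - v' - S (G (e, v) - G (e, v')) = - S (G (e, v) - G (e, v') - L (Ir (v - v'))).
    by rewrite [S (_ - L _)]linearB /= -[L _]/((L \o Ir) _) TS opprB.
  rewrite normrN; apply: (le_trans (SC _)).
  by rewrite -ler_pdivlMl// mulrA.
have GA c : 0 < c -> \forall e \near e0, `|G (e, v0)| < c.
  move=> c0; have : {for e0, continuous (fun e => G (e, v0))}.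
    apply: (@continuous_comp _ _ _ (fun e => (e, v0)) G); last exact: cG.
    by apply: cvg_pair; [exact: cvg_id|exact: cvg_cst].
  move=> /cvgrPdist_lt/(_ _ c0); rewrite G0.
  by apply: filterS => e; rewrite sub0r normrN.
pose A := (interior [set e | `|G (e, v0)| < CS^-1 * (r / 2)]) `&` ball e0 r.
pose B := ball v0 r.
have AE e : A e -> `|G (e, v0)| < CS^-1 * (r / 2) /\ `|e0 - e| < r.
  by move=> [/interior_subset H]; rewrite -ball_normE.
have BE v : B v -> `|v0 - v| < r by rewrite /B -ball_normE.
have fix_ e : A e -> exists v, B v /\ G (e, v) = 0.
  move=> /AE[He er]; pose T v := v - S (G (e, v)).
  have ed : `|e0 - e| < d0 by case: rd; lra.
  have T0 : `|T v0 - v0| < r / 2.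
    rewrite /T addrC addKr normrN; apply: (le_lt_trans (SC _)).
    by rewrite -ltr_pdivlMl.
  have TC v v' : `|v - v0| <= r -> `|v' - v0| <= r -> `|T v - T v'| <= 2^-1 * `|v - v'|.
    move=> vr vr'.
    have -> : T v - T v' = v - v' - S (G (e, v) - G (e, v')).
      by rewrite [S (_ - _)]linearB /= /T !opprD !opprK addrACA.
    by apply: key => //; rewrite distrC; case: rd; lra.
  have TB v : `|v - v0| <= r -> `|T v - v0| <= r.
    move=> vr; have := TC v v0 vr; rewrite subrr normr0 => /(_ (ltW r0)).
    have := ler_normD (T v - T v0) (T v0 - v0); rewrite subrKA; lra.
  have [v vr Tv] := contraction_fixed (ltW r0) TB TC.
  exists v; split.
    rewrite /B -ball_normE /= distrC.
    have := TC v v0 vr; rewrite subrr normr0 => /(_ (ltW r0)).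
    have := ler_normD (T v - T v0) (T v0 - v0); rewrite subrKA Tv; lra.
  have /eqP : T v = v by [].
  rewrite /T -subr_eq0 addrC addKr oppr_eq0 => /eqP S0.
  by rewrite -[LHS]ST S0 linear0.
pose g e := xget v0 [set v | B v /\ G (e, v) = 0].
have gP e : A e -> B (g e) /\ G (e, g e) = 0.
  by move=> /fix_[v Hv]; apply: (@xgetPex _ v0 [set v | B v /\ G (e, v) = 0]); exists v.
have uniq_ e v v' : A e -> B v -> B v' -> G (e, v) = 0 -> G (e, v') = 0 -> v = v'.
  move=> /AE[_ Ae] /BE Bv /BE Bv' E1 E2; have := key e v v'; rewrite E1 E2 subrr linear0 subr0.
  have -> : `|e0 - e| < d0 by case: rd; lra.
  have -> : `|v0 - v| < d0 by case: rd; lra.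
  have -> : `|v0 - v'| < d0 by case: rd; lra.
  move=> /(_ isT isT isT) H; apply/eqP; rewrite -subr_eq0 -normr_le0; lra.
have oA : open A by apply: openI; [exact: open_interior|exact: ball_open].
have Ae0 : A e0 by split; [apply: GA; rewrite mulr_gt0 ?invr_gt0// divr_gt0|exact: ballxx].
have Bv0 : B v0 by exact: ballxx.
have ge0 : g e0 = v0 by have [? ?] := gP _ Ae0; apply: (uniq_ e0).
exists A, B, g; split.
  split => // [|e v /AE[_ ee] /BE vv]; first exact: ball_open.
  by apply: Hd1; apply: nE; case: rd; lra.
split.
- by move=> e /gP[].
- move=> e v Ae Bv; have [Bg Gg] := gP e Ae; split=> [Gv|->//].
  exact: (uniq_ e).
- exists S => e v v' /AE[_ ee] /BE vv /BE vv'.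
  by apply: key; case: rd; lra.
have linLg : linear (fun a => - S (L (Il a))).
  by move=> a x y; rewrite (linearP Il) (linearP L) (linearP S) opprD scalerN.
pose Lg : {linear E -> V} := HB.pack (fun a => - S (L (Il a)))
  (GRing.isLinear.Build _ _ _ _ _ linLg).
exists Lg => e e_gt0; have [K K0 HK] := lin_boundW Lg.
(* with this precision |g x - g y| is at most (2 K + 1) |x - y|, and the
error is at most e |x - y| *)
pose eta := Num.min (1 / 2) (e / (2 * K + 2)).
have K20 : 0 < 2 * K + 2 by lra.
have eta0 : 0 < eta by rewrite lt_min !divr_gt0.
have eta_half : eta <= 1 / 2 by rewrite ge_min lexx.
have eta_e : eta * (2 * K + 2) <= e.
  by rewrite -ler_pdivlMr// ge_min lexx orbT.
have [d2 d20 Hd2] := strict_ball sG (divr_gt0 eta0 CS0).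
have cg : \forall x \near e0, [/\ A x, `|e0 - x| < d2 & `|v0 - g x| < d2].
  near=> x; have Ax : A x by near: x; exact: open_nbhs_nbhs.
  have xd : `|e0 - x| < d2 by near: x; apply/nbhs_normP; exists d2.
  split; [exact: Ax|exact: xd|].
  have [Bg Gg] := gP _ Ax.
  have := key x (g x) v0; rewrite Gg sub0r linearN opprK subrr normr0.
  have -> : `|e0 - x| < d0 by have [_] := AE _ Ax; case: rd; lra.
  have -> : `|v0 - g x| < d0 by have := BE _ Bg; case: rd; lra.
  move=> /(_ isT isT d00) H.
  have Gx : `|G (x, v0)| < CS^-1 * (d2 / 2).
    by near: x; apply: GA; rewrite mulr_gt0 ?invr_gt0// divr_gt0.
  have : `|S (G (x, v0))| < d2 / 2.
    by apply: (le_lt_trans (SC _)); rewrite -ltr_pdivlMl.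
  have := ler_normD (g x - v0 + S (G (x, v0))) (- S (G (x, v0))).
  by rewrite addrK normrN (distrC v0); lra.
near=> x y.
have [Ax x1 x2] : [/\ A x, `|e0 - x| < d2 & `|v0 - g x| < d2] by near: x.
have [Ay y1 y2] : [/\ A y, `|e0 - y| < d2 & `|v0 - g y| < d2] by near: y.
have := Hd2 (x, g x) (y, g y) (nE _ _ _ x1 x2) (nE _ _ _ y1 y2).
have [_ ->] := gP _ Ax; have [_ ->] := gP _ Ay; rewrite subrr sub0r normrN.
have -> : (x, g x) - (y, g y) = Il (x - y) + Ir (g x - g y).
  by apply: injective_projections => /=; rewrite ?addr0 ?add0r.
have Inorm : `|Il (x - y) + Ir (g x - g y)| <= `|x - y| + `|g x - g y|.
  by rewrite prod_normE /= addr0 add0r ge_max lerDl lerDr !normr_ge0.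
move=> H.
have : `|S (L (Il (x - y) + Ir (g x - g y)))| <= eta * (`|x - y| + `|g x - g y|).
  apply: (le_trans (SC _)); rewrite mulrC -ler_pdivlMr//; apply: (le_trans H).
  by rewrite mulrAC ler_wpM2r ?invr_ge0 ?(ltW CS0)// ler_wpM2l ?(ltW eta0).
rewrite linearD [S _]linearD /= -[L (Ir _)]/((L \o Ir) _) TS => H1.
have E1 : g x - g y - Lg (x - y) = S (L (Il (x - y))) + (g x - g y).
  by rewrite /Lg /= opprK addrC.
have HK1 := HK (x - y).
have := ler_normD (g x - g y - Lg (x - y)) (Lg (x - y)); rewrite subrK E1.
set a := `|x - y| in HK1 H1 *; set b := `|g x - g y| in H1 *.
set c := `|S _ + _| in H1 *; set f := `|Lg _| in HK1 *.
have a0 : 0 <= a by exact: normr_ge0.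
have b0 : 0 <= b by exact: normr_ge0.
move=> H2.
have H3 : eta * (a + b) <= (1 / 2) * (a + b) by rewrite ler_wpM2r// addr_ge0.
have bK : a + b <= (2 * K + 2) * a by lra.
apply: (le_trans H1); apply: (@le_trans _ _ (eta * ((2 * K + 2) * a))).
  by rewrite ler_wpM2l// ltW.
by rewrite mulrA ler_wpM2r.
Unshelve. all: by end_near. Qed.

End ImplicitBase.

Section Implicit.
Context {R : realType}.

Lemma Ck1_diffE (V W : normedModType R) (A : set V) k (f : V -> W) x v :
  Ck k.+1 A f -> A x -> 'D_v f x = 'd f x v.
Proof. by move=> kf Ax; rewrite deriveE//; exact: Ck_diff kf Ax. Qed.

(** At each point of the graph the local implicit function is strictly
    differentiable, and by uniqueness it is g. *)
Lemma implicit_regular0 (E V : normedModType R) (cE : coords E) (cV : coords V)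
    (U : set (E * V)) (G : E * V -> V) (A : set E) (g : E -> V) :
  open U -> Ck 1 U G -> open A ->
  (forall e, A e -> [/\ U (e, g e), G (e, g e) = 0,
     forall z, 'D_(0, z) G (e, g e) = 0 -> z = 0 & {for e, continuous g}]) ->
  Ck 1 A g.
Proof.
move=> oU kG oA H; apply: strict_Ck1 => // e Ae.
have [Ue Ge inj cg] := H e Ae.
have inj' z : 'd G (e, g e) (0, z) = 0 -> z = 0.
  by rewrite -(Ck1_diffE _ kG Ue); exact: inj.
have [A1 [B1 [g1 [[oA1 A1e oB1 B1e _] [_ Hg1 _ [L HL]]]]]] :=
  implicit_base (Ck_strict oU kG Ue) (Ck_cont kG Ue) Ge inj' filterT.
exists L => eps eps0; have [d d0 Hd] := strict_ball HL eps0.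
have nE : \forall x \near e, `|e - x| < d /\ g x = g1 x.
  near=> x; split; first by near: x; apply/nbhs_normP; exists d.
  have Ax : A x by near: x; exact: open_nbhs_nbhs.
  have [_ Gx _ _] := H x Ax.
  apply: (Hg1 x (g x) _ _).1 => //.
    by near: x; exact: open_nbhs_nbhs.
  by near: x; apply: cg; exact: open_nbhs_nbhs.
near=> x y; have [xd ->] : `|e - x| < d /\ g x = g1 x by near: x.
have [yd ->] : `|e - y| < d /\ g y = g1 y by near: y.
exact: Hd.
Unshelve. all: by end_near. Qed.

(** The pair (g, D_a g) is again an implicit function, for the system G = 0 and
    D_(a, z) G = 0 in the unknown (v, z). Its partial derivative is triangular
    with two copies of the injective one of G, so that one derivative is gained. *)
Lemma implicit_regular k (E V : normedModType R) (cE : coords E) (cV : coords V)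
    (U : set (E * V)) (G : E * V -> V) (A : set E) (g : E -> V) :
  open U -> Ck k.+1 U G -> open A ->
  (forall e, A e -> [/\ U (e, g e), G (e, g e) = 0,
     forall z, 'D_(0, z) G (e, g e) = 0 -> z = 0 & {for e, continuous g}]) ->
  Ck k.+1 A g.
Proof.
elim: k V cV U G g => [|k IH] V cV U G g oU kG oA H; first exact: implicit_regular0 H.
have kG1 : Ck 1 U G by exact: Ck_le kG.
have kg1 : Ck 1 A g by apply: implicit_regular0 H.
have [dg Dg] := kg1.
split=> // a.
pose U2 : set (E * (V * V)) := (fun p => (p.1, p.2.1)) @^-1` U.
pose G2 (p : E * (V * V)) := (G (p.1, p.2.1), 'D_(a, p.2.2) G (p.1, p.2.1)).
pose g2 e := (g e, 'D_a g e).
have k1 (B : set (E * (V * V))) : open B -> Ck k.+1 B (fun p => (p.1, p.2.1)).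
  move=> oB; apply: Ck_pair => //; first by apply: Ck_fst => //; exact: Ck_id.
  by do 2 (apply: Ck_fst => // || apply: Ck_snd => //); exact: Ck_id.
have oU2 : open U2.
  apply: open_comp => // p _.
  exact: (Ck_cont (k1 setT openT)).
suff : Ck k.+1 A g2 by move=> /(Ck_snd oA).
have kG21 : Ck k.+1 U2 (fun p => G (p.1, p.2.1)).
  by apply: (Ck_comp (B := U)) => //; [exact: k1|exact: Ck_S].
have kG22 : Ck k.+1 U2 (fun p => 'D_(a, p.2.2) G (p.1, p.2.1)).
  apply: (Ck_comp (B := U `*` setT) (f := fun p => ((p.1, p.2.1), (a, p.2.2)))
    (g := fun q => 'D_(q.2) G q.1)) => //.
  - apply: Ck_pair => //; first exact: k1.
    apply: Ck_pair => //; first exact: Ck_cst.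
    by do 2 apply: Ck_snd => //; exact: Ck_id.
  - exact: Ck_dir.
apply: (IH _ _ U2 G2 g2 oU2) => //; first exact: Ck_pair.
move=> e Ae; have [Ue Ge inj cg] := H e Ae; split => //.
- congr pair => //.
  have dp : differentiable (fun x => (x, g x)) e.
    by apply: differentiable_pair => //; exact: dg.
  have := derive_comp (f := fun x => (x, g x)) (g := G) (x := e) a dp (Ck_diff kG Ue).
  rewrite derive_pair; [|by []|exact: dg].
  rewrite (derive_id e a) => <-.
  rewrite -(derive_cst (0 : V) e a); apply: near_eq_derive.
  by near=> x => /=; have [] // := H x _; near: x; exact: open_nbhs_nbhs.
- move=> [z1 z2]; rewrite /G2 derive_pair.
  + move=> /pair_equal_spec[E1 E2].
    have z10 : z1 = 0.
      by apply: inj; rewrite -E1.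
    rewrite z10 in E2 *; congr pair; apply: inj; rewrite -[RHS]E2.
    have lin z : 'D_(a, z) G (e, g e) = 'd G (e, g e) (a, z).
      by apply: Ck1_diffE kG _.
    rewrite (_ : 'D_(0, (0, z2)) _ _ = 'D_z2 (fun z => 'd G (e, g e) (a, z)) ('D_a g e)).
      rewrite (derive_comp (f := fun z => (a, z)) (g := 'd G (e, g e))).
      * rewrite derive_pair; [|exact: differentiable_cst|by []].
        rewrite derive_cst derive_id derive_linear; last exact: lin_continuous.
        by rewrite (Ck1_diffE _ kG).
      * by apply: differentiable_pair; [exact: differentiable_cst|].
      * by apply: linear_differentiable; exact: lin_continuous.
    apply: (congr1 (fun F : R -> V => lim (F @ 0^'))); apply/funext => h /=.
    by rewrite !scaler0 !add0r !lin.
  + exact: (Ck_diff kG21 (Ue : U2 (e, g2 e))).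
  + exact: (Ck_diff kG22 (Ue : U2 (e, g2 e))).
- by apply: cvg_pair; [exact: cg|exact: Dg].
Unshelve. all: by end_near. Qed.

(** Injectivity of the partial derivative is also asserted on the whole
    neighbourhood: solving with another right-hand side will need it. *)
Theorem implicit_function k (E V : normedModType R) {cE : coords E} {cV : coords V}
    (U : set (E * V)) (G : E * V -> V) (e0 : E) (v0 : V) :
  open U -> U (e0, v0) -> Ck k.+1 U G -> G (e0, v0) = 0 ->
  (forall z, 'D_(0, z) G (e0, v0) = 0 -> z = 0) ->
  exists (A : set E) (B : set V) (g : E -> V),
    [/\ open A, A e0, open B, B v0 & forall e v, A e -> B v -> U (e, v)] /\
    [/\ forall e, A e -> B (g e),
       forall e v, A e -> B v -> (G (e, v) = 0 <-> v = g e),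
       forall e v z, A e -> B v -> 'D_(0, z) G (e, v) = 0 -> z = 0 &
       Ck k.+1 A g].
Proof.
move=> oU Ue kG Ge inj.
have kG1 : Ck 1 U G by exact: Ck_le kG.
have inj' z : 'd G (e0, v0) (0, z) = 0 -> z = 0.
  by rewrite -(Ck1_diffE _ kG Ue); exact: inj.
have nU : nbhs (e0, v0) U by exact: open_nbhs_nbhs.
have [A [B [g [[oA Ae oB Be AB] [Hg1 Hg2 [S HS] [L HL]]]]]] :=
  implicit_base (Ck_strict oU kG1 Ue) (Ck_cont kG Ue) Ge inj' nU.
have injAB e v z : A e -> B v -> 'D_(0, z) G (e, v) = 0 -> z = 0.
  move=> Ae1 Bv1; have Uev := AB _ _ Ae1 Bv1.
  rewrite (Ck1_diffE _ kG Uev) => Dz.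
  have [C C0 HC] := lin_boundW S.
  have C4 : 0 < 1 / 4 / C by rewrite !divr_gt0.
  have /nbhs_normP[d /= d0 Hd] := differentiable_eps C4 (Ck_diff kG Uev).
  have /nbhs_normP[d1 /= d10 Hd1] : nbhs v B by exact: open_nbhs_nbhs.
  pose t := Num.min d d1 / 2 / (`|z| + 1).
  have z1 : 0 < `|z| + 1 by rewrite ltr_wpDl.
  have t0 : 0 < t by rewrite !divr_gt0// lt_min d0.
  have tz : `|t *: z| < Num.min d d1.
    rewrite normrZ gtr0_norm//; apply: (@le_lt_trans _ _ (t * (`|z| + 1))).
      by rewrite ler_wpM2l ?(ltW t0)// lerDl.
    by rewrite /t divfK ?gt_eqF// gtr_pMr ?invf_lt1 ?ltr1n// lt_min d0.
  have [tzd tzd1] : `|t *: z| < d /\ `|t *: z| < d1 by move: tz; rewrite lt_min => /andP.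
  have EN : (e, v + t *: z) - (e, v) = (0, t *: z) :> E * V.
    by apply: injective_projections => /=; rewrite ?subrr// addrC addKr.
  have EN' : `|(0, t *: z) : E * V| = `|t *: z| by rewrite prod_normE /= normr0 max_r.
  have /Hd : `|(e, v) - (e, v + t *: z)| < d by rewrite distrC EN EN'.
  rewrite EN EN' (_ : (0, t *: z) = t *: (0, z) :> E * V); last first.
    by apply: injective_projections => //=; rewrite scaler0.
  rewrite linearZ /= Dz scaler0 subr0 => H1.
  have Bt : B (v + t *: z) by apply: Hd1; rewrite /= opprD addrA subrr sub0r normrN.
  have tE : v + t *: z - v = t *: z by rewrite addrC addKr.
  have := HS e _ _ Ae1 Bt Bv1; rewrite tE.
  have := HC (G (e, v + t *: z) - G (e, v)); set X := G _ - G _ => H2 H3.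
  have H4 : C * `|X| <= 1 / 4 * `|t *: z|.
    rewrite -ler_pdivlMl//; apply: (le_trans H1).
    by rewrite mulrA [_^-1 * _]mulrC.
  have := ler_normD (t *: z - S X) (S X); rewrite subrK => H5.
  have : `|t *: z| <= 0 by move: H3 H4 H5; clear -H2; move: H2; clear; lra.
  by rewrite normr_le0 scaler_eq0 gt_eqF//= => /eqP.
exists A, B, g; split; first by [].
split; [exact: Hg1|exact: Hg2|exact: injAB|].
apply: (implicit_regular cE cV oU kG oA) => e Ae1; split.
- by apply: AB => //; exact: Hg1.
- by apply/(Hg2 _ _ Ae1 (Hg1 _ Ae1)).
- by move=> z; apply: injAB => //; exact: Hg1.
have [C C0 HC] := lin_boundW S.
have Ge1 : G (e, g e) = 0 by apply/(Hg2 _ _ Ae1 (Hg1 _ Ae1)).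
have cG : {for e, continuous (fun x => G (x, g e))}.
  apply: (@continuous_comp _ _ _ (fun x => (x, g e)) G).
    by apply: cvg_pair; [exact: cvg_id|exact: cvg_cst].
  by apply: (Ck_cont kG); apply: AB => //; exact: Hg1.
apply/cvgrPdist_lt => eps eps0.
have eC : 0 < eps / 2 / C by rewrite !divr_gt0.
have /cvgrPdist_lt/(_ _ eC) := cG; rewrite Ge1 => nG.
near=> x.
have Ax : A x by near: x; exact: open_nbhs_nbhs.
have Gx : G (x, g x) = 0 by apply/(Hg2 _ _ Ax (Hg1 _ Ax)).
have := HS x _ _ Ax (Hg1 _ Ax) (Hg1 _ Ae1); rewrite Gx.
have : `|0 - G (x, g e)| < eps / 2 / C by near: x; exact: nG.
set X := 0 - _ => HX H1.
have H2 : `|S X| < eps / 2.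
  by apply: (le_lt_trans (HC _)); rewrite mulrC -ltr_pdivlMr.
have := ler_normD (g x - g e - S X) (S X); rewrite subrK (distrC (g e)).
move: H1 H2; clear; lra.
Unshelve. all: by end_near. Qed.

End Implicit.

(** * Growth and existence for differential equations *)

Section Growth.
Context {R : realType} {V : normedModType R} {cV : coords V}.

Lemma derive_dirZ (U W : normedModType R) (f : U -> W) x (c : R) v :
  differentiable f x -> 'D_(c *: v) f x = c *: 'D_v f x.
Proof. by move=> df; rewrite (deriveE _ df) (deriveE v df) linearZ. Qed.

Lemma is_derive_weight (M e L t : R) : is_derive t 1
  (fun s => M * expR (2 * L * s) + e * s) (M * (2 * L * expR (2 * L * t)) + e).
Proof.
have lin (c : R) : is_derive t 1 (fun s : R => c * s) c.
  have := is_derive_line (0 : R) c t.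
  rewrite (_ : (fun s : R => 0 + s *: c) = (fun s => c * s))//.
  by apply/funext => s; rewrite add0r [_ *: _]mulrC.
apply: is_deriveD.
have d1 : is_derive t 1 (fun s => expR (2 * L * s)) (2 * L * expR (2 * L * t)).
  have [d e1] := lin (2 * L); have [d2 e2] := is_derive_expR (2 * L * t).
  have := is_derive_curve (f := expR) (y := fun s => 2 * L * s) (t := t) (dy := 2 * L) _ (lin _).
  have de : differentiable (expR : R -> R) (2 * L * t) by apply/derivable1_diffP.
  move=> /(_ de) H; apply: (is_derive_eq H).
  rewrite -[X in 'D_X expR _](mulr1 (2 * L)).
  by rewrite (derive_dirZ (2 * L) (1 : R) de) e2.
have [d2 e2] := d1; split; first by apply: derivableZ.
by rewrite (deriveZ M d2) e2.
Qed.

Lemma withinM (T : topologicalType) (A : set T) (f g : T -> R) :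
  {within A, continuous f} -> {within A, continuous g} ->
  {within A, continuous (fun t => f t * g t)}.
Proof. by move=> cf cg x; apply: continuousM; [exact: cf|exact: cg]. Qed.

(** Let M be the maximum of |y t| exp(- 2 L t), reached at s. The mean value
    inequality on [0, s] with majorant M/2 exp(2 L t) + e t bounds M by
    |y 0| + M/2 + e; the doubled rate 2 L is what produces the factor 1/2. *)
Lemma gronwall (y dy : R -> V) (L e : R) : 0 < L -> 0 <= e ->
  {within `[0, 1], continuous y} ->
  (forall t : R, 0 < t < 1 -> is_derive t 1 y (dy t)) ->
  (forall t : R, 0 < t < 1 -> `|dy t| <= L * `|y t| + e) ->
  forall t : R, 0 <= t <= 1 -> `|y t| <= 2 * (`|y 0| + e) * expR (2 * L).
Proof.
move=> L0 e0 cy hy le; pose w (t : R) := `|y t| * expR (- (2 * L * t)).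
have cw : {within `[0, 1], continuous w}.
  apply: withinM.
    exact: (within_comp (W := R) (g := fun v => `|v|) cy (@norm_continuous R V)).
  have c : continuous (fun t : R => expR (- (2 * L * t))).
    move=> x; apply: (@continuous_comp _ _ _ (fun t => - (2 * L * t)) expR); last exact: continuous_expR.
    by apply: (continuousN (V := R^o)); exact: mulrl_continuous.
  exact: (continuous_subspaceT c).
have [s] := EVT_max (@ler01 R) cw; rewrite in_itv /= => /andP[s0 s1] ws.
pose M := w s.
have yM (t : R) : 0 <= t <= 1 -> `|y t| <= M * expR (2 * L * t).
  move=> t01; rewrite -ler_pdivrMr ?expR_gt0// -expRN.
  by apply: ws; rewrite in_itv.
have M0 : 0 <= M by rewrite /M /w mulr_ge0// expR_ge0.
have yMs : `|y s| = M * expR (2 * L * s).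
  by rewrite /M /w -mulrA -expRD addNr expR0 mulr1.
have := @mean_value_le R V cV y dy (fun t => M / 2 * expR (2 * L * t) + e * t)
  (fun t => M / 2 * (2 * L * expR (2 * L * t)) + e) 0 s s0.
have cs : {within `[0, s], continuous y}.
  apply: continuous_subspaceW cy => x /=; rewrite !in_itv /= => /andP[-> xs].
  exact: le_trans xs s1.
have cpsi : {within `[0, s], continuous (fun t => M / 2 * expR (2 * L * t) + e * t)}.
  apply: derivable_within_continuous => t _; by have [] := is_derive_weight (M / 2) e L t.
move=> /(_ cs cpsi) H.
have {}H : `|y s - y 0| <= M / 2 * expR (2 * L * s) + e * s - (M / 2 * expR (2 * L * 0) + e * 0).
  apply: H.
  - by move=> t /andP[t0 ts]; apply: hy; rewrite t0 (lt_le_trans ts).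
  - by move=> t _; exact: is_derive_weight.
  - move=> t /andP[t0 ts]; have t1 : t < 1 by exact: lt_le_trans s1.
    apply: (le_trans (le t _)); first by rewrite t0.
    rewrite lerD2r (_ : M / 2 * _ = L * (M * expR (2 * L * t))); last by field.
    by rewrite ler_pM2l// yM// !ltW.
rewrite mulr0 expR0 mulr0 mulr1 in H.
have es : e * s <= e by rewrite ler_piMr.
have := ler_normD (y s - y 0) (y 0); rewrite subrK yMs => H2.
have MM : M <= M * expR (2 * L * s).
  by rewrite ler_peMr// -expR0 ler_expR !mulr_ge0// ltW.
have ME : M <= 2 * (`|y 0| + e).
  move: H H2 es MM M0; set a := M * expR _; rewrite [M / 2 * _]mulrAC -/a.
  move: (`|y s - y 0|) (`|y 0|) (e * s) => *; lra.
move=> t /andP[t0 t1]; apply: (le_trans (yM t _)); first by rewrite t0.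
apply: ler_pM; [by []|exact: expR_ge0|by []|].
by rewrite ler_expR ler_piMr// mulr_ge0// ltW.
Qed.

Lemma is_derive_bigsum (I : Type) (r : seq I) (F : I -> R -> V) (dF : I -> V) (t : R) :
  (forall i, is_derive t 1 (F i) (dF i)) ->
  is_derive t 1 (fun s => \sum_(i <- r) F i s) (\sum_(i <- r) dF i).
Proof.
move=> H; elim: r => [|i r IH].
  rewrite big_nil (_ : (fun s => _) = cst 0); first exact: is_derive_cst.
  by apply/funext => s; rewrite big_nil.
rewrite big_cons (_ : (fun s => _) = F i + (fun s => \sum_(j <- r) F j s)).
  exact: is_deriveD.
by apply/funext => s; rewrite big_cons.
Qed.

(** The interval ]-1, 2[ only serves to have [0, 1] in its interior. *)
Lemma antiderivative (h : R -> V) : continuous h ->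
  exists H : R -> V, H 0 = 0 /\ forall t : R, -1 < t < 2 -> is_derive t 1 H (h t).
Proof.
move=> ch.
have Hi i : exists Hi : R -> R, Hi 0 = 0 /\
    forall t : R, -1 < t < 2 -> is_derive t 1 Hi (cco i (h t)).
  pose f t := cco i (h t).
  have cf : continuous f.
    move=> t; apply: (@continuous_comp _ _ _ h (cco i)); first exact: ch.
    exact: (lin_continuous (W := R^o)).
  pose F (x : R) := (\int[@lebesgue_measure R]_(t in `[(-1)%R, x]) f t)%R.
  have If : (@lebesgue_measure R).-integrable `[-1, 2] (EFin \o f).
    apply: continuous_compact_integrable; first exact: segment_compact.
    exact: (continuous_subspaceT cf).
  exists (fun t => F t - F 0); split; first exact: subrr.
  move=> t /andP[t0 t1].
  have [d e] := continuous_FTC1_closed t1 If t0 (cf t).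
  have dF : is_derive t 1 F (f t) by split; rewrite -?derive1E.
  have := is_deriveB (df := f t) (dg := 0) dF (is_derive_cst (F 0) t 1).
  by rewrite subr0.
have [H HH] := choice Hi.
exists (fun t => \sum_i H i t *: cbasis i); split.
  by apply: big1 => i _; rewrite (HH i).1 scale0r.
move=> t t01; rewrite [h t]cco_sum.
apply: (@is_derive_bigsum _ _ (fun i s => H i s *: cbasis i)) => i.
have lin : linear (fun c : R => c *: (cbasis i : V)).
  by move=> a x y; rewrite scalerDl scalerA.
pose L : {linear R -> V} := HB.pack (fun c : R => c *: (cbasis i : V))
  (GRing.isLinear.Build _ _ _ _ _ lin).
exact: (is_derive_lin (f := L) (lin_continuous (f := L)) ((HH i).2 t t01)).
Qed.

End Growth.

Section Picard.
Context {R : realType}.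

(** Composing with it turns a function continuous on [0, 1] into one continuous on
    the whole line. *)
Definition clamp (t : R) : R := Num.max 0 (Num.min 1 t).

Lemma clamp_itv t : 0 <= clamp t <= 1.
Proof. by rewrite /clamp le_max lexx ge_max ge_min lexx ler01. Qed.

Lemma clampE (t : R) : 0 <= t <= 1 -> clamp t = t.
Proof. by move=> /andP[t0 t1]; rewrite /clamp (min_r t1) max_r. Qed.

Lemma clamp_continuous : continuous clamp.
Proof.
move=> t; apply: (continuous_max (f := fun=> 0) (g := fun t : R => Num.min 1 t)).
  exact: cvg_cst.
by apply: (continuous_min (f := fun=> 1) (g := fun t : R => t)); [exact: cvg_cst|exact: cvg_id].
Qed.

Context {V : normedModType R} {cV : coords V}.

Lemma within_clamp (W : topologicalType) (y : R -> W) : {within `[0, 1], continuous y} ->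
  continuous (fun t => y (clamp t)).
Proof.
move=> /subspace_continuousP cy t A HA.
have ct : `[0, 1]%classic (clamp t) by rewrite /= in_itv; exact: clamp_itv.
have H : nbhs (clamp t) [set u | `[0, 1]%classic u -> A (y u)] := cy _ ct A HA.
have := clamp_continuous H.
apply: (@filterS _ _ _ (clamp @^-1` [set u | `[0, 1]%classic u -> A (y u)])) => s Hs.
by apply: Hs; rewrite /= in_itv; exact: clamp_itv.
Qed.

(** In the weight exp(2 L t) the integral operator halves distances, so that its
    iterates converge on all of [0, 1] at once. The Lipschitz bound is global;
    smooth fields are truncated before this is applied. *)
Lemma picard (g : R -> V -> V) (L : R) (x : V) : 0 < L ->
  (forall y : R -> V, continuous y -> continuous (fun t => g t (y t))) ->
  (forall t a b, `|g t a - g t b| <= L * `|a - b|) ->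
  exists y : R -> V, [/\ continuous y, y 0 = x &
    forall t : R, 0 < t < 1 -> is_derive t 1 y (g t (y t))].
Proof.
move=> L0 cg gL.
have /choice[P HP] : forall y : R -> V, exists y' : R -> V, continuous y ->
    [/\ continuous y', y' 0 = x &
        forall t : R, 0 < t < 1 -> is_derive t 1 y' (g t (y t))].
  move=> y; have [cy|] := pselect (continuous y); last by exists y.
  have [H [H0 dH]] := antiderivative (cg y cy).
  exists (fun t => x + H (clamp t)) => _; split.
  - move=> t; apply: continuousD; first exact: cvg_cst.
    apply: (@continuous_comp _ _ _ clamp H); first exact: clamp_continuous.
    apply: differentiable_continuous; apply/derivable1_diffP.
    have /andP[c0 c1] := clamp_itv t.
    have c12 : -1 < clamp t < 2 by lra.
    by have [] := dH _ c12.
  - by rewrite clampE ?lexx ?ler01// H0 addr0.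
  - move=> t t01; have t12 : -1 < t < 2 by lra.
    have := is_deriveD (is_derive_cst x t 1) (dH t t12); rewrite add0r.
    apply: near_eq_is_derive; near=> s; rewrite /= /cst clampE//.
    suff : 0 < s < 1 by move=> /andP[/ltW-> /ltW->].
    have : s \in `]0, 1[ by near: s; apply: near_in_itvoo; rewrite in_itv.
    by rewrite in_itv.
pose E := expR (2 * L).
have E0 : 0 < E by exact: expR_gt0.
have comp y1 y2 M : continuous y1 -> continuous y2 -> 0 <= M ->
    (forall t : R, 0 <= t <= 1 -> `|y1 t - y2 t| <= M * expR (2 * L * t)) ->
    forall t : R, 0 <= t <= 1 -> `|P y1 t - P y2 t| <= M / 2 * expR (2 * L * t).
  move=> c1 c2 M0 H t /andP[t0 t1].
  have [cP1 P10 dP1] := HP _ c1; have [cP2 P20 dP2] := HP _ c2.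
  have := @mean_value_le R V cV (fun t => P y1 t - P y2 t) (fun t => g t (y1 t) - g t (y2 t))
    (fun t => M / 2 * expR (2 * L * t) + 0 * t)
    (fun t => M / 2 * (2 * L * expR (2 * L * t)) + 0) 0 t t0.
  have cd : {within `[0, t], continuous (fun t => P y1 t - P y2 t)}.
    have c : continuous (fun t => P y1 t - P y2 t).
      by move=> s; apply: continuousB; [exact: cP1|exact: cP2].
    exact: (continuous_subspaceT c).
  have cw : {within `[0, t], continuous (fun t => M / 2 * expR (2 * L * t) + 0 * t)}.
    by apply: derivable_within_continuous => s _; have [] := is_derive_weight (M / 2) 0 L s.
  move=> /(_ cd cw); rewrite P10 P20 subrr subr0 !mul0r !addr0 mulr0 expR0 mulr1.
  move=> H1; have : `|P y1 t - P y2 t| <= M / 2 * expR (2 * L * t) - M / 2.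
    apply: H1.
    - move=> s /andP[s0 s1]; have s01 : 0 < s < 1 by rewrite s0 (lt_le_trans s1).
      by apply: is_deriveB; [exact: dP1|exact: dP2].
    - by move=> s _; exact: is_derive_weight.
    - move=> s /andP[s0 s1]; rewrite addr0; apply: (le_trans (gL _ _ _)).
      rewrite (_ : M / 2 * _ = L * (M * expR (2 * L * s))); last by field.
      by rewrite ler_pM2l// H// (ltW s0) ltW// (lt_le_trans s1).
  by move=> /le_trans; apply; rewrite gerBl divr_ge0.
pose y n := iter n P (fun=> x).
have cy n : continuous (y n).
  by elim: n => [|n IH] /=; [move=> t; exact: cvg_cst|have [] := HP _ IH].
have [M M0 HM] : exists2 M, 0 <= M & forall t : R, 0 <= t <= 1 -> `|y 1 t - y 0 t| <= M.
  have c : {within `[0, 1], continuous (fun t => `|y 1 t - y 0 t|)}.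
    have c : continuous (fun t => `|y 1 t - y 0 t|).
      move=> t; apply: (@continuous_comp _ _ _ (fun t => y 1 t - y 0 t) (fun v : V => `|v|)).
        by apply: continuousB; exact: cy.
      exact: norm_continuous.
    exact: (continuous_subspaceT c).
  have [s _ Hs] := EVT_max (@ler01 R) c.
  by exists (`|y 1 s - y 0 s|) => // t t01; apply: Hs; rewrite in_itv.
have yC n (t : R) : 0 <= t <= 1 -> `|y n.+1 t - y n t| <= M * 2^-1 ^+ n * expR (2 * L * t).
  elim: n t => [|n IH] t t01.
    apply: (le_trans (HM t t01)); rewrite expr0 mulr1 ler_peMr// -expR0 ler_expR.
    by move/andP: t01 => [t0 _]; rewrite !mulr_ge0// ltW.
  rewrite exprSr mulrA; apply: (comp (y n.+1) (y n) _ (cy _) (cy _) _ IH) => //.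
  by rewrite mulr_ge0// exprn_ge0.
have yE n (t : R) : 0 <= t <= 1 -> `|y n.+1 t - y n t| <= M * E * 2^-1 ^+ n.
  move=> t01; apply: (le_trans (yC n t t01)); rewrite mulrAC ler_wpM2r ?exprn_ge0//.
  by rewrite ler_wpM2l// ler_expR ler_piMr ?mulr_ge0 ?(ltW L0)//; case/andP: t01.
have ME0 : 0 <= M * E by rewrite mulr_ge0// ltW.
have /choice[z Hz] : forall t, exists l, forall n, `|y n (clamp t) - l| <= 2 * (M * E) * 2^-1 ^+ n.
  by move=> t; apply: geo_lim => // n; apply: yE; exact: clamp_itv.
have cz : continuous z.
  move=> t; apply/cvgrPdist_lt => e e0.
  have [n Hn] : exists n, 2 * (M * E) * 2^-1 ^+ n < e / 3.
    apply: contrapT => /forallNP H.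
    have : e / 3 <= 0; last by rewrite leNgt divr_gt0.
    by apply: (@geo_small _ _ _ (2 * (M * E))) => n; rewrite add0r leNgt; apply/negP.
  have c : {for t, continuous (fun t => y n (clamp t))}.
    apply: (@continuous_comp _ _ _ clamp (y n)); first exact: clamp_continuous.
    exact: cy.
  have e3 : 0 < e / 3 by rewrite divr_gt0.
  have /cvgrPdist_lt/(_ _ e3) := c; apply: filterS => s /= Hs.
  have := Hz s n; have := Hz t n.
  have := ler_normD (z t - y n (clamp t)) (y n (clamp t) - z s); rewrite subrKA (distrC (z t) (y n (clamp t))).
  have := ler_normD (y n (clamp t) - y n (clamp s)) (y n (clamp s) - z s); rewrite subrKA.
  move: Hn Hs; clear; move: (2 * (M * E) * 2^-1 ^+ n) => k; lra.
have yz n (t : R) : 0 <= t <= 1 -> `|y n t - z t| <= 2 * (M * E) * 2^-1 ^+ n * expR (2 * L * t).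
  move=> t01; have := Hz t n; rewrite clampE// => /le_trans; apply.
  have K0 : 0 <= 2 * (M * E) * 2^-1 ^+ n by rewrite mulr_ge0// ?exprn_ge0// mulr_ge0.
  rewrite (ler_peMr K0)// -expR0 ler_expR.
  by move/andP: t01 => [t0 _]; rewrite !mulr_ge0// ltW.
have Pz (t : R) : 0 <= t <= 1 -> P z t = z t.
  move=> t01; apply/eqP; rewrite -subr_eq0 -normr_le0.
  apply: (@geo_small _ _ _ (2 * (M * E) * E)) => n; rewrite add0r.
  have K0 : 0 <= 2 * (M * E) * 2^-1 ^+ n by rewrite mulr_ge0// ?exprn_ge0// mulr_ge0.
  have A1 := comp _ _ _ (cy n) cz K0 (yz n) t t01.
  have A2 := yz n.+1 t t01.
  have := ler_normD (P z t - y n.+1 t) (y n.+1 t - z t); rewrite subrKA.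
  rewrite (distrC (P z t) (y n.+1 t)) => /le_trans; apply; apply: (le_trans (lerD A1 A2)).
  have KE : 2 * (M * E) * 2^-1 ^+ n.+1 = 2 * (M * E) * 2^-1 ^+ n / 2.
    by rewrite exprSr !mulrA.
  rewrite KE -mulrDl -splitr.
  rewrite [leRHS]mulrAC ler_wpM2l// /E ler_expR ler_piMr ?mulr_ge0 ?(ltW L0)//.
  by case/andP: t01.
have [cPz Pz0 dPz] := HP z cz.
exists (P z); split => // t /[dup] t01 /dPz; rewrite Pz//.
by case/andP: t01 => /ltW-> /ltW->.
Unshelve. all: by end_near. Qed.

End Picard.

(** * Smooth dependence of solutions on initial values *)

Section UnitInterval.
Context {R : realType}.

(** Compactness of [0, 1], in the form used for estimates along an orbit: a
    property holding locally uniformly in t holds uniformly. *)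
Lemma near_unit (I : Type) (F : set_system I) (P : I -> R -> Prop) : Filter F ->
  (forall x : R, 0 <= x <= 1 -> \forall x' \near x & i \near F, P i x') ->
  \forall i \near F, forall t : R, 0 <= t <= 1 -> P i t.
Proof.
move=> FF H; have /compact_near_coveringP := @segment_compact R 0 1.
move=> /(_ I F P FF); have H' : forall x : R, `[0, 1]%classic x -> \forall x' \near x & i \near F, P i x'.
  by move=> x; rewrite /= in_itv => /H.
by move=> /(_ H'); apply: filterS => i /= Hi t t01; apply: Hi; rewrite /= in_itv.
Qed.

End UnitInterval.

Section Tube.
Context {R : realType} {V : normedModType R} {cV : coords V}.

(** Time 1 suffices: the travel time will become a component of the state. *)
Definition trajectory (f : V -> V) (y : R -> V) :=
  {within `[0, 1], continuous y} /\
  forall t : R, 0 < t < 1 -> is_derive t 1 y (f (y t)).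

(** Gronwall needs a Lipschitz constant between the two trajectories only, and
    compactness provides one: near a time where they meet it comes from
    differentiability of f, near the others from a positive distance. *)
Lemma trajectory_unique (f : V -> V) (y1 y2 : R -> V) : Ck 1 setT f ->
  trajectory f y1 -> trajectory f y2 -> y1 0 = y2 0 ->
  forall t : R, 0 <= t <= 1 -> y1 t = y2 t.
Proof.
move=> kf [c1 d1] [c2 d2] E0.
have C1 := within_clamp c1; have C2 := within_clamp c2.
pose P (L t : R) := `|f (y1 (clamp t)) - f (y2 (clamp t))| <= L * `|y1 (clamp t) - y2 (clamp t)|.
have : \forall L \near +oo, forall t : R, 0 <= t <= 1 -> P L t.
  apply: near_unit => t t01.
  have [E|NE] := eqVneq (y1 (clamp t)) (y2 (clamp t)).
    have [d d0 Hd] := strict_ball (Ck_strict openT kf I : strict_diff f (y1 (clamp t)) _) ltr01.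
    have [C C0 HC] := lin_boundW ('d f (y1 (clamp t))).
    near=> s L; have /Hd : `|y1 (clamp t) - y1 (clamp s)| < d.
      by near: s; move/cvgrPdist_lt: (C1 t); exact.
    have s2 : `|y1 (clamp t) - y2 (clamp s)| < d.
      by rewrite E; near: s; move/cvgrPdist_lt: (C2 t); exact.
    move=> /(_ _ s2); rewrite mul1r /P => H.
    have HC1 := HC (y1 (clamp s) - y2 (clamp s)).
    have := ler_normD (f (y1 (clamp s)) - f (y2 (clamp s)) - 'd f (y1 (clamp t)) (y1 (clamp s) - y2 (clamp s)))
      ('d f (y1 (clamp t)) (y1 (clamp s) - y2 (clamp s))).
    rewrite subrK => /le_trans; apply; apply: (le_trans (lerD H HC1)).
    have HL : 1 + C <= L by near: L; apply: nbhs_pinfty_ge; rewrite num_real.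
    by apply: le_trans (ler_wpM2r (normr_ge0 _) HL); rewrite mulrDl mul1r.
  pose dl := `|y1 (clamp t) - y2 (clamp t)|.
  have dl0 : 0 < dl by rewrite normr_gt0 subr_eq0.
  pose M := `|f (y1 (clamp t)) - f (y2 (clamp t))| + 1.
  have cd : (fun s => `|y1 (clamp s) - y2 (clamp s)|) @ t --> dl.
    by apply: cvg_norm; apply: cvgB; [exact: C1|exact: C2].
  have cf : (fun s => `|f (y1 (clamp s)) - f (y2 (clamp s))|) @ t --> `|f (y1 (clamp t)) - f (y2 (clamp t))|.
    have cfy (y : R -> V) : continuous y -> f (y s) @[s --> t] --> f (y t).
      by move=> cy; apply: (@continuous_comp _ _ _ y f); [exact: cy|exact: (Ck_cont kf)].
    by apply: cvg_norm; apply: cvgB; [exact: (cfy _ C1)|exact: (cfy _ C2)].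
  near=> s L; rewrite /P.
  have H1 : `|f (y1 (clamp s)) - f (y2 (clamp s))| <= M.
    near: s; apply: (cvgr_le _ cf); rewrite /M; lra.
  have H2 : dl / 2 <= `|y1 (clamp s) - y2 (clamp s)|.
    near: s; apply: (cvgr_ge _ cd); lra.
  have H3 : 2 * M / dl <= L by near: L; apply: nbhs_pinfty_ge; rewrite num_real.
  apply: (le_trans H1); rewrite (_ : M = 2 * M / dl * (dl / 2)); last first.
    by field; rewrite gt_eqF.
  apply: ler_pM => //; last by rewrite divr_ge0// ltW.
  by rewrite divr_ge0 ?(ltW dl0)// mulr_ge0// /M addr_ge0.
move=> H; near +oo_R => L.
have HL : forall t : R, 0 <= t <= 1 -> P L t by near: L.
have L0 : 0 < L by near: L; apply: nbhs_pinfty_gt; rewrite num_real.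
move=> t t01; apply/eqP; rewrite -subr_eq0 -normr_le0.
have cw : {within `[0, 1], continuous (fun t => y1 t - y2 t)}.
  by move=> x; apply: continuousB; [exact: c1|exact: c2].
have := @gronwall R V cV (fun t => y1 t - y2 t) (fun t => f (y1 t) - f (y2 t)) L 0 L0 (lexx 0) cw.
rewrite E0 subrr normr0 addr0 mulr0 mul0r; apply => //.
  by move=> s s01; apply: is_deriveB; [exact: d1|exact: d2].
move=> s s01; rewrite addr0; have s01' : 0 <= s <= 1 by move/andP: s01 => [/ltW-> /ltW->].
by have := HL s s01'; rewrite /P clampE.
Unshelve. all: by end_near. Qed.

Variables (f : V -> V) (y0 : R -> V).
Hypothesis kf : Ck 1 setT f.
Hypothesis ty0 : trajectory f y0.

Let Y t := y0 (clamp t).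
Let cY : continuous Y.
Proof. by case: ty0 => c _; exact: within_clamp. Qed.

(** Strict differentiability with the same radius along the whole orbit. *)
Lemma tube_strict (e : R) : 0 < e -> exists2 d, 0 < d & forall (t : R) a b,
  `|Y t - a| < d -> `|Y t - b| < d -> `|f a - f b - 'd f (Y t) (a - b)| <= e * `|a - b|.
Proof.
move=> e0.
pose P (d t : R) := forall a b, `|Y t - a| < d -> `|Y t - b| < d ->
  `|f a - f b - 'd f (Y t) (a - b)| <= e * `|a - b|.
have e2 : 0 < e / 2 by rewrite divr_gt0.
suff : \forall d \near 0^'+, forall t : R, 0 <= t <= 1 -> P d t.
  move=> H; near (0 : R)^'+ => d.
  have Hd : forall t : R, 0 <= t <= 1 -> P d t by near: d.
  exists d => [|t]; first by near: d; exact: nbhs_right_gt.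
  have := Hd _ (clamp_itv t); rewrite /P /Y clampE//; exact: clamp_itv.
apply: near_unit => t t01.
have [d0 d00 Hd0] := strict_ball (Ck_strict openT kf I : strict_diff f (Y t) _) e2.
have d02 : 0 < d0 / 2 by rewrite divr_gt0.
have HD : \forall s \near t, forall v, `|'D_v f (Y s) - 'D_v f (Y t)| <= e / 2 * `|v|.
  have H := Ck_diff_near (cV := cV) openT kf (I : setT (Y t)) e2.
  have H2 : \forall s \near t, setT (Y s) /\ forall v, `|'D_v f (Y s) - 'D_v f (Y t)| <= e / 2 * `|v|.
    exact: (cY (x := t) H).
  by apply: filterS H2 => s [].
near=> s d => a b Ha Hb.
have Ys : `|Y t - Y s| < d0 / 2 by near: s; move/cvgrPdist_lt: (cY (x := t)); exact.
have dd : d < d0 / 2 by near: d; exact: nbhs_right_lt.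
have Hclose x : `|Y s - x| < d -> `|Y t - x| < d0.
  move=> Hx; have := ler_normD (Y t - Y s) (Y s - x); rewrite subrKA.
  move: Hx Ys dd; clear; lra.
have H1 := Hd0 a b (Hclose _ Ha) (Hclose _ Hb).
have /(_ (a - b)) H2 : forall v, `|'D_v f (Y s) - 'D_v f (Y t)| <= e / 2 * `|v| by near: s.
rewrite !(Ck1_diffE _ kf I) in H2.
have := ler_normB (f a - f b - 'd f (Y t) (a - b)) ('d f (Y s) (a - b) - 'd f (Y t) (a - b)).
rewrite opprB addrA subrK => /le_trans; apply; apply: (le_trans (lerD H1 H2)).
by rewrite -mulrDl -splitr.
Unshelve. all: by end_near. Qed.

Lemma tube_diff : exists2 L, 0 < L & forall (t : R) v, `|'d f (Y t) v| <= L * `|v|.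
Proof.
pose P (L t : R) := forall v, `|'d f (Y t) v| <= L * `|v|.
suff : \forall L \near +oo, forall t : R, 0 <= t <= 1 -> P L t.
  move=> H; near +oo_R => L.
  have Hd : forall t : R, 0 <= t <= 1 -> P L t by near: L.
  exists L => [|t]; first by near: L; apply: nbhs_pinfty_gt; rewrite num_real.
  have := Hd _ (clamp_itv t); rewrite /P /Y clampE//; exact: clamp_itv.
apply: near_unit => t t01.
have HD : \forall s \near t, forall v, `|'D_v f (Y s) - 'D_v f (Y t)| <= 1 * `|v|.
  have H := Ck_diff_near (cV := cV) openT kf (I : setT (Y t)) ltr01.
  have H2 : \forall s \near t, setT (Y s) /\ forall v, `|'D_v f (Y s) - 'D_v f (Y t)| <= 1 * `|v|.
    exact: (cY (x := t) H).
  by apply: filterS H2 => s [].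
have [C C0 HC] := lin_boundW ('d f (Y t)).
near=> s L => v.
have /(_ v) H2 : forall v, `|'D_v f (Y s) - 'D_v f (Y t)| <= 1 * `|v| by near: s.
rewrite !(Ck1_diffE _ kf I) in H2.
have := ler_normD ('d f (Y s) v - 'd f (Y t) v) ('d f (Y t) v); rewrite subrK => /le_trans; apply.
have HL : 1 + C <= L by near: L; apply: nbhs_pinfty_ge; rewrite num_real.
apply: (le_trans (lerD H2 (HC v))).
by apply: le_trans (ler_wpM2r (normr_ge0 _) HL); rewrite mulrDl.
Unshelve. all: by end_near. Qed.

End Tube.

Section WithinArith.
Context {R : realType} {V : normedModType R} (T : topologicalType) (A : set T).

Lemma withinD (f g : T -> V) : {within A, continuous f} -> {within A, continuous g} ->
  {within A, continuous (fun t => f t + g t)}.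
Proof. by move=> cf cg x; apply: continuousD; [exact: cf|exact: cg]. Qed.

Lemma withinB (f g : T -> V) : {within A, continuous f} -> {within A, continuous g} ->
  {within A, continuous (fun t => f t - g t)}.
Proof. by move=> cf cg x; apply: continuousB; [exact: cf|exact: cg]. Qed.

End WithinArith.

Section Truncation.
Context {R : realType} {V : normedModType R} {cV : coords V}.

Definition trunc1 (r x : R) : R := Num.max (- r) (Num.min r x).

Lemma trunc1_le r x : 0 <= r -> `|trunc1 r x| <= r.
Proof.
move=> r0; rewrite /trunc1 ler_norml le_max lexx ge_max ge_min lexx /= andbT.
by rewrite (le_trans _ r0)// oppr_le0.
Qed.

Lemma trunc1_id r x : `|x| <= r -> trunc1 r x = x.
Proof. by rewrite ler_norml => /andP[h1 h2]; rewrite /trunc1 (min_r h2) max_r. Qed.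

Lemma trunc1_lip r x y : 0 <= r -> `|trunc1 r x - trunc1 r y| <= `|x - y|.
Proof.
move=> r0; wlog xy : x y / x <= y.
  move=> H; have [/H//|/ltW/H] := leP x y.
  by rewrite distrC [`|y - x|]distrC.
rewrite distrC [`|x - y|]distrC [leRHS]ger0_norm ?subr_ge0//.
have m : trunc1 r x <= trunc1 r y.
  rewrite /trunc1 ge_max !le_max lexx /=.
  by have [?|?] := leP r x; have [?|?] := leP r y; apply/orP; right; lra.
rewrite ger0_norm ?subr_ge0//.
rewrite /trunc1; have [?|?] := leP r x; have [?|?] := leP r y;
  rewrite /Num.max; (do 2 case: ltP => ?); lra.
Qed.

(** Truncation of every coordinate: a map onto the ball of radius r that does not
    increase distances, because the norm is the largest coordinate. *)
Definition trunc (r : R) (v : V) : V := \sum_i trunc1 r (cco i v) *: cbasis i.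

Lemma trunc_le r v : 0 <= r -> `|trunc r v| <= r.
Proof.
by move=> r0; apply: norm_le_cco => // i; rewrite /trunc cco_comb; exact: trunc1_le.
Qed.

Lemma trunc_id r v : `|v| <= r -> trunc r v = v.
Proof.
move=> vr; rewrite [RHS]cco_sum; apply: eq_bigr => i _.
by rewrite trunc1_id// (le_trans (cco_le i v)).
Qed.

Lemma trunc_lip r v v' : 0 <= r -> `|trunc r v - trunc r v'| <= `|v - v'|.
Proof.
move=> r0; apply: norm_le_cco => // i; rewrite linearB /= /trunc !cco_comb.
apply: (le_trans (trunc1_lip _ _ r0)).
by rewrite -[cco i v - _](linearB (cco i)); exact: cco_le.
Qed.

Lemma trunc_continuous r : 0 <= r -> continuous (trunc r).
Proof.
move=> r0 v; apply/cvgrPdist_lt => e e0; near=> v'.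
apply: (le_lt_trans (trunc_lip _ _ r0)); near: v'.
by apply/nbhs_normP; exists e.
Unshelve. all: by end_near. Qed.

End Truncation.

Section Neighbours.
Context {R : realType} {V : normedModType R} {cV : coords V}.
Variables (f : V -> V) (y0 : R -> V).
Hypothesis kf : Ck 1 setT f.
Hypothesis ty0 : trajectory f y0.

Let y0c (t : R) : 0 <= t <= 1 -> y0 (clamp t) = y0 t.
Proof. by move=> t01; rewrite clampE. Qed.

Lemma tube_lip : exists d L, [/\ 0 < d, 0 < L & forall (t : R) a b,
  `|y0 (clamp t) - a| < d -> `|y0 (clamp t) - b| < d -> `|f a - f b| <= L * `|a - b|].
Proof.
have [d d0 Hd] := tube_strict kf ty0 ltr01.
have [L L0 HL] := tube_diff kf ty0.
exists d, (1 + L); split => [//||t a b ta tb]; first by rewrite addr_gt0.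
have := ler_normD (f a - f b - 'd f (y0 (clamp t)) (a - b)) ('d f (y0 (clamp t)) (a - b)).
rewrite subrK => /le_trans; apply.
by apply: (le_trans (lerD (Hd _ _ _ ta tb) (HL _ _))); rewrite mulrDl.
Qed.

(** Replacing the displacement from y0 by its truncation makes the field globally
    Lipschitz, so that solutions exist on [0, 1]; by Gronwall those starting
    close to y0 never reach the truncated region and solve the original
    equation. *)
Lemma trajectory_near : exists d C, [/\ 0 < d, 0 < C,
  (forall x, `|y0 0 - x| < d -> exists y, [/\ trajectory f y, y 0 = x &
     forall t : R, 0 <= t <= 1 -> `|y0 t - y t| <= C * `|y0 0 - x|]) &
  (forall y1 y2, trajectory f y1 -> trajectory f y2 ->
     (forall t : R, 0 <= t <= 1 -> `|y0 t - y1 t| < d) ->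
     (forall t : R, 0 <= t <= 1 -> `|y0 t - y2 t| < d) ->
     forall t : R, 0 <= t <= 1 -> `|y1 t - y2 t| <= C * `|y1 0 - y2 0|)].
Proof.
have [d [L [d0 L0 HL]]] := tube_lip.
have [cy0 dy0] := ty0; have cY := within_clamp cy0.
pose C := 2 * expR (2 * L).
have C0 : 0 < C by rewrite mulr_gt0// expR_gt0.
have C1 : 1 <= C.
  have : 1 <= expR (2 * L) by rewrite -expR0 ler_expR mulr_ge0// ltW.
  by rewrite /C; lra.
pose r := d / 2; have r0 : 0 < r by rewrite divr_gt0.
have rd : r < d by rewrite /r ltr_pdivrMr// ltr_pMr// ltr1n.
pose g (t : R) v := f (y0 (clamp t) + trunc (cV := cV) r (v - y0 (clamp t))).
have cg (y : R -> V) : continuous y -> continuous (fun t => g t (y t)).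
  move=> cy t.
  apply: (@continuous_comp _ _ _ (fun t => y0 (clamp t) + trunc (cV := cV) r (y t - y0 (clamp t))) f).
    apply: continuousD; first exact: cY.
    apply: (@continuous_comp _ _ _ (fun t => y t - y0 (clamp t)) (trunc (cV := cV) r)).
      by apply: continuousB; [exact: cy|exact: cY].
    exact/trunc_continuous/ltW.
  exact: (Ck_cont kf).
have gL (t : R) a b : `|g t a - g t b| <= L * `|a - b|.
  have H v : `|y0 (clamp t) - (y0 (clamp t) + trunc (cV := cV) r v)| < d.
    rewrite opprD addrA subrr sub0r normrN.
    exact: le_lt_trans (trunc_le _ (ltW r0)) rd.
  apply: (le_trans (HL t _ _ (H _) (H _))); rewrite ler_pM2l//.
  rewrite opprD addrACA subrr add0r; apply: (le_trans (trunc_lip _ _ (ltW r0))).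
  by rewrite opprB addrA subrK.
have dC : 0 < d / C by rewrite divr_gt0.
have rC : 0 < r / C by rewrite divr_gt0.
exists (r / C), C; split => // [x xd|y1 y2 [c1 d1] [c2 d2] n1 n2 t t01].
  have [y [cy y00 dy]] := picard x L0 cg gL.
  have B (t : R) : 0 <= t <= 1 -> `|y0 t - y t| <= C * `|y0 0 - x|.
    have cw : {within `[0, 1], continuous (fun t => y0 t - y t)}.
      by move=> s; apply: continuousB; [exact: cy0|exact: (continuous_subspaceT cy)].
    have := @gronwall R V cV _ (fun t => f (y0 t) - g t (y t)) L 0 L0 (lexx 0) cw.
    rewrite y00 addr0 /C [2 * expR _ * _]mulrAC; apply => //.
      by move=> s s01; apply: is_deriveB; [exact: dy0|exact: dy].
    move=> s /andP[/ltW s0 /ltW s1]; rewrite addr0.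
    have -> : f (y0 s) = g s (y0 s).
      by rewrite /g y0c ?s0// subrr trunc_id ?addr0// normr0 ltW.
    exact: gL.
  have Br (t : R) : 0 <= t <= 1 -> `|y0 t - y t| <= r.
    move=> /B /le_trans; apply; rewrite mulrC -ler_pdivlMr//; exact: ltW.
  exists y; split => //; split; first exact: (continuous_subspaceT cy).
  move=> t t01; have := dy t t01; rewrite /g y0c; last by case/andP: t01 => /ltW-> /ltW->.
  rewrite trunc_id ?subrKC// distrC; apply: Br.
  by case/andP: t01 => /ltW-> /ltW->.
have rCd : r / C < d.
  by apply: le_lt_trans rd; rewrite ler_pdivrMr// ler_peMr// ltW.
have cw : {within `[0, 1], continuous (fun t => y1 t - y2 t)}.
  by move=> s; apply: continuousB; [exact: c1|exact: c2].
have := @gronwall R V cV _ (fun t => f (y1 t) - f (y2 t)) L 0 L0 (lexx 0) cw.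
rewrite addr0 /C [2 * expR _ * _]mulrAC; apply => //.
  by move=> s s01; apply: is_deriveB; [exact: d1|exact: d2].
move=> s /andP[/ltW s0 /ltW s1]; rewrite addr0.
have s01 : 0 <= s <= 1 by rewrite s0.
apply: (HL s); rewrite y0c//.
  exact: lt_trans (n1 _ s01) rCd.
exact: lt_trans (n2 _ s01) rCd.
Qed.

(** The equation is linear with coefficients bounded along the orbit, so Picard
    applies without truncation; linearity in v comes from Gronwall. *)
Lemma variational : exists z : V -> R -> V,
  (forall v, [/\ {within `[0, 1], continuous (z v)}, z v 0 = v &
     forall t : R, 0 < t < 1 -> is_derive t 1 (z v) ('d f (y0 t) (z v t))]) /\
  linear (fun v => z v 1).
Proof.
have [L L0 HL] := tube_diff kf ty0.
have [cy0 dy0] := ty0; have cY := within_clamp cy0.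
pose g (t : R) (v : V) := 'd f (y0 (clamp t)) v.
have cg (y : R -> V) : continuous y -> continuous (fun t => g t (y t)).
  move=> cy t.
  have -> : (fun t => g t (y t)) = (fun t => 'D_(y t) f (y0 (clamp t))).
    by apply/funext => s; rewrite (Ck1_diffE _ kf).
  have := @continuous_comp _ _ _ (fun t => (y0 (clamp t), y t)) (fun p => 'D_(p.2) f p.1) t.
  apply; first by apply: cvg_pair; [exact: cY|exact: cy].
  by apply: (Ck_cont (Ck_dir openT kf)).
have gL (t : R) a b : `|g t a - g t b| <= L * `|a - b|.
  by rewrite /g -linearB; exact: HL.
have [z Hz] := choice (fun x => picard x L0 cg gL).
have Hz' v : [/\ {within `[0, 1], continuous (z v)}, z v 0 = v &
     forall t : R, 0 < t < 1 -> is_derive t 1 (z v) ('d f (y0 t) (z v t))].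
  have [c i d] := Hz v; split => //; first exact: (continuous_subspaceT c).
  by move=> t /[dup] /andP[/ltW t0 /ltW t1] /d; rewrite /g y0c ?t0.
exists z; split => // a u v; apply/eqP; rewrite -subr_eq0 -normr_le0.
have [c1 i1 d1] := Hz' (a *: u + v); have [c2 i2 d2] := Hz' u; have [c3 i3 d3] := Hz' v.
have cw : {within `[0, 1], continuous (fun t => z (a *: u + v) t - (a *: z u t + z v t))}.
  apply: withinB; first exact: c1.
  apply: withinD; last exact: c3.
  exact: (within_comp (g := fun x : V => a *: x) c2 (@scaler_continuous R V a)).
have := @gronwall R V cV _ (fun t => 'd f (y0 t) (z (a *: u + v) t) -
  (a *: 'd f (y0 t) (z u t) + 'd f (y0 t) (z v t))) L 0 L0 (lexx 0) cw.
rewrite i1 i2 i3 subrr normr0 addr0 mulr0 mul0r; apply; last by rewrite lexx ler01.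
  move=> t t01; apply: is_deriveB; first exact: d1.
  apply: is_deriveD; last exact: d3.
  by apply: is_deriveZ; exact: d2.
by move=> t /andP[/ltW t0 /ltW t1]; rewrite addr0 -linearP -linearB -y0c ?t0.
Qed.

End Neighbours.

Section Flow.
Context {R : realType}.

Definition flowdom (V : normedModType R) (f : V -> V) : set V :=
  [set x | exists y, trajectory f y /\ y 0 = x].

Definition time1 (V : normedModType R) (f : V -> V) (x : V) : V :=
  xget 0 [set v | exists y, [/\ trajectory f y, y 0 = x & y 1 = v]].

Lemma time1E (V : normedModType R) {cV : coords V} (f : V -> V) (y : R -> V) :
  Ck 1 setT f -> trajectory f y -> time1 f (y 0) = y 1.
Proof.
move=> kf ty; rewrite /time1; case: xgetP => [_ -> [y' [ty' y'0 <-]]|].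
  by apply: (trajectory_unique kf ty' ty y'0); rewrite ler01 lexx.
by move=> /(_ (y 1)) []; exists y.
Qed.

Lemma flowdom_open (V : normedModType R) {cV : coords V} (f : V -> V) :
  Ck 1 setT f -> open (flowdom f).
Proof.
move=> kf; rewrite openE => x [y [ty <-]].
have [d [C [d0 _ H _]]] := trajectory_near kf ty.
apply/nbhs_normP; exists d => //= x' /= /H[y' [ty' y'0 _]].
by exists y'.
Qed.

(** The difference of two neighbouring trajectories minus the solution z of the
    variational equation starts at 0 and satisfies the same linear equation up
    to an error e |a - b|, uniformly along the orbit; Gronwall does the rest. *)
Lemma time1_strict (V : normedModType R) {cV : coords V} (f : V -> V) (y0 : R -> V) (z : V -> R -> V) :
  Ck 1 setT f -> trajectory f y0 ->
  (forall v, [/\ {within `[0, 1], continuous (z v)}, z v 0 = v &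
     forall t : R, 0 < t < 1 -> is_derive t 1 (z v) ('d f (y0 t) (z v t))]) ->
  strict_diff (time1 f) (y0 0) (fun v => z v 1).
Proof.
move=> kf ty0 Hz e e0.
have [d [C [d0 C0 HE HC]]] := trajectory_near kf ty0.
have [L L0 HL] := tube_diff kf ty0.
(* the constant that Gronwall and the comparison of trajectories put in front
of the error *)
pose K := 2 * C * expR (2 * L).
have K0 : 0 < K by rewrite !mulr_gt0// expR_gt0.
have eK0 : 0 < e / K by rewrite divr_gt0.
have [d1 d10 Hd1] := tube_strict kf ty0 eK0.
pose dm := Num.min d (Num.min (d / C) (d1 / C)).
have dm0 : 0 < dm by rewrite !lt_min d0 !divr_gt0.
have nD : \forall x \near y0 0, `|y0 0 - x| < dm by apply/nbhs_normP; exists dm.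
near=> a b.
have ad : `|y0 0 - a| < dm by near: a.
have bd : `|y0 0 - b| < dm by near: b.
have HE' x : `|y0 0 - x| < dm -> exists y, [/\ trajectory f y, y 0 = x,
    forall t : R, 0 <= t <= 1 -> `|y0 t - y t| < d &
    forall t : R, 0 <= t <= 1 -> `|y0 t - y t| < d1].
  rewrite !lt_min => /and3P[x1 x2 x3]; have [y [ty y_0 By]] := HE x x1.
  exists y; split => // t /By /le_lt_trans; apply; by rewrite mulrC -ltr_pdivlMr.
have [ya [tya ya0 ad0 ad1]] := HE' a ad.
have [yb [tyb yb0 bd0 bd1]] := HE' b bd.
have Ea : time1 f a = ya 1 by rewrite -ya0; exact: time1E.
have Eb : time1 f b = yb 1 by rewrite -yb0; exact: time1E.
rewrite /= Ea Eb.
have [cz z0 dz] := Hz (a - b); have [cya dya] := tya; have [cyb dyb] := tyb.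
have cw : {within `[0, 1], continuous (fun t => ya t - yb t - z (a - b) t)}.
  by apply: withinB => //; exact: withinB.
have B0 : 0 <= e / K * (C * `|a - b|) by rewrite !mulr_ge0// ltW// invr_gt0.
have := @gronwall R V cV _ (fun t => f (ya t) - f (yb t) - 'd f (y0 t) (z (a - b) t))
  L _ L0 B0 cw.
rewrite ya0 yb0 z0 subrr normr0 add0r.
rewrite (_ : 2 * _ * _ = e * `|a - b|); last first.
  by rewrite /K; field; rewrite !gt_eqF// expR_gt0.
move=> G; apply: (G _ _ 1); last by rewrite ler01 lexx.
  by move=> t t01; apply: is_deriveB; [apply: is_deriveB; [exact: dya|exact: dyb]|exact: dz].
move=> t /andP[/ltW t0 /ltW t1]; have t01 : 0 <= t <= 1 by rewrite t0.
have := Hd1 t (ya t) (yb t); have := HL t (ya t - yb t - z (a - b) t); rewrite clampE//.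
move=> H1 /(_ (ad1 _ t01) (bd1 _ t01)) H2.
have := HC ya yb tya tyb ad0 bd0 t t01; rewrite ya0 yb0 => H3.
have := ler_normD (f (ya t) - f (yb t) - 'd f (y0 t) (ya t - yb t))
  ('d f (y0 t) (ya t - yb t - z (a - b) t)).
rewrite [X in `|_ + X|]linearB /= addrA subrK => /le_trans; apply.
rewrite addrC lerD//; apply: (le_trans H2).
by rewrite ler_wpM2l// ltW.
Unshelve. all: by end_near. Qed.

Lemma time1_C1 (V : normedModType R) {cV : coords V} (f : V -> V) :
  Ck 1 setT f -> Ck 1 (flowdom f) (time1 f).
Proof.
move=> kf; apply: strict_Ck1; first exact: flowdom_open.
move=> x [y0 [ty0 <-]]; have [z [Hz lz]] := variational kf ty0.
exists (HB.pack_for {linear V -> V} (fun v => z v 1) (GRing.isLinear.Build _ _ _ _ _ lz)).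
exact: time1_strict.
Qed.

Definition tangent_field (V : normedModType R) (f : V -> V) (p : V * V) : V * V :=
  (f p.1, 'D_(p.2) f p.1).

Lemma tangent_field_Ck (V : normedModType R) {cV : coords V} k (f : V -> V) :
  Ck k.+1 setT f -> Ck k setT (tangent_field f).
Proof.
move=> kf; apply: Ck_pair; first exact: openT.
  apply: (Ck_comp (B := setT) openT) => //; last exact: Ck_S.
  by apply: Ck_fst; [exact: openT|exact: Ck_id].
by apply: Ck_sub (Ck_dir openT kf) => -[].
Qed.

(** A trajectory together with a solution of its variational equation is a
    trajectory of the tangent field. *)
Lemma derive_time1 (V : normedModType R) {cV : coords V} (f : V -> V) x v :
  Ck 2 setT f -> flowdom f x ->
  flowdom (tangent_field f) (x, v) /\
  'D_v (time1 f) x = (time1 (tangent_field f) (x, v)).2.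
Proof.
move=> kf2 [y0 [ty0 <-]]; have kf : Ck 1 setT f by exact: Ck_S.
have [z [Hz lz]] := variational kf ty0.
have [cz z0 dz] := Hz v; have [cy0 dy0] := ty0.
have tp : trajectory (tangent_field f) (fun t => (y0 t, z v t)).
  split; first by move=> s; apply: cvg_pair; [exact: cy0|exact: cz].
  move=> t t01; rewrite /tangent_field /= (Ck1_diffE _ kf)//.
  have [d1 e1] := dy0 t t01; have [d2 e2] := dz t t01.
  have d1' : differentiable y0 t by exact/derivable1_diffP.
  have d2' : differentiable (z v) t by exact/derivable1_diffP.
  split; first by apply/derivable1_diffP; exact: differentiable_pair.
  by rewrite derive_pair// e1 e2.
split; first by exists (fun t => (y0 t, z v t)); rewrite z0.
have := time1E (tangent_field_Ck kf2) tp; rewrite /= z0 => -> /=.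
pose Z := (HB.pack_for {linear V -> V} (fun v => z v 1) (GRing.isLinear.Build _ _ _ _ _ lz)).
have sZ : strict_diff (time1 f) (y0 0) Z by exact: time1_strict.
by have [d e] := strict_is_diff sZ; rewrite deriveE// e.
Qed.

(** The derivative of the time-one map is a component of the time-one map of the
    tangent field, which is one class less regular. *)
Theorem time1_Ck (V : normedModType R) {cV : coords V} k (f : V -> V) :
  Ck k.+1 setT f -> Ck k.+1 (flowdom f) (time1 f).
Proof.
elim: k V cV f => [|k IH] V cV f kf; first exact: time1_C1.
have kf1 : Ck 1 setT f by exact: Ck_le kf.
have kf2 : Ck 2 setT f by exact: Ck_le kf.
have oD : open (flowdom f) by exact: flowdom_open.
split=> [x Dx|v]; first exact: (Ck_diff (time1_C1 kf1) Dx).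
apply: (Ck_ext (f := fun x => (time1 (tangent_field f) (x, v)).2) oD).
  by move=> x /(derive_time1 v kf2)[_ ->].
apply: Ck_snd => //.
apply: (Ck_comp (B := flowdom (tangent_field f)) oD (f := fun x => (x, v))).
- by move=> x /(derive_time1 v kf2)[].
- by apply: Ck_pair => //; [exact: Ck_id|exact: Ck_cst].
- by apply: IH; exact: tangent_field_Ck.
Qed.

End Flow.

(** * Smoothness of the blow-up *)

Section BlowUp.
Context {R : realType} {V : normedModType R} {cV : coords V}.
Variable F : V -> R -> R -> V.
Let Fp (p : V * R * R) := F p.1.1 p.1.2 p.2.

(** The limit of F (mu y) mu eta / mu as mu tends to 0, when F vanishes at the
    origin. *)
Definition radial_derivative (y : V) (eta : R) : V := 'D_((y, 1), 0) Fp ((0, 0), eta).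

Definition blowup (p : V * R * R) : V :=
  if p.1.2 == 0 then radial_derivative p.1.1 p.2
  else p.1.2^-1 *: F (p.1.2 *: p.1.1) p.1.2 p.2.

(** The components of the state are the value q, the time s, and the constants
    (y, mu, eta); q' is the derivative of F in the direction (y, 1, 0) at the
    point reached on the ray at time s. At mu = 0 this point is the origin for
    all s, and nothing is divided by mu. *)
Definition ray_field (s : V * R * (V * R * R)) : V * R * (V * R * R) :=
  (('D_((s.2.1.1, 1), 0) Fp (((s.1.2 * s.2.1.2) *: s.2.1.1, s.1.2 * s.2.1.2), s.2.2), 1), 0).

Lemma ray_field_Ck k : Ck k.+1 setT Fp -> Ck k setT ray_field.
Proof.
move=> kF; have oT (U : normedModType R) : open [set: U] by exact: openT.
have k0 : Ck k [set: V * R * (V * R * R)] id by exact: Ck_id.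
have k12 : Ck k [set: V * R * (V * R * R)] (fun s => s.1.2).
  by apply: Ck_snd => //; exact: Ck_fst.
have k211 : Ck k [set: V * R * (V * R * R)] (fun s => s.2.1.1).
  by do 2 apply: Ck_fst => //; exact: Ck_snd.
have k212 : Ck k [set: V * R * (V * R * R)] (fun s => s.2.1.2).
  by apply: Ck_snd => //; apply: Ck_fst => //; exact: Ck_snd.
have k22 : Ck k [set: V * R * (V * R * R)] (fun s => s.2.2).
  by do 2 apply: Ck_snd => //.
have kp : Ck k [set: V * R * (V * R * R)] (fun s => s.1.2 * s.2.1.2).
  by exact: (Ck_scale (W := R) (oT _) k12 k212).
apply: Ck_pair => //; last exact: Ck_cst.
apply: Ck_pair => //; last exact: Ck_cst.
have kf : Ck k [set: V * R * (V * R * R)] (fun s => (((((s.1.2 * s.2.1.2) *: s.2.1.1,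
    s.1.2 * s.2.1.2), s.2.2), ((s.2.1.1, 1), 0)) : (V * R * R) * (V * R * R))).
  apply: Ck_pair => //; first (apply: Ck_pair => //; apply: Ck_pair => //; exact: Ck_scale).
  by apply: Ck_pair => //; [apply: Ck_pair => //|]; exact: Ck_cst.
have kg := Ck_dir (cV := coords_prod (coords_prod cV coordsR) coordsR) openT kF.
have AB : forall s : V * R * (V * R * R), setT s ->
    (setT `*` setT) (((((s.1.2 * s.2.1.2) *: s.2.1.1,
    s.1.2 * s.2.1.2), s.2.2), ((s.2.1.1, 1), 0)) : (V * R * R) * (V * R * R)) by [].
exact: (Ck_comp (oT _) AB kf kg).
Qed.

Hypothesis F0 : forall eta, F 0 0 eta = 0.

(** For mu <> 0 the curve F (t mu y) (t mu) eta / mu has this velocity by the chain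
    rule; for mu = 0 the velocity is constant. *)
Lemma ray_trajectory p : Ck 1 setT Fp -> exists y, [/\ trajectory ray_field y,
  y 0 = ((0, 0), p) & (y 1).1.1 = blowup p].
Proof.
move=> kF; case: p => [[u mu] eta].
pose c := radial_derivative u eta.
pose q (t : R) := if mu == 0 then t *: c else mu^-1 *: F ((t * mu) *: u) (t * mu) eta.
have dq (t : R) : is_derive t 1 q ('D_((u, 1), 0) Fp (((t * mu) *: u, t * mu), eta)).
  rewrite /q; have [->|mu0] := eqVneq mu 0.
    rewrite mulr0 scale0r -/c; have := is_derive_line 0 c t.
    by under eq_fun do rewrite add0r.
  pose l (s : R) : V * R * R := ((0, 0), eta) + (s * mu) *: ((u, 1), 0).
  have El s : l s = (((s * mu) *: u, s * mu), eta).
    rewrite /l; apply: injective_projections => /=; last by rewrite scaler0 addr0.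
    by apply: injective_projections => /=; rewrite add0r// [_ *: _]mulr1.
  have dl : is_derive t 1 l (mu *: ((u, 1), 0)).
    have := is_derive_line ((0, 0), eta) (mu *: (((u, 1), 0) : V * R * R)) t.
    by under eq_fun do rewrite scalerA.
  have dF := Ck_diff kF (I : setT (l t)).
  have := is_deriveZ mu^-1 (is_derive_curve dF dl).
  rewrite derive_dirZ// scalerA mulVf// scale1r El.
  rewrite (_ : (mu^-1 \*: _) = (fun s => mu^-1 *: F ((s * mu) *: u) (s * mu) eta)) //.
  by apply/funext => s /=; rewrite El.
exists (fun t => ((q t, t), ((u, mu), eta))); split.
- have dy (t : R) : is_derive t 1 (fun t => ((q t, t), ((u, mu), eta)))
     (ray_field ((q t, t), ((u, mu), eta))).
    have [d1 e1] := dq t.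
    have d1' : differentiable q t by exact/derivable1_diffP.
    have d2 : differentiable (fun s : R => s) t by [].
    have d3 : differentiable (fun s => (q s, s)) t by exact: differentiable_pair.
    have d4 : differentiable (fun s : R => ((u, mu), eta)) t by exact: differentiable_cst.
    split; first by apply/derivable1_diffP; exact: differentiable_pair.
    by rewrite derive_pair// derive_pair// e1 derive_id derive_cst.
  split=> // ; apply: derivable_within_continuous => t _; by have [] := dy t.
- rewrite /q mul0r !scale0r F0 scaler0; by case: ifP.
- by rewrite /q /blowup /= mul1r scale1r; case: ifP.
Qed.

(** Loses one class because the equation involves a derivative of F. Expressing
    the blow-up as a time-one map treats mu = 0 and mu <> 0 alike. *)
Lemma blowup_Ck k : Ck k.+2 setT Fp -> Ck k.+1 setT blowup.
Proof.
move=> kF; have kF1 : Ck 1 setT Fp by exact: Ck_le kF.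
have kr : Ck k.+1 setT ray_field by exact: ray_field_Ck.
have kr1 : Ck 1 setT ray_field by exact: Ck_le kr.
have oT (U : normedModType R) : open [set: U] by exact: openT.
have D p : flowdom ray_field ((0, 0), p) /\ (time1 ray_field ((0, 0), p)).1.1 = blowup p.
  have [y [ty y0 y1]] := ray_trajectory p kF1; split; first by exists y.
  by rewrite -y0 (time1E kr1 ty).
apply: (Ck_ext (f := fun p => (time1 ray_field ((0, 0), p)).1.1) (oT _)).
  by move=> p _; case: (D p).
do 2 apply: Ck_fst => //.
apply: (Ck_comp (B := flowdom ray_field) (f := fun p => ((0, 0), p)) (oT _)).
- by move=> p _; case: (D p).
- by apply: Ck_pair => //; [exact: Ck_cst|exact: Ck_id].
- exact: time1_Ck.
Qed.

End BlowUp.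

Section Slices.
Context {R : realType}.

(** A directional derivative only sees the restriction to a line. *)
Lemma derive_congr (V V' W : normedModType R) (f : V -> W) (g : V' -> W) x y v w :
  (forall h : R, f (h *: v + x) = g (h *: w + y)) -> 'D_v f x = 'D_w g y.
Proof.
move=> H; have H0 : f x = g y by have := H 0; rewrite !scale0r !add0r.
rewrite /derive; apply: (congr1 (fun F : R -> W => lim (F @ 0^'))).
by apply/funext => h /=; rewrite H H0.
Qed.

Lemma jac_mul p q (f : 'cV[R]_p -> 'cV[R]_q) x v : jac f x *m v = 'd f x v.
Proof.
have Ev : v = \sum_j v j 0 *: delta_mx j 0.
  rewrite [LHS]matrix_sum_delta; apply: eq_bigr => j _.
  by rewrite big_ord1.
rewrite [in RHS]Ev linear_sum; apply/colP => i; rewrite mxE summxE.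
by apply: eq_bigr => j _; rewrite linearZ /= !mxE mulrC.
Qed.

Lemma dotvE p (a b : 'cV[R]_p) : a^T *m b = (dotv a b)%:M.
Proof. by apply/matrixP => i j; rewrite !ord1 [RHS]mxE mulr1n. Qed.

Lemma dotv_is_linear p (a : 'cV[R]_p) : linear (dotv a : 'cV[R]_p -> R^o).
Proof. by move=> c x y; rewrite /dotv mulmxDr -scalemxAr !mxE. Qed.
HB.instance Definition _ p (a : 'cV[R]_p) :=
  GRing.isLinear.Build R 'cV[R]_p R^o *:%R (dotv a) (@dotv_is_linear p a).

End Slices.

Section BlowUpHybrid.
Context {R : realType} {m : nat}.
Notation state := 'cV[R]_m.+1.
Variables (F Reset W : state -> R -> R -> state) (C : state).
Let joint (G : state -> R -> R -> state) (p : (state * R * R)%type) : state := G p.1.1 p.1.2 p.2.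

Lemma radial_derivativeE (y : state) (eta : R) : Ck 1 setT (joint F) ->
  radial_derivative F y eta = coefA F eta *m y + Defs.coefM F eta.
Proof.
move=> kF; have dF := Ck_diff kF (I : setT ((0, 0), eta)).
have dslice : differentiable (fun x => F x 0 eta) (0 : state).
  have di : differentiable (fun x : state => (((x, 0), eta) : state * R * R)) 0.
    by apply: differentiable_pair; [apply: differentiable_pair|]; [by []|exact: differentiable_cst|exact: differentiable_cst].
  exact: (differentiable_comp (f := fun x : state => (((x, 0), eta) : state * R * R)) (g := joint F) di dF).
rewrite /radial_derivative (deriveE _ dF).
have -> : ((y, 1), 0) = ((y, 0), 0) + ((0, 1), 0) :> state * R * R.
  by apply: injective_projections => /=; [apply: injective_projections => /=|]; rewrite ?addr0 ?add0r.
rewrite linearD; congr (_ + _).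
  rewrite -(deriveE ((y, 0), 0) dF) /coefA jac_mul -(deriveE y dslice).
  by apply: derive_congr => h; rewrite /joint /= !addr0 !scaler0 ?add0r.
rewrite -(deriveE (((0, 1), 0) : state * R * R) dF).
by apply: derive_congr => h; rewrite /joint /= !addr0 !scaler0 ?add0r.
Qed.

Lemma blowup_fieldE y mu eta : Ck 1 setT (joint F) ->
  blowup_field F y mu eta = blowup F ((y, mu), eta).
Proof. by move=> kF; rewrite /blowup_field /blowup /= radial_derivativeE. Qed.

Hypothesis F0 : forall eta, F 0 0 eta = 0.
Hypothesis ResetE : forall x mu eta, Reset x mu eta = x + velocity F C x mu eta *: W x mu eta.

(** Product rule for velocity times W: the velocity vanishes at the origin, so
    only the value W 0 0 eta enters. *)
Lemma radial_derivative_reset (y : state) (eta : R) :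
  Ck 1 setT (joint F) -> Ck 1 setT (joint W) ->
  radial_derivative Reset y eta =
    (1%:M - Defs.coefB W eta *m C^T *m coefA F eta) *m y - Defs.coefB W eta *m C^T *m Defs.coefM F eta.
Proof.
move=> kF kW; have dF := Ck_diff kF (I : setT ((0, 0), eta)).
have dW := Ck_diff kW (I : setT ((0, 0), eta)).
have cC : continuous (dotv C) by exact: (lin_continuous (W := R^o)).
have dv : differentiable (fun p : state * R * R => dotv C (F p.1.1 p.1.2 p.2)) ((0, 0), eta).
  by apply: (differentiable_comp (f := joint F) (g := dotv C)) => //; exact: linear_differentiable.
have [d e] := is_diff_scale dv dW.
have df1 : differentiable (fun p : state * R * R => p.1.1) ((0, 0), eta).
  have k : Ck 1 [set: state * R * R] (fun p => p.1.1).
    by do 2 (apply: Ck_fst; first exact: openT); exact: Ck_id.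
  exact: (Ck_diff k I).
rewrite -[LHS]/('D_(((y, 1), 0) : state * R * R) (joint Reset) ((0, 0), eta)).
have -> : joint Reset = (fun p => p.1.1) +
    (fun p : state * R * R => dotv C (F p.1.1 p.1.2 p.2) *: W p.1.1 p.1.2 p.2).
  by apply/funext => p; rewrite /joint ResetE.
rewrite deriveD; [|exact: diff_derivable|exact: diff_derivable].
rewrite derive_scale// (derive_comp (f := joint F) (g := dotv C))//; last exact: linear_differentiable.
rewrite (derive_linear _ _ cC) /= F0 linear0 scale0r add0r.
rewrite -[X in dotv C X]/(radial_derivative F y eta) radial_derivativeE//.
have -> : 'D_((y, 1), 0) (fun p : state * R * R => p.1.1) ((0, 0), eta) = y.
  have -> : 'D_((y, 1), 0) (fun p : state * R * R => p.1.1) ((0, 0), eta) = 'D_y id 0.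
    by apply: derive_congr => h.
  exact: derive_id.
rewrite mulmxBl mul1mx -addrA; congr (_ + _).
rewrite -opprD /Defs.coefB -!mulmxA -mulmxDr -mulmxDr dotvE mulNmx opprK.
by rewrite mul_mx_scalar.
Qed.

Lemma blowup_resetE y mu eta : Ck 1 setT (joint F) -> Ck 1 setT (joint W) ->
  blowup_reset F W Reset C y mu eta = blowup Reset ((y, mu), eta).
Proof. by move=> kF kW; rewrite /blowup_reset /blowup /= radial_derivative_reset. Qed.

End BlowUpHybrid.

(** * Flows with parameters and travel time *)

Lemma within_pair (R : realType) (V W : normedModType R) (T : topologicalType) (A : set T)
    (f : T -> V) (g : T -> W) : {within A, continuous f} -> {within A, continuous g} ->
  {within A, continuous (fun t => (f t, g t))}.
Proof. by move=> cf cg x; apply: cvg_pair; [exact: cf|exact: cg]. Qed.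

Section TimedFlow.
Context {R : realType} {V : normedModType R} {cV : coords V}.

Lemma derive0_cst (W : normedModType R) {cW : coords W} (z : R -> W) :
  {within `[0, 1], continuous z} -> (forall t : R, 0 < t < 1 -> is_derive t 1 z 0) ->
  forall t : R, 0 <= t <= 1 -> z t = z 0.
Proof.
move=> cz dz t /andP[t0 t1].
have cw : {within `[0, t], continuous z}.
  by apply: continuous_subspaceW cz => x /=; rewrite !in_itv /= => /andP[->] /le_trans; apply.
have c0 : {within `[0, t], continuous (fun=> 0 : R)}.
  exact: (continuous_subspaceT (@cst_continuous _ _ (0 : R))).
have := @mean_value_le R W cW z (fun=> 0) (fun=> 0) (fun=> 0) 0 t t0 cw c0.
rewrite subr0 => H; apply/eqP; rewrite -subr_eq0 -normr_le0; apply: H.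
- by move=> s /andP[s0 st]; apply: dz; rewrite s0 (lt_le_trans st).
- by move=> s _; rewrite normr0.
Qed.

Variable G : V -> R -> R -> V.
Let S : normedModType R := (V * R * R * R)%type.

(** Parameters and travel time are made constant components of the state, so that
    smoothness of the time-one map is smoothness in all of them. *)
Definition timed_field (p : V * R * R * R) : V * R * R * R :=
  (((p.2 *: G p.1.1.1 p.1.1.2 p.1.2, 0), 0), 0).

Definition solves (T mu eta : R) (y : R -> V) :=
  {within `[0, T], continuous y} /\
  forall t : R, 0 < t < T -> is_derive t 1 y (G (y t) mu eta).

Definition timed_flow (x : V) (mu eta t : R) : V :=
  (time1 timed_field (((x, mu), eta), t)).1.1.1.

Hypothesis kG : Ck 1 setT (fun p : V * R * R => G p.1.1 p.1.2 p.2).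

Lemma timed_field_Ck k : Ck k setT (fun p : V * R * R => G p.1.1 p.1.2 p.2) ->
  Ck k setT timed_field.
Proof.
move=> kGk; have oT : open [set: V * R * R * R] by exact: openT.
do 3 (apply: Ck_pair => //; last exact: Ck_cst).
apply: Ck_scale => //; first by apply: Ck_snd => //; exact: Ck_id.
apply: (Ck_comp (B := setT) (f := fun p : V * R * R * R => p.1)
  (g := fun p : V * R * R => G p.1.1 p.1.2 p.2) oT) => //.
by apply: Ck_fst => //; exact: Ck_id.
Qed.

Lemma rescale_within (W : topologicalType) (y : R -> W) (T t : R) : 0 <= t <= T ->
  {within `[0, T], continuous y} -> {within `[0, 1], continuous (fun s => y (t * s))}.
Proof.
move=> /andP[t0 tT] /subspace_continuousP cy; apply/subspace_continuousP => s.
rewrite /= in_itv => /andP[s0 s1] A HA.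
have ts : `[0, T]%classic (t * s).
  by rewrite /= in_itv /= mulr_ge0//= (le_trans _ tT)// ler_piMr.
have H : nbhs (t * s) [set u | `[0, T]%classic u -> A (y u)] := cy _ ts A HA.
have H2 := @mulrl_continuous R t s _ H.
move: H2; apply: (@filterS _ _ _ ( *%R t @^-1` [set u | `[0, T]%classic u -> A (y u)])) => u Hu; rewrite /= in_itv /= => /andP[u0 u1]; apply: Hu.
by rewrite /= in_itv /= mulr_ge0//= (le_trans _ tT)// ler_piMr.
Qed.

Lemma is_derive_rescale (W : normedModType R) (y : R -> W) (c s : R) (dy : W) :
  is_derive (c * s) 1 y dy -> is_derive s 1 (fun s => y (c * s)) (c *: dy).
Proof.
move=> [d e]; have d' : differentiable y (c * s) by exact/derivable1_diffP.
have l : is_derive s 1 (fun s : R => c * s) c.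
  have := is_derive_line (0 : R) c s.
  rewrite (_ : (fun s : R => 0 + s *: c) = (fun s => c * s))//.
  by apply/funext => r; rewrite add0r [_ *: _]mulrC.
have := is_derive_curve (f := y) (y := fun s => c * s) d' l.
by rewrite -[X in 'D_X _ _](mulr1 c) (derive_dirZ c (1 : R) d') e.
Qed.

(** Time is rescaled by t; for t = 0 the trajectory is constant. *)
Lemma solves_trajectory T mu eta y t : 0 <= t <= T -> solves T mu eta y ->
  trajectory timed_field (fun s => (((y (t * s), mu), eta), t)).
Proof.
move=> t0T [cy dy]; have /andP[t0 tT] := t0T; split.
  do 3 (apply: within_pair; last exact: continuous_subspaceT (@cst_continuous _ _ _)).
  exact: (rescale_within t0T cy).
move=> s /andP[s0 s1]; rewrite /timed_field /=.
have [d e] : is_derive s 1 (fun s => y (t * s)) (t *: G (y (t * s)) mu eta).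
  have [->|tn0] := eqVneq t 0.
    rewrite scale0r (_ : (fun s => _) = cst (y 0)); first exact: is_derive_cst.
    by apply/funext => r; rewrite mul0r.
  have tp : 0 < t by rewrite lt_neqAle eq_sym tn0.
  apply: is_derive_rescale; apply: dy; rewrite mulr_gt0//=.
  by apply: lt_le_trans tT; rewrite gtr_pMr.
have d1 : differentiable (fun s => y (t * s)) s by exact/derivable1_diffP.
have dc (W : normedModType R) (c : W) : differentiable (fun _ : R => c) s by exact: differentiable_cst.
have d2 := differentiable_pair d1 (dc _ mu).
have d3 := differentiable_pair d2 (dc _ eta).
have d4 := differentiable_pair d3 (dc _ t).
split; first exact/derivable1_diffP.
by rewrite derive_pair// derive_pair// derive_pair// e !derive_cst.
Qed.

Lemma solves_flow T mu eta y t : 0 <= t <= T -> solves T mu eta y ->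
  flowdom timed_field (((y 0, mu), eta), t) /\ timed_flow (y 0) mu eta t = y t.
Proof.
move=> t0T sy; have ty := solves_trajectory t0T sy; split.
  by exists (fun s => (((y (t * s), mu), eta), t)); split => //; rewrite mulr0.
by rewrite /timed_flow; have := time1E (timed_field_Ck kG) ty; rewrite mulr0 mulr1 => ->.
Qed.

Lemma flow_solves x mu eta t : 0 < t -> flowdom timed_field (((x, mu), eta), t) ->
  exists y, [/\ solves t mu eta y & y 0 = x].
Proof.
move=> t0 [z [[cz dz] z0]].
have cst_ (W : normedModType R) (cW : coords W) (L : {linear (V * R * R * R)%type -> W}) :
    (forall p, L (timed_field p) = 0) -> forall s : R, 0 <= s <= 1 -> L (z s) = L (((x, mu), eta), t).
  move=> L0 s s01; have cL : continuous L by exact: lin_continuous.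
  rewrite -z0; apply: (derive0_cst (cW := cW) (z := fun s => L (z s))) => //.
    exact: (within_comp (g := L) cz cL).
  by move=> r r01; rewrite -(L0 (z r)); apply: is_derive_lin => //; exact: dz.
have Emu (s : R) : 0 <= s <= 1 -> (z s).1.1.2 = mu.
  exact: (cst_ _ _ (@snd V R \o @fst (V * R) R \o @fst (V * R * R) R)).
have Eeta (s : R) : 0 <= s <= 1 -> (z s).1.2 = eta.
  exact: (cst_ _ _ (@snd (V * R) R \o @fst (V * R * R) R)).
have Et (s : R) : 0 <= s <= 1 -> (z s).2 = t.
  exact: (cst_ _ _ (@snd (V * R * R) R)).
have dy (s : R) : 0 < s < 1 -> is_derive s 1 (fun s => (z s).1.1.1) (t *: G (z s).1.1.1 mu eta).
  move=> s01; have s01' : 0 <= s <= 1 by move/andP: s01 => [/ltW-> /ltW->].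
  have := is_derive_lin (f := (@fst V R \o @fst (V * R) R \o @fst (V * R * R) R)) _ (dz s s01).
  rewrite /= Emu// Eeta// Et//; apply; exact: lin_continuous.
have ti : 0 < t^-1 by rewrite invr_gt0.
exists (fun s => (z (t^-1 * s)).1.1.1); split; last by rewrite mulr0 z0.
split.
  have cy : {within `[0, 1], continuous (fun s => (z s).1.1.1)}.
    apply: (within_comp (g := (@fst V R \o @fst (V * R) R \o @fst (V * R * R) R)) cz).
    exact: lin_continuous.
  apply/subspace_continuousP => s; rewrite /= in_itv => /andP[s0 s1] A HA.
  have ts u : `[0, t]%classic u -> `[0, 1]%classic (t^-1 * u).
    rewrite /= !in_itv /= => /andP[u0 u1].
    by rewrite mulr_ge0 ?(ltW ti)//= mulrC ler_pdivrMr// mul1r.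
  have ss : `[0, t]%classic s by rewrite /= in_itv; apply/andP.
  have H : nbhs (t^-1 * s) [set u | `[0, 1]%classic u -> A (z u).1.1.1].
    by move/subspace_continuousP: cy => /(_ _ (ts _ ss) A HA).
  have H2 := @mulrl_continuous R t^-1 s _ H.
  move: H2; apply: (@filterS _ _ _ ( *%R t^-1 @^-1`
    [set u | `[0, 1]%classic u -> A (z u).1.1.1])) => u Hu /ts; exact: Hu.
move=> s /andP[s0 s1].
have ts : 0 < t^-1 * s < 1 by rewrite mulr_gt0//= mulrC ltr_pdivrMr// mul1r.
have := is_derive_rescale (dy _ ts).
by rewrite scalerA mulVf ?scale1r// gt_eqF.
Qed.

End TimedFlow.

(** * The first-return map *)

Section ReturnMap.
Context {R : realType} {m : nat}.
Notation state := 'cV[R]_m.+1.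
Variables (G Rt : state -> R -> R -> state) (C : state) (Q : 'M[R]_(m, m.+1)).

(** [poincare_graph] with an arbitrary smooth field and reset law in place of the
    blown-up ones. *)
Definition return_graph (mu eta : R) (u u' : 'cV[R]_m) : Prop :=
  outgoing G C mu eta (zeta_inv C Q u) /\
  exists (tau : R) (y : R -> state),
    [/\ 0 < tau, is_solution (fun z => G z mu eta) tau y &
        y 0 = zeta_inv C Q u] /\
    [/\ (forall t : R, 0 < t < tau -> ~ surface C (y t)),
        incoming G C mu eta (y tau) &
        u' = Q *m Rt (y tau) mu eta].

Hypothesis kG1 : Ck 1 setT (fun p : state * R * R => G p.1.1 p.1.2 p.2).

(** Two solutions agree while both exist, and each stops at its first return. *)
Lemma return_graph_functional mu eta u u1 u2 :
  return_graph mu eta u u1 -> return_graph mu eta u u2 -> u1 = u2.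
Proof.
move=> [_ [t1 [y1 [[t10 s1 y10] [n1 [i1 _] ->]]]]] [_ [t2 [y2 [[t20 s2 y20] [n2 [i2 _] ->]]]]].
have E t : 0 <= t <= t1 -> 0 <= t <= t2 -> y1 t = y2 t.
  move=> h1 h2; have [_ <-] := solves_flow kG1 h1 s1.
  by have [_ <-] := solves_flow kG1 h2 s2; rewrite y10 y20.
have [lt|lt|eq] := ltgtP t1 t2.
- case: (n2 t1); first by rewrite t10.
  by rewrite -E// ?lexx ?(ltW t10)//= ltW.
- case: (n1 t2); first by rewrite t20.
  by rewrite E// ?lexx ?(ltW t20)//= ltW.
- by rewrite eq in E *; rewrite E// ?lexx ltW.
Qed.

Lemma solution_MVT (T mu eta : R) y a b : is_solution (fun z => G z mu eta) T y ->
  0 <= a -> a < b -> b <= T -> exists2 c, a < c < b &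
  dotv C (y b) - dotv C (y a) = velocity G C (y c) mu eta * (b - a).
Proof.
move=> [cy dy] a0 ab bT.
have cC : continuous (dotv C) by exact: (lin_continuous (W := R^o)).
have cg : {within `[a, b], continuous (fun t => dotv C (y t))}.
  apply: (within_comp (g := dotv C)) => //.
  apply: continuous_subspaceW cy => x /=; rewrite !in_itv /= => /andP[ax xb].
  by rewrite (le_trans a0 ax) (le_trans xb bT).
have dg (t : R) : t \in `]a, b[ -> is_derive t 1 (fun t => dotv C (y t)) (velocity G C (y t) mu eta).
  rewrite in_itv /= => /andP[at_ tb].
  apply: (is_derive_lin (W := R^o) (f := dotv C)) => //; apply: dy.
  by rewrite (le_lt_trans a0 at_) (lt_le_trans tb bT).
have [c] := MVT ab dg cg; rewrite in_itv /= => cab E.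
by exists c.
Qed.

(** The orbit starts with positive velocity, hence on the positive side, and can
    change side only through the surface. *)
Lemma return_positive mu eta u tau y : outgoing G C mu eta (zeta_inv C Q u) -> 0 < tau ->
  is_solution (fun z => G z mu eta) tau y -> y 0 = zeta_inv C Q u ->
  (forall t : R, 0 < t < tau -> ~ surface C (y t)) ->
  forall t : R, 0 < t < tau -> 0 < dotv C (y t).
Proof.
move=> [S0 V0] tau0 sy y0 ns t /andP[t0 tt].
have cC : continuous (dotv C) by exact: (lin_continuous (W := R^o)).
have [cy _] := sy.
rewrite ltNge; apply/negP => neg.
have [s s0t ps] : exists2 s : R, 0 < s < t & 0 < dotv C (y s).
  have vc : \forall x \near zeta_inv C Q u, 0 < velocity G C x mu eta.
    have c : {for zeta_inv C Q u, continuous (fun x => velocity G C x mu eta)}.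
      apply: (@continuous_comp _ _ _ (fun x => G x mu eta) (dotv C)); last exact: cC.
      have k : Ck 1 setT (fun x : state => G x mu eta).
        apply: (Ck_comp (B := setT) (f := fun x : state => ((x, mu), eta))
          (g := fun p : state * R * R => G p.1.1 p.1.2 p.2) openT) => //.
        by do 2 (apply: Ck_pair; [exact: openT| |exact: Ck_cst]); exact: Ck_id.
      exact: (Ck_cont k).
    exact: (cvgr_gt _ c).
  move/subspace_continuousP: (cy) => /(_ 0); rewrite /= in_itv /= lexx (ltW tau0) => /(_ isT).
  rewrite -y0 in vc; move=> c0; have /nbhs_normP[d /= d0 Hd] := c0 _ vc.
  pose s := Num.min (d / 2) (t / 2).
  have s0 : 0 < s by rewrite lt_min !divr_gt0.
  have [sd st] : s < d /\ s < t.
    split; first by apply: (@le_lt_trans _ _ (d / 2)); [rewrite ge_min lexx|rewrite ltr_pdivrMr// ltr_pMr// ltr1n].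
    by apply: (@le_lt_trans _ _ (t / 2)); [rewrite ge_min lexx orbT|rewrite ltr_pdivrMr// ltr_pMr// ltr1n].
  exists s; first by rewrite s0.
  have [c /andP[c0' cs]] := solution_MVT sy (lexx 0) s0 (ltW (lt_trans st tt)).
  rewrite y0 S0 !subr0 => ->; rewrite mulr_gt0//.
  apply: Hd; first by rewrite /= sub0r normrN gtr0_norm// (lt_trans cs).
  by rewrite /= in_itv /= (ltW c0') (ltW (lt_trans cs (lt_trans st tt))).
have /andP[s0 st] := s0t.
have cg : {within `[s, t], continuous (fun t => dotv C (y t))}.
  apply: (within_comp (g := dotv C)) => //.
  apply: continuous_subspaceW cy => x /=; rewrite !in_itv /= => /andP[ax xb].
  by rewrite (le_trans (ltW s0) ax) (le_trans xb (ltW tt)).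
have [|c] := IVT (ltW st) cg (v := 0).
  by rewrite ge_min le_max neg orbT (ltW ps).
rewrite in_itv /= => /andP[sc ct] E; apply: (ns c) => //.
by rewrite (lt_le_trans s0 sc) (le_lt_trans ct tt).
Qed.

End ReturnMap.

Lemma dist_between (R : realDomainType) (t a b c d : R) :
  `|t - a| < d -> `|t - b| < d -> a < c -> c < b -> `|t - c| < d.
Proof. by rewrite !ltr_norml => /andP[? ?] /andP[? ?] ? ?; apply/andP; split; lra. Qed.

Section ReturnMapSmooth.
Context {R : realType} {m : nat}.
Notation state := 'cV[R]_m.+1.
Notation params := ('cV[R]_m * R * R)%type.
Variables (G Rt : state -> R -> R -> state) (C : state) (Q : 'M[R]_(m, m.+1)).
Variable k : nat.
Hypothesis kG : Ck k.+1 setT (fun p : state * R * R => G p.1.1 p.1.2 p.2).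
Hypothesis kRt : Ck k.+1 setT (fun p : state * R * R => Rt p.1.1 p.1.2 p.2).

Let kG1 : Ck 1 setT (fun p : state * R * R => G p.1.1 p.1.2 p.2).
Proof. exact: Ck_le kG. Qed.

Lemma zeta_inv_is_linear : linear (zeta_inv C Q).
Proof.
move=> a x y; rewrite /zeta_inv scalemxAr -mulmxDr; congr (_ *m _).
apply/matrixP => i j; rewrite !mxE; case: (@fintype.split 1 m i) => l; rewrite !mxE//.
by rewrite mulr0 addr0.
Qed.
HB.instance Definition _ := GRing.isLinear.Build R 'cV[R]_m state *:%R (zeta_inv C Q)
  zeta_inv_is_linear.

Hypothesis Q_frame : frame C Q \in unitmx.

Lemma frame_zeta_inv u : C^T *m zeta_inv C Q u = 0 /\ Q *m zeta_inv C Q u = u.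
Proof.
have : frame C Q *m zeta_inv C Q u = (col_mx 0 u : 'cV[R]_(1 + m)).
  by rewrite /zeta_inv mulKVmx.
move=> E; have {}E : col_mx C^T Q *m zeta_inv C Q u = col_mx 0 u by exact: E.
by move: E; rewrite mul_col_mx => /eq_col_mx.
Qed.

Lemma surface_zeta_inv u : surface C (zeta_inv C Q u).
Proof. by rewrite /surface /= /dotv (frame_zeta_inv u).1 mxE. Qed.

Let start (q : params * R) : state * R * R * R :=
  (((zeta_inv C Q q.1.1.1, q.1.1.2), q.1.2), q.2).
Let dom : set (params * R) := start @^-1` flowdom (timed_field G).
Let phi (q : params * R) : state := timed_flow G (zeta_inv C Q q.1.1.1) q.1.1.2 q.1.2 q.2.
Let vel (q : params * R) : R := velocity G C (phi q) q.1.1.2 q.1.2.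

Let oT (U : normedModType R) : open [set: U]. Proof. exact: openT. Qed.

Let cC : continuous (dotv C).
Proof. exact: (lin_continuous (W := R^o)). Qed.

Let k11 j (A : set (params * R)) : open A -> Ck j A (fun q => q.1.1.1).
Proof. by move=> oA; do 3 (apply: Ck_fst; first by []); exact: Ck_id. Qed.
Let k12 j (A : set (params * R)) : open A -> Ck j A (fun q => q.1.1.2).
Proof. by move=> oA; apply: Ck_snd => //; do 2 (apply: Ck_fst; first by []); exact: Ck_id. Qed.
Let k13 j (A : set (params * R)) : open A -> Ck j A (fun q => q.1.2).
Proof. by move=> oA; apply: Ck_snd => //; apply: Ck_fst => //; exact: Ck_id. Qed.
Let k14 j (A : set (params * R)) : open A -> Ck j A (fun q => q.2).
Proof. by move=> oA; apply: Ck_snd => //; exact: Ck_id. Qed.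

Let start_Ck j : Ck j setT start.
Proof.
apply: Ck_pair; [exact: oT| |exact: k14 (oT _)].
apply: Ck_pair; [exact: oT| |exact: k13 (oT _)].
apply: Ck_pair; [exact: oT| |exact: k12 (oT _)].
apply: (Ck_linl (L := zeta_inv C Q)) => //; [exact: lin_continuous|].
exact: k11 (oT _).
Qed.

Let dom_open : open dom.
Proof.
apply: open_comp => [q _|]; first exact: (Ck_cont (start_Ck 0)).
by apply: flowdom_open; exact: timed_field_Ck.
Qed.

Let phi_Ck : Ck k.+1 dom phi.
Proof.
do 3 apply: Ck_fst => //.
apply: (Ck_comp (B := flowdom (timed_field G)) (f := start)) => //.
  by apply: Ck_sub (start_Ck _).
by apply: time1_Ck; exact: timed_field_Ck.
Qed.

Let at_phi (H : state -> R -> R -> state) (j : nat) (A : set (params * R)) : open A ->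
  Ck j setT (fun p : state * R * R => H p.1.1 p.1.2 p.2) -> Ck j A phi ->
  Ck j A (fun q => H (phi q) q.1.1.2 q.1.2).
Proof.
move=> oA kH kphi.
apply: (Ck_comp (B := setT) (f := fun q => ((phi q, q.1.1.2), q.1.2))
  (g := fun p : state * R * R => H p.1.1 p.1.2 p.2)) => //.
apply: Ck_pair; [exact: oA| |exact: k13].
by apply: Ck_pair; [exact: oA| |exact: k12].
Qed.

Let vel_Ck : Ck k.+1 dom vel.
Proof. by apply: (Ck_linl (L := dotv C)) => //; exact: at_phi. Qed.

Let gap (q : params * R) : R := dotv C (phi q).

Let gap_Ck : Ck k.+1 dom gap.
Proof. exact: (Ck_linl (L := dotv C)). Qed.

Let orbit (p : params) (t : R) : 0 < t -> dom (p, t) -> exists y,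
  [/\ is_solution (fun z => G z p.1.2 p.2) t y, y 0 = zeta_inv C Q p.1.1 &
      forall s : R, 0 <= s <= t -> dom (p, s) /\ phi (p, s) = y s].
Proof.
move=> t0 D; have [y [sy y0]] := flow_solves t0 D.
exists y; split => // s st; have [D1 E1] := solves_flow kG1 st sy.
by rewrite /dom /start /phi /= -y0.
Qed.

Let gap_MVT (p : params) (t a b : R) : 0 < t -> dom (p, t) -> 0 <= a -> a < b -> b <= t ->
  exists2 c, a < c < b & gap (p, b) - gap (p, a) = vel (p, c) * (b - a).
Proof.
move=> t0 D a0 ab bt; have [y [sy y0 E]] := orbit t0 D.
have [c cab Ec] := solution_MVT C sy a0 ab bt; exists c => //.
have /andP[ac cb] := cab.
have I s : a <= s -> s <= b -> 0 <= s <= t by move=> s1 s2; rewrite (le_trans a0)// (le_trans s2).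
rewrite /gap (E b _).2 ?I// ?(ltW ab)// (E a _).2 ?I// ?(ltW ab)// Ec /vel.
by rewrite (E c _).2// I// ltW.
Qed.

Let gap_derive (p : params) (t : R) : 0 < t -> dom (p, t) -> 'D_(0, 1) gap (p, t) = vel (p, t).
Proof.
move=> t0 D.
have [t' tt' D'] : exists2 t', t < t' & dom (p, t').
  have /nbhs_normP[d /= d0 Hd] : nbhs (p, t) dom by exact: open_nbhs_nbhs.
  have d20 : 0 < d / 2 by rewrite divr_gt0.
  exists (t + d / 2); first by rewrite ltrDl.
  apply: Hd; rewrite /= prod_normE /= subrr normr0 opprD addrA subrr sub0r normrN.
  by rewrite gtr0_norm// max_r ?(ltW d20)// ltr_pdivrMr// ltr_pMr// ltr1n.
have t'0 := lt_trans t0 tt'.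
have [y [sy y0 E]] := orbit t'0 D'.
have -> : 'D_(0, 1) gap (p, t) = 'D_1 (fun s => gap (p, s)) t.
  apply: derive_congr => h; congr gap.
  by apply: injective_projections => //=; rewrite scaler0 add0r.
have -> : 'D_1 (fun s => gap (p, s)) t = 'D_1 (fun s => dotv C (y s)) t.
  apply: near_eq_derive; near=> s; rewrite /gap (E s _).2//.
  have : s \in `]0, t'[ by near: s; apply: near_in_itvoo; rewrite in_itv /= t0.
  by rewrite in_itv => /andP[/ltW-> /ltW->].
have dy : is_derive t 1 y (G (y t) p.1.2 p.2) by apply: sy.2; rewrite t0.
have := is_derive_lin (W := R^o) (f := dotv C) cC dy => -[_ ->].
by rewrite /vel /velocity (E t _).2// (ltW t0) ltW.
Unshelve. all: by end_near. Qed.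

(** The return time T comes from the implicit function theorem. That it is the
    first return is an open condition although the constraint is tight at both
    ends: near the start and near the return the sign of the velocity decides,
    in between the distance to the surface is bounded below on the base orbit;
    compactness of [0, 1] glues these cases, after rescaling time by T. *)
Theorem return_map_smooth (u0 u0' : 'cV[R]_m) (mu0 eta0 : R) :
  return_graph G Rt C Q mu0 eta0 u0 u0' ->
  exists (U : set params) (P : params -> 'cV[R]_m),
    [/\ open U, U ((u0, mu0), eta0), Ck k.+1 U P &
        forall p, U p -> return_graph G Rt C Q p.1.2 p.2 p.1.1 (P p)].
Proof.
move=> base; have [out0 [tau0 [y0 [[tau00 sy0 y00] [ns0 inc0 u0E]]]]] := base.
pose p0 : params := ((u0, mu0), eta0).
have pos0 := return_positive kG1 out0 tau00 sy0 y00 ns0.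
have E0 (t : R) : 0 <= t <= tau0 -> dom (p0, t) /\ phi (p0, t) = y0 t.
  move=> tt; have [D1 E1] := solves_flow kG1 tt sy0.
  by rewrite /dom /start /phi /= -y00.
have tt0 : 0 <= tau0 <= tau0 by rewrite lexx ltW.
have [D0 phi0] := E0 _ tt0.
have gap0 : gap (p0, tau0) = 0 by rewrite /gap phi0; case: inc0.
have vel0 : vel (p0, tau0) < 0 by rewrite /vel phi0; case: inc0.
have inj z : 'D_(0, z) gap (p0, tau0) = 0 -> z = 0.
  have -> : ((0, z) : params * R) = z *: (0, 1).
    by apply: injective_projections => /=; [rewrite scaler0|rewrite [_ *: _]mulr1].
  rewrite derive_dirZ; last exact: (Ck_diff gap_Ck D0).
  rewrite gap_derive// => /eqP; rewrite [_ *: _]mulrC mulf_eq0 lt_eqF//= => /eqP->.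
  by [].
have [A [B [T [[oA Ap oB Bt AB] [TB TE _ kT]]]]] := implicit_function dom_open D0 gap_Ck gap0 inj.
have T0 : T p0 = tau0 by apply/esym/(TE _ _ Ap Bt).
have domT p : A p -> dom (p, T p) by move=> Ap1; apply: AB => //; exact: TB.
have gapT p : A p -> gap (p, T p) = 0 by move=> Ap1; apply/(TE _ _ Ap1 (TB _ Ap1)).
have cT : {for p0, continuous T} by exact: (Ck_cont kT Ap).
have nA : \forall p \near p0, A p by exact: open_nbhs_nbhs.
have outn : \forall p \near p0, 0 < velocity G C (zeta_inv C Q p.1.1) p.1.2 p.2.
  have kz : Ck 1 setT (fun p : params => velocity G C (zeta_inv C Q p.1.1) p.1.2 p.2).
    apply: (Ck_linl (L := dotv C)) => //.
    apply: (Ck_comp (B := setT) (f := fun p : params => ((zeta_inv C Q p.1.1, p.1.2), p.2))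
      (g := fun p : state * R * R => G p.1.1 p.1.2 p.2)) => //.
    apply: Ck_pair; [exact: oT| |by apply: Ck_snd; [exact: oT|exact: Ck_id]].
    apply: Ck_pair; [exact: oT| |by apply: Ck_snd; [|apply: Ck_fst]; [exact: oT|exact: oT|exact: Ck_id]].
    apply: (Ck_linl (L := zeta_inv C Q)); [exact: oT|exact: lin_continuous|].
    by do 2 (apply: Ck_fst; first exact: oT); exact: Ck_id.
  by apply: (cvgr_gt _ (Ck_cont kz I)); case: out0.
have velT : \forall p \near p0, vel (p, T p) < 0.
  have c : {for p0, continuous (fun p => vel (p, T p))}.
    have kp : Ck k.+1 A (fun p => (p, T p)) by apply: Ck_pair => //; exact: Ck_id.
    exact: (Ck_cont (Ck_comp oA domT kp vel_Ck) Ap).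
  by apply: (cvgr_lt _ c); rewrite T0.
have Tpos : \forall p \near p0, 0 < T p by apply: (cvgr_gt _ cT); rewrite T0.
(* the rescaled time s T(p) and the parameter p can be kept close to their
base values simultaneously *)
have joint (s0 d : R) : 0 < d -> \forall s \near s0 & p \near p0,
    [/\ `|p0 - p| < d, `|s0 * tau0 - s * T p| < d, `|tau0 - T p| < d, A p & 0 < T p].
  move=> d0; pose K := `|s0| + 1.
  have K0 : 0 < K by rewrite ltr_wpDl.
  have K2 : 0 < d / 2 / K by rewrite !divr_gt0.
  have d2 : 0 < d / 2 / tau0 by rewrite !divr_gt0.
  have nB : \forall p \near p0, `|p0 - p| < d by apply/nbhs_normP; exists d.
  have nT e : 0 < e -> \forall p \near p0, `|tau0 - T p| < e.
    by move=> e0; rewrite -T0; move/cvgrPdist_lt: cT; exact.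
  near=> s p; have Ap1 : A p by near: p.
  have Tp : 0 < T p by near: p.
  have Bp : `|p0 - p| < d by near: p.
  have Td : `|tau0 - T p| < d by near: p; exact: nT.
  split; [exact: Bp| |exact: Td|exact: Ap1|exact: Tp].
    have s1 : `|s0 - s| < 1 by near: s; apply/nbhs_normP; exists 1; [exact: ltr01|by []].
    have s2 : `|s0 - s| < d / 2 / tau0 by near: s; apply/nbhs_normP; exists (d / 2 / tau0).
    have p1 : `|tau0 - T p| < d / 2 / K.
      by near: p; exact: nT.
    have sK : `|s| <= K.
      have := ler_normB s0 (s0 - s); rewrite subKr /K => /le_trans; apply.
      by rewrite lerD2l ltW.
    have -> : s0 * tau0 - s * T p = (s0 - s) * tau0 + s * (tau0 - T p) by ring.
    apply: (le_lt_trans (ler_normD _ _)); rewrite !normrM (gtr0_norm tau00).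
    have H1 : `|s0 - s| * tau0 < d / 2 by rewrite -ltr_pdivlMr.
    have H2 : `|s| * `|tau0 - T p| <= d / 2.
      apply: (@le_trans _ _ (K * (d / 2 / K))); last by rewrite mulrC divfK// gt_eqF.
      by apply: ler_pM => //; exact: ltW.
    by rewrite [ltRHS]splitr; exact: ltr_leD.
have box (t0 : R) (N : set (params * R)) : nbhs (p0, t0) N -> exists2 d, 0 < d &
    forall p t, `|p0 - p| < d -> `|t0 - t| < d -> N (p, t).
  move=> /nbhs_normP[d /= d0 Hd]; exists d => // p t H1 H2; apply: Hd.
  by rewrite /= prod_normE /= gt_max H1.
(* s = 0, s = 1 and 0 < s < 1 are the three cases described above *)
have posn : \forall p \near p0, forall s : R, 0 <= s <= 1 -> (0 < s < 1 -> 0 < gap (p, s * T p)).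
  apply: (@near_unit R _ (nbhs p0) (fun p s => 0 < s < 1 -> 0 < gap (p, s * T p))) => s0 /andP[s00 s01].
  have Ds : dom (p0, s0 * tau0).
    by apply: (E0 _ _).1; rewrite mulr_ge0 ?(ltW tau00)//= ler_piMl// ltW.
  have nD : nbhs (p0, s0 * tau0) dom by exact: open_nbhs_nbhs.
  have velc := Ck_cont vel_Ck Ds; have gapc := Ck_cont gap_Ck Ds.
  move: s00; rewrite le_eqVlt => /predU1P[s00|s00].
    have vpos : 0 < vel (p0, s0 * tau0).
      rewrite -s00 mul0r /vel (E0 0 _).2; last by rewrite lexx ltW.
      by rewrite y00; case: out0.
    have [d d0 Hd] := box _ _ (filterI nD (cvgr_gt _ velc _ vpos)).
    apply: filterS (joint s0 d d0) => -[s p] /= [pd sd _ Ap1 Tp] /andP[s1 s2].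
    have st0 : 0 < s * T p by rewrite mulr_gt0.
    have [Dst _] := Hd _ _ pd sd.
    have [c /andP[c0 cs]] := gap_MVT st0 Dst (lexx 0) st0 (lexx _).
    have [y [_ y_0 Ey]] := orbit st0 Dst.
    have -> : gap (p, 0) = 0.
      rewrite /gap (Ey 0 _).2 ?lexx ?(ltW st0)// y_0.
      exact: surface_zeta_inv.
    rewrite !subr0 => ->; rewrite mulr_gt0//.
    apply: (Hd p c pd _).2; rewrite -s00 mul0r sub0r normrN (gtr0_norm c0).
    by apply: (lt_trans cs); move: sd; rewrite -s00 mul0r sub0r normrN gtr0_norm.
  move: s01; rewrite le_eqVlt => /predU1P[s01|s01].
    have vneg : vel (p0, s0 * tau0) < 0 by rewrite s01 mul1r.
    have [d d0 Hd] := box _ _ (cvgr_lt _ velc _ vneg).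
    apply: filterS (joint s0 d d0) => -[s p] /= [pd sd Td Ap1 Tp] /andP[s1 s2].
    have sT : s * T p < T p by rewrite gtr_pMl.
    have sT0 : 0 <= s * T p by rewrite mulr_ge0// ltW.
    have [c /andP[c0 cs]] := gap_MVT Tp (domT p Ap1) sT0 sT (lexx _).
    rewrite (gapT p Ap1) sub0r => Eg.
    rewrite -oppr_lt0 Eg nmulr_rlt0 ?subr_gt0//.
    apply: (Hd p c pd _); rewrite s01 mul1r in sd *.
    exact: dist_between sd Td c0 cs.
  have gpos : 0 < gap (p0, s0 * tau0).
    have s0t : 0 < s0 * tau0 < tau0 by rewrite mulr_gt0//= gtr_pMl.
    rewrite /gap (E0 _ _).2; last by case/andP: s0t => /ltW-> /ltW->.
    exact: pos0.
  have [d d0 Hd] := box _ _ (cvgr_gt _ gapc _ gpos).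
  by apply: filterS (joint s0 d d0) => -[s p] /= [pd sd _ _ _] _; exact: Hd.
pose good (p : params) := [/\ A p, 0 < T p,
  0 < velocity G C (zeta_inv C Q p.1.1) p.1.2 p.2, vel (p, T p) < 0 &
  forall s : R, 0 <= s <= 1 -> (0 < s < 1 -> 0 < gap (p, s * T p))].
have ngood : \forall p \near p0, good p.
  by near=> p; split; near: p.
exists (interior good), (fun p => Q *m Rt (phi (p, T p)) p.1.2 p.2); split.
- exact: open_interior.
- exact: ngood.
- have oG : open (interior good) by exact: open_interior.
  have kT' : Ck k.+1 (interior good) T.
    by apply: Ck_sub kT => p /interior_subset[].
  have kpT : Ck k.+1 (interior good) (fun p => (p, T p)) by apply: Ck_pair => //; exact: Ck_id.
  have kphiT : Ck k.+1 (interior good) (fun p => phi (p, T p)).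
    apply: (Ck_comp (B := dom) (f := fun p => (p, T p)) (g := phi)) => //.
    by move=> p /interior_subset[Ap1 _ _ _ _]; exact: domT.
  apply: (Ck_linl (L := mulmx Q)) => //; first exact: lin_continuous.
  apply: (Ck_comp (B := setT) (f := fun p : params => ((phi (p, T p), p.1.2), p.2))
    (g := fun p : state * R * R => Rt p.1.1 p.1.2 p.2)) => //.
  apply: Ck_pair; [by []| |by apply: Ck_snd => //; exact: Ck_id].
  by apply: Ck_pair; [by []|by []|apply: Ck_snd => //; apply: Ck_fst => //; exact: Ck_id].
move=> p /interior_subset[Ap1 Tp outp velp posp].
split; first by split => //; exact: surface_zeta_inv.
have [y [sy y_0 Ey]] := orbit Tp (domT p Ap1).
have TT : 0 <= T p <= T p by rewrite lexx ltW.
exists (T p), y; split => //; split.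
- move=> t /andP[t0 tT]; have tT1 : 0 < t / T p < 1 by rewrite divr_gt0//= ltr_pdivrMr// mul1r.
  have tT1' : 0 <= t / T p <= 1 by case/andP: tT1 => /ltW-> /ltW->.
  have := posp _ tT1' tT1; rewrite divfK ?gt_eqF// /gap (Ey t _).2 ?(ltW t0) ?(ltW tT)//.
  by move=> + E; rewrite E ltxx.
- split; first by rewrite /surface /= -(Ey _ TT).2; exact: gapT.
  by move: velp; rewrite /vel (Ey _ TT).2.
- by rewrite (Ey _ TT).2.
Unshelve. all: by end_near. Qed.

End ReturnMapSmooth.

(** * Simple eigenvalues *)

Section SimpleEigenvalue.
Context {F : fieldType} {m : nat}.

(** Two block eliminations of the same bordered matrix; stated over a domain so
    that it applies to polynomial matrices. *)
Lemma det_scalar_rank1 (A : idomainType) (c : A) (V : 'cV[A]_m) (W : 'rV[A]_m) :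
  c * \det (c%:M + V *m W) = (c + (W *m V) 0 0) * c ^+ m.
Proof.
pose K : 'M[A]_(1 + m) := block_mx 1%:M (- W) V c%:M.
have E1 : \det K = \det (c%:M + V *m W).
  have -> : K = block_mx 1%:M 0 V 1%:M *m block_mx 1%:M (- W) 0 (c%:M + V *m W).
    rewrite mulmx_block !mul1mx !mul0mx !mulmx1 !addr0 mulmxN.
    by rewrite addrC addrK.
  by rewrite det_mulmx det_lblock det_ublock !det1 !mul1r.
have E2 : \det K * c = (c + (W *m V) 0 0) * c ^+ m.
  have Ec : \det (block_mx c%:M 0 (- V) 1%:M : 'M[A]_(1 + m)) = c.
    by rewrite det_lblock det1 mulr1 det_scalar1.
  rewrite -[X in \det K * X]Ec -det_mulmx mulmx_block !mulmx1 !mul1mx !mulmx0 !add0r mulNmx mulmxN opprK.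
  rewrite mulmxN mul_mx_scalar mul_scalar_mx subrr det_ublock det_scalar; congr (_ * _).
  by rewrite det_mx11 !mxE eqxx mulr1n.
by rewrite -E1 mulrC.
Qed.

(** Subtracting v w^T moves the eigenvalue 1 of v to 0 and leaves the others. *)
Lemma char_poly_deflation (J : 'M[F]_m) (v w : 'cV[F]_m) : J *m v = v ->
  (w^T *m v) 0 0 = 1 ->
  'X * char_poly J = ('X - 1%:P) * char_poly (J - v *m w^T).
Proof.
move=> Jv wv.
pose V := map_mx polyC v; pose Wt := map_mx polyC w^T; pose A := char_poly_mx J.
have WV : (Wt *m V) 0 0 = 1 by rewrite /Wt /V -map_mxM mxE wv.
pose c : {poly F} := 'X - 1%:P.
have AV : A *m V = c *: V.
  rewrite /A /char_poly_mx mulmxBl mul_scalar_mx -map_mxM Jv /c scalerBl.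
  by rewrite scale1r.
have EA : char_poly_mx (J - v *m w^T) = A + V *m Wt.
  by rewrite /A /char_poly_mx map_mxB map_mxM opprB addrA addrAC.
have M1 : A *m (c%:M + V *m Wt) = c *: (A + V *m Wt).
  by rewrite mulmxDr mul_mx_scalar mulmxA AV -scalemxAl [RHS]scalerDr.
have := congr1 determinant M1; rewrite det_mulmx detZ -EA => M2.
have D := det_scalar_rank1 c V Wt; rewrite WV in D.
have cX : c + 1 = 'X by rewrite /c subrK.
rewrite cX in D.
have cn0 : c ^+ m != 0 by rewrite expf_neq0// polyXsubC_eq0.
apply: (mulIf cn0); rewrite mulrAC -D -[c * _ * _]mulrA [_ * \det A]mulrC M2.
by rewrite -[RHS]mulrA [_ * c ^+ m in RHS]mulrC.
Qed.

(** By deflation, multiplicity one means that 1 is no eigenvalue of J - v w^T. In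
    this form simplicity is an open condition. *)
Lemma simple_eigenvalueP (J : 'M[F]_m) (v w : 'cV[F]_m) : J *m v = v ->
  (w^T *m v) 0 0 = 1 ->
  (mup 1 (char_poly J) = 1)%N <-> (1%:M - J + v *m w^T) \in unitmx.
Proof.
move=> Jv wv; have E := char_poly_deflation Jv wv.
pose J' := J - v *m w^T.
have c0 (K : 'M[F]_m) : char_poly K != 0 by rewrite monic_neq0// char_poly_monic.
have m1 : mup 1 (char_poly J) = (1 + mup 1 (char_poly J'))%N.
  have := congr1 (mup 1) E; rewrite mupMr; last by rewrite rootX oner_eq0.
  rewrite mupM ?polyXsubC_eq0// => ->; congr (_ + _)%N.
  by rewrite -['X - _]expr1 mup_XsubCX eqxx.
have e1 : (char_poly J').[1] = \det (1%:M - J + v *m w^T).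
  rewrite /char_poly -horner_evalE -det_map_mx; congr (\det _).
  apply/matrixP => i j; rewrite !mxE /= horner_evalE !hornerE hornerMn hornerX.
  by rewrite opprB addrA addrAC.
rewrite m1 unitmxE unitfE -e1; split=> [/eqP|r].
  rewrite -[X in _ == X]addn0 eqn_add2l => /eqP m0.
  apply/negP => /eqP r; have : (1 <= mup 1 (char_poly J'))%N.
    by rewrite mup_geq// expr1 dvdp_XsubCl; apply/eqP.
  by rewrite m0.
by rewrite mupNroot.
Qed.

End SimpleEigenvalue.

(** * Stability of the spectrum *)

Section ComplexRows.
Context {R : realType} {m : nat}.
Implicit Types (J : 'M[R]_m) (x y : 'rV[R]_m) (z : R[i]).

Lemma Re_sum (I : Type) (s : seq I) (f : I -> R[i]) :
  complex.Re (\sum_(i <- s) f i) = \sum_(i <- s) complex.Re (f i).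
Proof. by apply: (big_morph (@complex.Re R)) => // -[a b] [c d]. Qed.

Lemma Im_sum (I : Type) (s : seq I) (f : I -> R[i]) :
  complex.Im (\sum_(i <- s) f i) = \sum_(i <- s) complex.Im (f i).
Proof. by apply: (big_morph (@complex.Im R)) => // -[a b] [c d]. Qed.

(** Real and imaginary parts of a complex left eigenvector; the compactness
    argument can then take place over the reals. *)
Lemma eigenvalue_real_rows J z : eigenvalue (map_mx (real_complex R) J) z <->
  exists x y, [/\ (x != 0) || (y != 0),
    x *m J = complex.Re z *: x - complex.Im z *: y &
    y *m J = complex.Im z *: x + complex.Re z *: y].
Proof.
case: z => a b /=; split.
  move=> /eigenvalueP[u Eu u0].
  exists (map_mx (@complex.Re R) u), (map_mx (@complex.Im R) u); split.
  - rewrite -negb_and; apply: contra u0 => /andP[/eqP x0 /eqP y0].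
    apply/eqP/rowP => j; rewrite mxE; have := congr1 (fun x : 'rV_m => x 0 j) x0.
    have := congr1 (fun x : 'rV_m => x 0 j) y0; rewrite !mxE.
    by case: (u 0 j) => c d /= -> ->.
  - apply/rowP => i; have := congr1 (fun x : 'rV_m => complex.Re (x 0 i)) Eu.
    rewrite !mxE Re_sum => H.
    transitivity (\sum_j complex.Re (u 0 j * (map_mx (real_complex R) J) j i)).
      by apply: eq_bigr => j _; rewrite !mxE; case: (u 0 j) => c d /=; rewrite mulr0 subr0.
    by rewrite H; case: (u 0 i).
  - apply/rowP => i; have := congr1 (fun x : 'rV_m => complex.Im (x 0 i)) Eu.
    rewrite !mxE Im_sum => H.
    transitivity (\sum_j complex.Im (u 0 j * (map_mx (real_complex R) J) j i)).
      by apply: eq_bigr => j _; rewrite !mxE; case: (u 0 j) => c d /=; rewrite mulr0 add0r.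
    by rewrite H; case: (u 0 i) => c d /=; rewrite addrC.
move=> [x [y [xy0 Ex Ey]]]; apply/eigenvalueP.
exists (\row_j (Complex (x 0 j) (y 0 j))).
  apply/rowP => i; rewrite !mxE; apply/eqP; rewrite eq_complex Re_sum Im_sum /=.
  have := congr1 (fun x : 'rV_m => x 0 i) Ex; have := congr1 (fun x : 'rV_m => x 0 i) Ey.
  rewrite !mxE => Ei Er; apply/andP; split; apply/eqP.
    rewrite -Er; apply: eq_bigr => j _; rewrite !mxE /=; rewrite mulr0 subr0//.
  rewrite [RHS]addrC -Ei; apply: eq_bigr => j _; rewrite !mxE /=; by rewrite mulr0 add0r.
apply: contraL xy0 => /eqP u0; rewrite negb_or !negbK.
have E j : (x 0 j = 0) /\ (y 0 j = 0).
  have := congr1 (fun x : 'rV_m => x 0 j) u0; rewrite !mxE => H.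
  by split; [have := congr1 (@complex.Re R) H|have := congr1 (@complex.Im R) H].
by apply/andP; split; apply/eqP/rowP => j; rewrite mxE; case: (E j).
Qed.

End ComplexRows.

Section CkEntries.
Context {R : realType}.
Implicit Types V W : normedModType R.

Lemma Ck_mul V k (A : set V) (f g : V -> R) : open A -> Ck k A f -> Ck k A g ->
  Ck k A (fun x => f x * g x).
Proof. exact: (Ck_scale (W := R)). Qed.

Lemma Ck_opp V W k (A : set V) (f : V -> W) : open A -> Ck k A f -> Ck k A (fun x => - f x).
Proof.
move=> oA kf; apply: (Ck_ext (f := fun x => (-1 : R) *: f x) oA) => [x _|].
  by rewrite scaleN1r.
by apply: Ck_scale => //; exact: Ck_cst.
Qed.

Lemma Ck_sub_fun V W k (A : set V) (f g : V -> W) : open A -> Ck k A f -> Ck k A g ->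
  Ck k A (fun x => f x - g x).
Proof. by move=> oA kf kg; apply: Ck_add => //; exact: Ck_opp. Qed.

Lemma Ck_sqr V k (A : set V) (f : V -> R) : open A -> Ck k A f -> Ck k A (fun x => f x ^+ 2).
Proof.
move=> oA kf; apply: (Ck_ext (f := fun x => f x * f x) oA) => [x _|]; first by rewrite expr2.
exact: Ck_mul.
Qed.

Lemma Ck_prod V k (A : set V) (I : Type) (s : seq I) (f : I -> V -> R) : open A ->
  (forall i, Ck k A (f i)) -> Ck k A (fun x => \prod_(i <- s) f i x).
Proof.
move=> oA H; elim: s => [|i s IH].
  by apply: (Ck_ext oA _ (@Ck_cst R V R k A 1)) => x _; rewrite big_nil.
by apply: (Ck_ext oA _ (Ck_mul oA (H i) IH)) => x _; rewrite big_cons.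
Qed.

Lemma Ck_entry V k (A : set V) p q (M : V -> 'M[R]_(p, q)) i j : open A ->
  Ck k A M -> Ck k A (fun x => M x i j).
Proof.
move=> oA; apply: (Ck_linl (W := R) (L := @cco R 'M[R]_(p, q) (coords_mx p q) (i, j))) => //.
exact: (lin_continuous (W := R^o)).
Qed.

Lemma Ck_det V k (A : set V) n (M : V -> 'M[R]_n) : open A ->
  (forall i j, Ck k A (fun x => M x i j)) -> Ck k A (fun x => \det (M x)).
Proof.
move=> oA H; apply: Ck_sum => // s; apply: Ck_mul => //; first exact: Ck_cst.
exact: Ck_prod.
Qed.

End CkEntries.

Lemma sqr_norm_le1 (R : realDomainType) (t : R) : (t ^+ 2 <= 1) = (`|t| <= 1).
Proof. by rewrite -(real_normK (num_real t)) expr_le1. Qed.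

Section SpectrumStability.
Context {R : realType} {m : nat} {X : normedModType R}.
Variables (A : set X) (J : X -> 'M[R]_m) (v : X -> 'cV[R]_m) (w : 'cV[R]_m) (q0 : X).
Hypothesis oA : open A.
Hypothesis Aq0 : A q0.
Hypothesis kJ : forall i j, Ck 0 A (fun q => J q i j).
Hypothesis kv : forall i, Ck 0 A (fun q => v q i 0).
Hypothesis Jv : forall q, A q -> J q *m v q = v q.
Hypothesis wv : forall q, A q -> dotv w (v q) = 1.
Hypothesis base : simple_unit_eigenvalue (J q0).

Let N q := 1%:M - J q + v q *m w^T.

Lemma bordered_near : \forall q \near q0, N q \in unitmx.
Proof.
have kN : Ck 0 A (fun q => \det (N q)).
  apply: Ck_det => // i j.
  apply: (Ck_ext (f := fun q => ((1%:M : 'M[R]_m) i j - J q i j) + v q i 0 * w j 0) oA).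
    by move=> q _; rewrite !mxE big_ord1 !mxE.
  apply: Ck_add => //; first by apply: Ck_sub_fun => //; exact: Ck_cst.
  by apply: Ck_mul => //; exact: Ck_cst.
have d0 : \det (N q0) != 0.
  by rewrite -unitfE -unitmxE; apply/(simple_eigenvalueP (Jv Aq0) (wv Aq0)); case: base.
have : \forall q \near q0, \det (N q) != 0.
  have c : \det (N q) @[q --> q0] --> \det (N q0) by exact: (Ck_cont kN Aq0).
  exact: (cvgr_neq0 _ c d0).
by apply: filterS => q; rewrite unitmxE unitfE.
Qed.

Notation K := ((R * R) * ('rV[R]_m * 'rV[R]_m))%type.

(** Vanishes exactly when x + i y is a normalized left eigenvector for the
    eigenvalue a + i b, of modulus one, and is orthogonal to v. Orthogonality
    singles out the eigenvalues other than 1: a left eigenvector for z <> 1 is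
    orthogonal to the right eigenvector for 1, and when 1 is simple its left
    eigenvectors are not. *)
Let Phi (q : X) (c : K) : R :=
  \sum_i (\sum_j c.2.1 0 j * J q j i - c.1.1 * c.2.1 0 i + c.1.2 * c.2.2 0 i) ^+ 2 +
  \sum_i (\sum_j c.2.2 0 j * J q j i - c.1.2 * c.2.1 0 i - c.1.1 * c.2.2 0 i) ^+ 2 +
  (\sum_j c.2.1 0 j * v q j 0) ^+ 2 + (\sum_j c.2.2 0 j * v q j 0) ^+ 2 +
  (c.1.1 ^+ 2 + c.1.2 ^+ 2 - 1) ^+ 2 +
  (\sum_j (c.2.1 0 j ^+ 2 + c.2.2 0 j ^+ 2) - 1) ^+ 2.

Let Phi_cont : Ck 0 (A `*` [set: K]) (fun p : X * K => Phi p.1 p.2).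
Proof.
have oAK : open (A `*` [set: K]) by exact: openT_prod.
have H1 : Ck 0 (A `*` [set: K]) (fun p => p.1) by apply: Ck_fst => //; exact: Ck_id.
have H2 : Ck 0 (A `*` [set: K]) (fun p => p.2) by apply: Ck_snd => //; exact: Ck_id.
have a1 : Ck 0 (A `*` [set: K]) (fun p => p.2.1.1) by exact: (Ck_fst oAK (Ck_fst oAK H2)).
have a2 : Ck 0 (A `*` [set: K]) (fun p => p.2.1.2) by exact: (Ck_snd oAK (Ck_fst oAK H2)).
have x j : Ck 0 (A `*` [set: K]) (fun p => p.2.2.1 0 j).
  exact: (Ck_entry _ _ oAK (Ck_fst oAK (Ck_snd oAK H2))).
have y j : Ck 0 (A `*` [set: K]) (fun p => p.2.2.2 0 j).
  exact: (Ck_entry _ _ oAK (Ck_snd oAK (Ck_snd oAK H2))).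
have kJ' i j : Ck 0 (A `*` [set: K]) (fun p => J p.1 i j).
  move=> p [Ap _]; apply: (@continuous_comp _ _ _ fst (fun q => J q i j)); first exact: cvg_fst.
  exact: (Ck_cont (@kJ i j) Ap).
have kv' i : Ck 0 (A `*` [set: K]) (fun p => v p.1 i 0).
  move=> p [Ap _]; apply: (@continuous_comp _ _ _ fst (fun q => v q i 0)); first exact: cvg_fst.
  exact: (Ck_cont (@kv i) Ap).
have c1 : Ck 0 (A `*` [set: K]) (fun=> 1 : R) by exact: Ck_cst.
have T1 : Ck 0 (A `*` [set: K]) (fun p => \sum_i (\sum_j p.2.2.1 0 j * J p.1 j i
    - p.2.1.1 * p.2.2.1 0 i + p.2.1.2 * p.2.2.2 0 i) ^+ 2).
  apply: (Ck_sum _ oAK) => i; apply: (Ck_sqr oAK).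
  apply: (Ck_add oAK _ (Ck_mul oAK a2 (y i))).
  apply: (Ck_sub_fun oAK _ (Ck_mul oAK a1 (x i))).
  by apply: (Ck_sum _ oAK) => j; apply: (Ck_mul oAK); [exact: x|exact: kJ'].
have T2 : Ck 0 (A `*` [set: K]) (fun p => \sum_i (\sum_j p.2.2.2 0 j * J p.1 j i
    - p.2.1.2 * p.2.2.1 0 i - p.2.1.1 * p.2.2.2 0 i) ^+ 2).
  apply: (Ck_sum _ oAK) => i; apply: (Ck_sqr oAK).
  apply: (Ck_sub_fun oAK _ (Ck_mul oAK a1 (y i))).
  apply: (Ck_sub_fun oAK _ (Ck_mul oAK a2 (x i))).
  by apply: (Ck_sum _ oAK) => j; apply: (Ck_mul oAK); [exact: y|exact: kJ'].
have T3 : Ck 0 (A `*` [set: K]) (fun p => (\sum_j p.2.2.1 0 j * v p.1 j 0) ^+ 2).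
  apply: (Ck_sqr oAK); apply: (Ck_sum _ oAK) => j; exact: Ck_mul.
have T4 : Ck 0 (A `*` [set: K]) (fun p => (\sum_j p.2.2.2 0 j * v p.1 j 0) ^+ 2).
  apply: (Ck_sqr oAK); apply: (Ck_sum _ oAK) => j; exact: Ck_mul.
have T5 : Ck 0 (A `*` [set: K]) (fun p => (p.2.1.1 ^+ 2 + p.2.1.2 ^+ 2 - 1) ^+ 2).
  exact: (Ck_sqr oAK (Ck_sub_fun oAK (Ck_add oAK (Ck_sqr oAK a1) (Ck_sqr oAK a2)) c1)).
have T6 : Ck 0 (A `*` [set: K])
    (fun p => (\sum_j (p.2.2.1 0 j ^+ 2 + p.2.2.2 0 j ^+ 2) - 1) ^+ 2).
  apply: (Ck_sqr oAK); apply: Ck_sub_fun => //; apply: Ck_sum => // j.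
  by apply: Ck_add => //; exact: Ck_sqr.
apply: (Ck_add oAK _ T6); apply: (Ck_add oAK _ T5); apply: (Ck_add oAK _ T4).
exact: (Ck_add oAK (Ck_add oAK T1 T2) T3).
Qed.

Let Phi0 q c : Phi q c = 0 ->
  [/\ c.2.1 *m J q = c.1.1 *: c.2.1 - c.1.2 *: c.2.2,
      c.2.2 *m J q = c.1.2 *: c.2.1 + c.1.1 *: c.2.2,
      c.2.1 *m v q = 0, c.2.2 *m v q = 0 &
      c.1.1 ^+ 2 + c.1.2 ^+ 2 = 1] /\ \sum_j (c.2.1 0 j ^+ 2 + c.2.2 0 j ^+ 2) = 1.
Proof.
have sq_sum (I : finType) (f : I -> R) : 0 <= \sum_i f i ^+ 2.
  by apply: sumr_ge0 => i _; exact: sqr_ge0.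
have sq_sum0 (f : 'I_m -> R) : \sum_i f i ^+ 2 = 0 -> forall i, f i = 0.
  move=> /eqP; rewrite psumr_eq0 => [/allP H i|i _]; last exact: sqr_ge0.
  by apply/eqP; rewrite -sqrf_eq0; have := H i; rewrite mem_index_enum => /(_ isT).
rewrite /Phi; set t1 := \sum_i _ ^+ 2; set t2 := \sum_i _ ^+ 2.
set t3 := (\sum_j c.2.1 0 j * _) ^+ 2; set t4 := (\sum_j c.2.2 0 j * _) ^+ 2.
set t5 := (_ - 1) ^+ 2; set t6 := (_ - 1) ^+ 2 => E.
have p1 : 0 <= t1 by exact: sq_sum.
have p2 : 0 <= t2 by exact: sq_sum.
have p3 : 0 <= t3 by exact: sqr_ge0.
have p4 : 0 <= t4 by exact: sqr_ge0.
have p5 : 0 <= t5 by exact: sqr_ge0.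
have p6 : 0 <= t6 by exact: sqr_ge0.
have [[e1 e2 e3] [e4 e5 e6]] : [/\ t1 = 0, t2 = 0 & t3 = 0] /\ [/\ t4 = 0, t5 = 0 & t6 = 0].
  by do 2 split; lra.
have {}e1 := sq_sum0 _ e1; have {}e2 := sq_sum0 _ e2.
move/eqP: e3; rewrite sqrf_eq0 => /eqP e3; move/eqP: e4; rewrite sqrf_eq0 => /eqP e4.
move/eqP: e5; rewrite sqrf_eq0 subr_eq0 => /eqP e5; move/eqP: e6; rewrite sqrf_eq0 subr_eq0 => /eqP e6.
split=> //; split => //.
- by apply/rowP => i; rewrite !mxE; have := e1 i; lra.
- by apply/rowP => i; rewrite !mxE; have := e2 i; lra.
- by apply/rowP => i; rewrite !ord1 !mxE.
- by apply/rowP => i; rewrite !ord1 !mxE.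
Qed.

Let box : set K := (`[-1, 1] `*` `[-1, 1]) `*`
  ([set x : 'rV[R]_m | forall i, `[-1, 1]%classic (x ord0 i)] `*`
   [set x : 'rV[R]_m | forall i, `[-1, 1]%classic (x ord0 i)]).

Let box_compact : compact box.
Proof.
have c : compact (`[-1, 1] : set R) by exact: segment_compact.
have cr : compact [set x : 'rV[R]_m | forall i, `[-1, 1]%classic (x ord0 i)].
  exact: (@rV_compact R m (fun=> `[-1, 1]%classic)).
by apply: compact_setX; exact: compact_setX.
Qed.

Let Phi_base c : Phi q0 c != 0.
Proof.
apply/eqP => /Phi0; case: c => [[a b] [x y]] /= [[Ex Ey xv yv ab] xy].
have N0 : N q0 \in unitmx.
  by apply/(simple_eigenvalueP (Jv Aq0) (wv Aq0)); case: base.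
have xy0 : (x != 0) || (y != 0).
  apply: contraT; rewrite negb_or !negbK => /andP[/eqP x0 /eqP y0].
  move: xy; rewrite big1 => [/eqP|j _]; first by rewrite eq_sym oner_eq0.
  by rewrite x0 y0 mxE expr0n addr0.
have ev : eigenvalue (map_mx (real_complex R) (J q0)) (Complex a b).
  by apply/eigenvalue_real_rows; exists x, y.
have z1 : Complex a b = 1 :> R[i].
  by apply: base.2 => //; rewrite normc_def /= ab sqrtr1.
have [a1 b0] : a = 1 /\ b = 0.
  by split; [have := congr1 (@complex.Re R) z1|have := congr1 (@complex.Im R) z1].
have fixed_ (u : 'rV[R]_m) : u *m J q0 = u -> u *m v q0 = 0 -> u = 0.
  move=> uJ uv; have uN : u *m N q0 = 0.
    by rewrite /N mulmxDr mulmxBr mulmx1 uJ subrr add0r mulmxA uv mul0mx.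
  by rewrite -(mulmxK N0 u) uN mul0mx.
have x0 : x = 0.
  by apply: fixed_ xv; rewrite Ex a1 b0 scale0r subr0 scale1r.
have y0 : y = 0.
  by apply: fixed_ yv; rewrite Ey a1 b0 scale0r add0r scale1r.
by move: xy0; rewrite x0 y0 eqxx.
Qed.

(** Phi has no zero in the compact box for q0, hence none for q near q0, and a
    unit eigenvalue z <> 1 would give one. *)
Lemma simple_unit_eigenvalue_near :
  \forall q \near q0, simple_unit_eigenvalue (J q) /\ N q \in unitmx.
Proof.
have nA : \forall q \near q0, A q by exact: open_nbhs_nbhs.
have oAK : open (A `*` [set: K]) by exact: openT_prod.
have nPhi : \forall q \near q0, forall c, box c -> Phi q c != 0.
  have /compact_near_coveringP := box_compact.
  move=> /(_ X (nbhs q0) (fun q c => Phi q c != 0) _); apply => c _.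
  have cp : (fun p : X * K => Phi p.1 p.2) p @[p --> (q0, c)] --> Phi q0 c.
    exact: (Ck_cont Phi_cont (conj Aq0 I : (A `*` [set: K]) (q0, c))).
  have [[P Q] /= [nP nQ] PQ] := cvgr_neq0 _ cp (Phi_base c).
  by exists (Q, P) => // -[c' q'] [Qc Pq]; exact: (PQ (q', c')).
have nN := bordered_near.
near=> q; have Aq : A q by near: q.
have Nq : N q \in unitmx by near: q.
split; [split; first by apply/(simple_eigenvalueP (Jv Aq) (wv Aq))|exact: Nq].
have Pq : forall c, box c -> Phi q c != 0 by near: q.
move=> z /eigenvalue_real_rows[x [y [xy0 Ex Ey]]] z1; apply/eqP; apply: contraT => zn1.
have zz : complex.Re z ^+ 2 + complex.Im z ^+ 2 = 1.
  by apply: complexI; rewrite add_Re2_Im2 z1 expr1n.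
set a := complex.Re z in Ex Ey zz; set b := complex.Im z in Ex Ey zz.
have zn : (a - 1) ^+ 2 + b ^+ 2 != 0.
  apply: contra zn1; rewrite paddr_eq0 ?sqr_ge0// !sqrf_eq0 subr_eq0 => /andP[/eqP a1 /eqP b0].
  by rewrite eq_complex /= -/a -/b a1 b0 !eqxx.
have [xv yv] : x *m v q = 0 /\ y *m v q = 0.
  have e1 : x *m v q = a *: (x *m v q) - b *: (y *m v q).
    by rewrite !scalemxAl -mulmxBl -Ex -mulmxA Jv.
  have e2 : y *m v q = b *: (x *m v q) + a *: (y *m v q).
    by rewrite !scalemxAl -mulmxDl -Ey -mulmxA Jv.
  move: e1 e2; move: (x *m v q) (y *m v q) => P Q e1 e2.
  have f1 := congr1 (fun M : 'M[R]_1 => M 0 0) e1; have f2 := congr1 (fun M : 'M[R]_1 => M 0 0) e2.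
  rewrite !mxE in f1 f2.
  have P0 : P 0 0 = 0.
    apply: (mulfI zn); rewrite mulr0.
    have -> : ((a - 1) ^+ 2 + b ^+ 2) * P 0 0 =
      (a - 1) * (a * P 0 0 - b * Q 0 0 - P 0 0) + b * (b * P 0 0 + a * Q 0 0 - Q 0 0) by ring.
    by rewrite -f1 -f2 !subrr !mulr0 addr0.
  have Q0 : Q 0 0 = 0.
    apply: (mulfI zn); rewrite mulr0.
    have -> : ((a - 1) ^+ 2 + b ^+ 2) * Q 0 0 =
      (a - 1) * (b * P 0 0 + a * Q 0 0 - Q 0 0) - b * (a * P 0 0 - b * Q 0 0 - P 0 0) by ring.
    by rewrite -f1 -f2 !subrr !mulr0 subr0.
  by split; apply/matrixP => i j; rewrite !ord1 mxE.
(* normalizing the eigenvector puts it into the box *)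
pose T := \sum_j (x 0 j ^+ 2 + y 0 j ^+ 2).
have T_ge0 j : 0 <= x 0 j ^+ 2 + y 0 j ^+ 2 by rewrite addr_ge0 ?sqr_ge0.
have T0 : 0 < T.
  rewrite lt_neqAle eq_sym sumr_ge0// andbT; apply: contraL xy0.
  rewrite psumr_eq0// negb_or !negbK => /allP H.
  have E j : (x 0 j = 0) /\ (y 0 j = 0).
    have := H j; rewrite mem_index_enum => /(_ isT) /=.
    by rewrite paddr_eq0 ?sqr_ge0// !sqrf_eq0 => /andP[/eqP-> /eqP->].
  by apply/andP; split; apply/eqP/rowP => j; rewrite mxE; case: (E j).
pose c := (Num.sqrt T)^-1.
have cT : c ^+ 2 * T = 1.
  by rewrite /c exprVn sqr_sqrtr ?(ltW T0)// mulVf// gt_eqF.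
have xy1 : \sum_j ((c *: x) 0 j ^+ 2 + (c *: y) 0 j ^+ 2) = 1.
  rewrite -cT mulr_sumr; apply: eq_bigr => j _.
  by rewrite !mxE !exprMn mulrDr.
have sq_le1 (t u : R) : t ^+ 2 + u ^+ 2 <= 1 -> (t \in `[-1, 1]) /\ (u \in `[-1, 1]).
  move=> tu; have t2 : t ^+ 2 <= 1 by apply: le_trans tu; rewrite lerDl sqr_ge0.
  have u2 : u ^+ 2 <= 1 by apply: le_trans tu; rewrite lerDr sqr_ge0.
  by split; rewrite in_itv /= -ler_norml -sqr_norm_le1.
have xyb j : (c *: x) 0 j ^+ 2 + (c *: y) 0 j ^+ 2 <= 1.
  rewrite -xy1 (bigD1 j)//= lerDl sumr_ge0// => i _.
  by rewrite addr_ge0 ?sqr_ge0.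
have bx : box ((a, b), (c *: x, c *: y)).
  have [ha hb] : (a \in `[-1, 1]) /\ (b \in `[-1, 1]) by apply: sq_le1; rewrite zz.
  by split; [split|split=> j /=]; [exact: ha|exact: hb|exact: (sq_le1 _ _ (xyb j)).1|
    exact: (sq_le1 _ _ (xyb j)).2].
have := Pq _ bx; suff -> : Phi q ((a, b), (c *: x, c *: y)) = 0 by rewrite eqxx.
have cv (u : 'rV[R]_m) : u *m v q = 0 -> \sum_j (c *: u) 0 j * v q j 0 = 0.
  move=> uv; have := congr1 (fun M : 'M[R]_1 => c * M 0 0) uv; rewrite !mxE mulr0 mulr_sumr => H.
  by rewrite -[RHS]H; apply: eq_bigr => j _; rewrite mxE mulrA.
have cJ (u : 'rV[R]_m) i : \sum_j (c *: u) 0 j * J q j i = c * (u *m J q) 0 i.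
  by rewrite mxE mulr_sumr; apply: eq_bigr => j _; rewrite mxE mulrA.
rewrite /Phi /= (cv x xv) (cv y yv) xy1 zz !subrr expr0n /= !addr0.
rewrite !big1 ?addr0// => i _; rewrite cJ ?Ex ?Ey !mxE; apply/eqP; rewrite sqrf_eq0; apply/eqP; ring.
Unshelve. all: by end_near. Qed.

End SpectrumStability.

(** * Folds of a real function *)

Section Parabola.
Context {R : realType}.

(** The derivative of E has the sign of s - s0 near s0, so that E decreases and
    then increases; the intermediate value theorem gives one point on each side.
    The radius r is arbitrary below r0, since the fixed points must be found in
    arbitrarily small neighbourhoods. *)
Lemma parabola_pos (E : R -> R) (A : set R) (s0 c : R) : open A -> A s0 -> Ck 2 A E ->
  'D_1 E s0 = 0 -> 'D_1 ('D_1 E) s0 = c -> 0 < c ->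
  exists2 r0, 0 < r0 & forall r, 0 < r -> r < r0 -> exists2 h0, 0 < h0 &
    [/\ forall s, `|s - s0| < r -> E s = E s0 -> s = s0,
        forall h s, 0 < h -> `|s - s0| < r -> E s <> E s0 - h &
        forall h, 0 < h < h0 -> exists s1 s2, [/\ s1 <> s2, `|s1 - s0| < r, `|s2 - s0| < r &
          forall s, `|s - s0| < r -> (E s = E s0 + h <-> s = s1 \/ s = s2)]].
Proof.
move=> oA As0 kE E1 E2 c0.
have dE s : A s -> is_derive s 1 E ('D_1 E s).
  by move=> As; apply: derivableP; apply/derivable1_diffP; exact: Ck_diff kE As.
have kE1 : Ck 1 A ('D_1 E) := kE.2 1.
have dE1 : differentiable ('D_1 E) s0 by exact: Ck_diff kE1 As0.
have c2 : 0 < c / 2 by rewrite divr_gt0.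
have nE := differentiable_eps c2 dE1.
have nA : \forall s \near s0, A s by exact: open_nbhs_nbhs.
have /nbhs_normP[r0 /= r00 Hr] : \forall s \near s0, A s /\
    `|'D_1 E s - 'D_1 E s0 - 'd ('D_1 E) s0 (s - s0)| <= c / 2 * `|s - s0|.
  exact: filterI nA nE.
have slope s : `|s - s0| < r0 -> (s0 < s -> 0 < 'D_1 E s) /\ (s < s0 -> 'D_1 E s < 0).
  rewrite distrC => /Hr[_]; rewrite E1 subr0.
  have -> : 'd ('D_1 E) s0 (s - s0) = (s - s0) * c.
    rewrite -(deriveE (s - s0) dE1) -[X in 'D_X _ _](mulr1 (s - s0)).
    by rewrite (derive_dirZ (s - s0) (1 : R) dE1) E2.
  move=> H; split=> ss.
    by move: H; rewrite (gtr0_norm (_ : 0 < s - s0)) ?subr_gt0// ler_norml => /andP[H _]; nra.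
  by move: H; rewrite (ltr0_norm (_ : s - s0 < 0)) ?subr_lt0// ler_norml => /andP[_ H]; nra.
have inA s : `|s - s0| < r0 -> A s by rewrite distrC => /Hr[].
have cE a b : `|a - s0| < r0 -> `|b - s0| < r0 -> {within `[a, b], continuous E}.
  move=> ha hb; apply: derivable_within_continuous => s; rewrite in_itv /= => /andP[as_ sb].
  have [] // := dE s _; apply: inA; rewrite ltr_norml; move: ha hb; rewrite !ltr_norml.
  by move=> /andP[? ?] /andP[? ?]; apply/andP; split; lra.
have mvt a b : `|a - s0| < r0 -> `|b - s0| < r0 -> a < b ->
    exists2 s, a < s < b & E b - E a = 'D_1 E s * (b - a).
  move=> ha hb ab; have [|s] := MVT ab _ (cE a b ha hb) (df := 'D_1 E).
    move=> s; rewrite in_itv /= => /andP[as_ sb]; apply: dE; apply: inA.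
    rewrite ltr_norml; move: ha hb; rewrite !ltr_norml.
    by move=> /andP[? ?] /andP[? ?]; apply/andP; split; lra.
  by rewrite in_itv /= => sab Es; exists s.
have s0r : `|s0 - s0| < r0 by rewrite subrr normr0.
have incr a b : s0 <= a -> a < b -> `|b - s0| < r0 -> E a < E b.
  move=> sa ab hb; have ha : `|a - s0| < r0.
    move: hb; rewrite !ltr_norml => /andP[? ?]; apply/andP; split; lra.
  have [s /andP[as_ sb] Es] := mvt a b ha hb ab.
  rewrite -subr_gt0 Es mulr_gt0 ?subr_gt0//; apply: (slope s _).1; last exact: le_lt_trans as_.
  by move: ha hb; rewrite !ltr_norml => /andP[? ?] /andP[? ?]; apply/andP; split; lra.
have decr a b : a < b -> b <= s0 -> `|a - s0| < r0 -> E b < E a.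
  move=> ab bs ha; have hb : `|b - s0| < r0.
    move: ha; rewrite !ltr_norml => /andP[? ?]; apply/andP; split; lra.
  have [s /andP[as_ sb] Es] := mvt a b ha hb ab.
  rewrite -subr_lt0 Es pmulr_llt0 ?subr_gt0//; apply: (slope s _).2; last exact: lt_le_trans bs.
  by move: ha hb; rewrite !ltr_norml => /andP[? ?] /andP[? ?]; apply/andP; split; lra.
have Emin s : `|s - s0| < r0 -> s <> s0 -> E s0 < E s.
  by move=> hs ns; have [lt|lt|//] := ltgtP s s0; [exact: decr|exact: incr].
exists r0 => // r rp rr0.
have hp : `|(s0 + r) - s0| < r0 by rewrite addrC addKr gtr0_norm.
have hm : `|(s0 - r) - s0| < r0 by rewrite addrC addKr normrN gtr0_norm.
have lp : s0 < s0 + r by rewrite ltrDl.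
have lm : s0 - r < s0 by rewrite gtrBl.
exists (Num.min (E (s0 + r) - E s0) (E (s0 - r) - E s0)).
  by rewrite lt_min !subr_gt0 incr// decr.
split.
- move=> s hs Es; apply: contrapT => ns; have := Emin s (lt_trans hs rr0) ns.
  by rewrite Es ltxx.
- move=> h s h0 hs Es; have [e|ns] := eqVneq s s0.
    by move: Es; rewrite e => /eqP; rewrite eq_sym subr_eq -subr_eq0 opprD addNKr oppr_eq0 gt_eqF.
  have := Emin s (lt_trans hs rr0) (elimN eqP ns); rewrite Es; lra.
move=> h /andP[h0]; rewrite lt_min !ltrBrDl => /andP[hh1 hh2].
have [s2] : exists2 s, s \in `[s0, s0 + r] & E s = E s0 + h.
  apply: IVT; [exact: ltW|exact: cE|].
  by rewrite ge_min le_max lerDl (ltW h0) /= (ltW hh1) orbT.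
rewrite in_itv /= => /andP[s20 s2r] Es2.
have [s1] : exists2 s, s \in `[s0 - r, s0] & E s = E s0 + h.
  apply: IVT; [exact: ltW|exact: cE|].
  by rewrite ge_min le_max lerDl (ltW h0) /= (ltW hh2) orbT.
rewrite in_itv /= => /andP[s1r s10] Es1.
have s2n : s2 != s0 by apply/eqP => e; move: Es2; rewrite e; lra.
have s1n : s1 != s0 by apply/eqP => e; move: Es1; rewrite e; lra.
have s2n' : s2 != s0 + r by apply/eqP => e; move: Es2; rewrite e; lra.
have s1n' : s1 != s0 - r by apply/eqP => e; move: Es1; rewrite e; lra.
have s20' : s0 < s2 by rewrite lt_neqAle eq_sym s2n.
have s10' : s1 < s0 by rewrite lt_neqAle s1n.
have s2r' : s2 < s0 + r by rewrite lt_neqAle s2n'.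
have s1r' : s0 - r < s1 by rewrite lt_neqAle eq_sym s1n'.
exists s1, s2; split.
- by move=> e; move: s10' s20'; rewrite e; lra.
- by rewrite ltr_norml; apply/andP; split; lra.
- by rewrite ltr_norml; apply/andP; split; lra.
move=> s hs; split=> [Es|[->//|->//]].
have hs0 : `|s - s0| < r0 by exact: lt_trans rr0.
have [lt|gt|e] := ltgtP s s0.
- left; have [l|l|//] := ltgtP s s1.
    by have := decr _ _ l (ltW s10') hs0; rewrite Es Es1 ltxx.
  have h1 : `|s1 - s0| < r0 by rewrite ltr_norml; apply/andP; split; lra.
  by have := decr _ _ l (ltW lt) h1; rewrite Es Es1 ltxx.
- right; have [l|l|//] := ltgtP s s2.
    have h1 : `|s2 - s0| < r0 by rewrite ltr_norml; apply/andP; split; lra.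
    by have := incr _ _ (ltW gt) l h1; rewrite Es Es2 ltxx.
  by have := incr _ _ (ltW s20') l hs0; rewrite Es Es2 ltxx.
- by move: Es; rewrite e; lra.
Qed.

Lemma parabola (E : R -> R) (A : set R) (s0 : R) : open A -> A s0 -> Ck 2 A E ->
  'D_1 E s0 = 0 -> 'D_1 ('D_1 E) s0 != 0 ->
  exists2 sg : R, (sg = 1 \/ sg = -1) &
  exists2 r0, 0 < r0 & forall r, 0 < r -> r < r0 -> exists2 h0, 0 < h0 &
    [/\ forall s, `|s - s0| < r -> E s = E s0 -> s = s0,
        forall h s, 0 < h -> `|s - s0| < r -> E s <> E s0 - sg * h &
        forall h, 0 < h < h0 -> exists s1 s2, [/\ s1 <> s2, `|s1 - s0| < r, `|s2 - s0| < r &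
          forall s, `|s - s0| < r -> (E s = E s0 + sg * h <-> s = s1 \/ s = s2)]].
Proof.
move=> oA As0 kE E1 E2.
have [c0|c0|c0] := ltgtP 0 ('D_1 ('D_1 E) s0); last by rewrite -c0 eqxx in E2.
  exists 1; first by left.
  have [r0 r00 H] := parabola_pos oA As0 kE E1 erefl c0.
  exists r0 => // r rp rr; have [h0 h00 [H1 H2 H3]] := H r rp rr.
  exists h0 => //; split => // [h s|h]; rewrite mul1r; [exact: H2|exact: H3].
exists (-1); first by right.
have kE' : Ck 2 A (fun s => - E s) by exact: Ck_opp.
have dE s : A s -> 'D_1 (fun s => - E s) s = - 'D_1 E s.
  by move=> As; apply: deriveN; apply/derivable1_diffP; exact: Ck_diff kE As.
have nA : \forall s \near s0, A s by exact: open_nbhs_nbhs.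
have dE2 : 'D_1 ('D_1 (fun s => - E s)) s0 = - 'D_1 ('D_1 E) s0.
  rewrite -deriveN; last by apply/derivable1_diffP; exact: Ck_diff (kE.2 1 : Ck 1 A ('D_1 E)) As0.
  by apply: near_eq_derive; apply: filterS nA => s /dE.
have c0' : 0 < - 'D_1 ('D_1 E) s0 by rewrite oppr_gt0.
have E1' : 'D_1 (fun s => - E s) s0 = 0 by rewrite dE// E1 oppr0.
have [r0 r00 H] := parabola_pos oA As0 kE' E1' dE2 c0'.
exists r0 => // r rp rr; have [h0 h00 [H1 H2 H3]] := H r rp rr.
exists h0 => //; split.
- by move=> s hs Es; apply: H1 => //; rewrite Es.
- by move=> h s hp hs Es; apply: (H2 h s hp hs); rewrite Es; ring.
move=> h hh; have [s1 [s2 [n h1 h2 Hs]]] := H3 h hh.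
exists s1, s2; split => // s hs; rewrite -(Hs s hs); split => Es.
  by rewrite Es; ring.
by rewrite -[LHS]opprK Es; ring.
Qed.

End Parabola.

(** * Derivatives of a parametrized family of maps *)

Lemma derive_dirD (R : realType) (V W : normedModType R) (f : V -> W) x a b c :
  c = a + b -> differentiable f x -> 'D_c f x = 'D_a f x + 'D_b f x.
Proof. by move=> -> df; rewrite !deriveE// linearD. Qed.

Lemma derive_dir_pair (R : realType) (V V' W : normedModType R) (f : V * V' -> W) p a b :
  differentiable f p -> 'D_(a, b) f p = 'D_(a, 0) f p + 'D_(0, b) f p.
Proof.
by apply: derive_dirD; apply: injective_projections => /=; rewrite ?addr0 ?add0r.
Qed.

Section SecondDerivative.
Context {R : realType} {V W : normedModType R} {cV : coords V}.

(** The second derivative of f, plus a term linear in the derivative b of the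
    direction: this is what differentiating the chain rule once more requires. *)
Lemma derive_dir (A : set V) (f : V -> W) x d a b : open A -> Ck 2 A f -> A x ->
  'D_(a, b) (fun p : V * V => 'D_(p.2) f p.1) (x, d) = 'D_a ('D_d f) x + 'D_b f x.
Proof.
move=> oA kf Ax.
have df : differentiable f x by exact: Ck_diff kf Ax.
have dL : differentiable (fun p : V * V => 'D_(p.2) f p.1) (x, d).
  by apply: (Ck_diff (Ck_dir oA kf)); split.
have E1 : 'D_(a, 0) (fun p : V * V => 'D_(p.2) f p.1) (x, d) = 'D_a ('D_d f) x.
  by apply: derive_congr => h /=; rewrite scaler0 add0r.
have cd : continuous ('d f x) by exact: diff_continuous.
have E2 : 'D_(0, b) (fun p : V * V => 'D_(p.2) f p.1) (x, d) = 'D_b f x.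
  transitivity ('D_b ('d f x) d); last by rewrite (derive_linear d b cd) (deriveE b df).
  by apply: derive_congr => h /=; rewrite scaler0 add0r (deriveE _ df).
exact: (etrans (derive_dir_pair a b dL) (congr2 +%R E1 E2)).
Qed.

End SecondDerivative.

Section FixedPointCurve.
Context {R : realType} {m : nat}.
Notation pt := ('cV[R]_m * R * R)%type.
Variables (P : pt -> 'cV[R]_m) (U : set pt).
Hypothesis oU : open U.

Definition jac_state (p : pt) : 'M[R]_m := jac (fun u => P ((u, p.1.2), p.2)) p.1.1.

Let slice_arg_Ck k (mu : R) (S : set ('cV[R]_m * R)) : open S ->
  Ck k S (fun q : 'cV[R]_m * R => ((q.1, mu), q.2) : pt).
Proof.
move=> oS; apply: (Ck_pair oS); last by apply: (Ck_snd oS); exact: Ck_id.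
by apply: (Ck_pair oS); [apply: (Ck_fst oS); exact: Ck_id|exact: Ck_cst].
Qed.

Lemma slice_open mu : open [set q : 'cV[R]_m * R | U ((q.1, mu), q.2)].
Proof.
apply: (@open_comp _ _ (fun q : 'cV[R]_m * R => ((q.1, mu), q.2))) => // q _.
exact: (Ck_cont (slice_arg_Ck 0 mu openT)).
Qed.

Lemma slice_Ck k mu : Ck k U P ->
  Ck k [set q : 'cV[R]_m * R | U ((q.1, mu), q.2)] (fun q => P ((q.1, mu), q.2)).
Proof.
by move=> kP; exact: (Ck_comp (slice_open (mu := mu)) _ (slice_arg_Ck _ _ (slice_open (mu := mu))) kP).
Qed.

Lemma jac_state_mul p z : Ck 1 U P -> U p -> jac_state p *m z = 'D_((z, 0), 0) P p.
Proof.
move=> kP Up; rewrite /jac_state jac_mul.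
have ds : differentiable (fun u => P ((u, p.1.2), p.2)) p.1.1.
  have di : differentiable (fun u : 'cV[R]_m => (u, p.2)) p.1.1.
    by apply: differentiable_pair; [by []|exact: differentiable_cst].
  apply: (differentiable_comp di (g := fun q => P ((q.1, p.1.2), q.2))).
  by apply: (Ck_diff (slice_Ck p.1.2 kP)); case: p Up {di} => [[]].
rewrite -(deriveE _ ds); apply: derive_congr => h.
by case: p {Up ds} => [[u mu] e] /=; congr P;
  apply: injective_projections => /=; rewrite ?scaler0 ?add0r//;
  apply: injective_projections => /=; rewrite ?scaler0 ?add0r.
Qed.

Definition param_derivative (p : pt) : 'cV[R]_m := 'D_((0, 0), 1) P p.

Lemma derive_state_param p z e : Ck 1 U P -> U p ->
  'D_((z, 0), e) P p = jac_state p *m z + e *: param_derivative p.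
Proof.
move=> kP Up; have dP := Ck_diff kP Up.
rewrite (derive_dir_pair _ _ dP) (jac_state_mul _ kP Up) -(derive_dirZ _ _ dP); congr (_ + 'D__ _ _).
by apply: injective_projections => /=; rewrite ?scaler0// [_ *: _]mulr1.
Qed.

End FixedPointCurve.

(** * Persistence of a generic saddle-node *)

Section FoldCurve.
Context {R : realType} {m : nat}.
Notation pt := ('cV[R]_m * R * R)%type.
Variables (P : pt -> 'cV[R]_m) (U : set pt) (k : nat) (u0 : 'cV[R]_m) (w v : 'cV[R]_m).
Let p0 : pt := ((u0, 0), 0).
Hypothesis oU : open U.
Hypothesis Up0 : U p0.
Hypothesis kP : Ck k.+2 U P.
Hypothesis P0 : P p0 = u0.
Hypothesis simple1 : simple_unit_eigenvalue (jac_state P p0).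
Hypothesis wv : unit_eigenvectors (jac_state P p0) w v.
Hypothesis Pe0 : dotv w (param_derivative P p0) != 0.

Let kP1 : Ck 1 U P. Proof. exact: Ck_le kP. Qed.

Definition at_curve (h : R * R -> 'cV[R]_m * R) (q : R * R) : pt := (((h q).1, q.2), (h q).2).

Let lift (q : (R * R) * ('cV[R]_m * R)) : pt := ((q.2.1, q.1.2), q.2.2).

Let lift_Ck j (A : set ((R * R) * ('cV[R]_m * R))) : open A -> Ck j A lift.
Proof.
move=> oA; apply: (Ck_pair oA); last by apply: (Ck_snd oA); apply: (Ck_snd oA); exact: Ck_id.
apply: (Ck_pair oA); first by apply: (Ck_fst oA); apply: (Ck_snd oA); exact: Ck_id.
by apply: (Ck_snd oA); apply: (Ck_fst oA); exact: Ck_id.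
Qed.

Let GU := lift @^-1` U.
Let G (q : (R * R) * ('cV[R]_m * R)) : 'cV[R]_m * R :=
  (P (lift q) - q.2.1, dotv w (q.2.1 - u0) - q.1.1).

Let oGU : open GU.
Proof. by apply: open_comp => // q _; exact: (Ck_cont (lift_Ck 0 openT)). Qed.

Let kG1 : Ck k.+2 GU (fun q => P (lift q) - q.2.1).
Proof.
apply: (Ck_sub_fun oGU).
  by apply: (Ck_comp oGU _ (lift_Ck _ oGU) kP).
by apply: (Ck_fst oGU); apply: (Ck_snd oGU); exact: Ck_id.
Qed.

Let kG2 : Ck k.+2 GU (fun q => dotv w (q.2.1 - u0) - q.1.1 : R).
Proof.
apply: (Ck_sub_fun oGU); last by apply: (Ck_fst oGU); apply: (Ck_fst oGU); exact: Ck_id.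
apply: (Ck_linl (L := dotv w) oGU); first exact: (lin_continuous (W := R^o)).
apply: (Ck_sub_fun oGU); last exact: Ck_cst.
by apply: (Ck_fst oGU); apply: (Ck_snd oGU); exact: Ck_id.
Qed.

Let DG q z e : GU q -> 'D_(0, (z, e)) G q =
  (jac_state P (lift q) *m z + e *: param_derivative P (lift q) - z, dotv w z).
Proof.
move=> Uq; have d1 := Ck_diff kG1 Uq; have d2 := Ck_diff kG2 Uq.
rewrite /G (derive_pair _ d1 d2); congr pair.
  have da : differentiable (fun q => P (lift q)) q.
    exact: (Ck_diff (Ck_comp (f := lift) (g := P) oGU (fun _ H => H) (lift_Ck _ oGU) kP) Uq).
  have db : differentiable (fun q : (R * R) * ('cV[R]_m * R) => q.2.1) q.
    by apply: (Ck_diff (k := 0) (A := setT)) => //; apply: (Ck_fst openT); apply: (Ck_snd openT); exact: Ck_id.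
  rewrite deriveB; [|exact: diff_derivable|exact: diff_derivable].
  congr (_ - _).
    rewrite -(derive_state_param oU z e kP1 Uq); by apply: derive_congr.
  transitivity ('D_z (fun x : 'cV[R]_m => x) q.2.1); last exact: derive_id.
  by apply: derive_congr.
transitivity ('D_z (fun x : 'cV[R]_m => (dotv w : 'cV[R]_m -> R^o) x - q.1.1 : R) (q.2.1 - u0)).
  by apply: derive_congr => t /=; rewrite scaler0 add0r addrA.
have cw : continuous (dotv w : 'cV[R]_m -> R^o) by exact: (lin_continuous (W := R^o)).
rewrite deriveB; [|exact/diff_derivable/linear_differentiable|exact: derivable_cst].
by rewrite derive_cst subr0 (derive_linear (f := dotv w)).
Qed.

Let N0 := 1%:M - jac_state P p0 + v *m w^T.

Let N0_unit : N0 \in unitmx.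
Proof.
have [_ Jv wv1] := wv; case: simple1 => m1 _.
by apply/(simple_eigenvalueP Jv wv1).
Qed.

Let G_regular z : 'D_(0, z) G ((0, 0), (u0, 0)) = 0 -> z = 0.
Proof.
case: z => z e; rewrite DG// => /pair_equal_spec [/eqP].
rewrite subr_eq0 => /eqP E wz; have [wJ Jv wv1] := wv.
have : dotv w (jac_state P p0 *m z + e *: param_derivative P p0) = dotv w z by rewrite E.
rewrite /dotv mulmxDr mulmxA wJ mxE -/(dotv w z) wz add0r -scalemxAr mxE => /eqP.
rewrite mulf_eq0 (negbTE Pe0) orbF => /eqP e0; rewrite e0 scale0r addr0 in E *.
congr pair; have : N0 *m z = 0.
  rewrite /N0 mulmxDl mulmxBl mul1mx E subrr add0r -mulmxA dotvE wz.
  by rewrite (_ : 0%:M = 0) ?mulmx0//; apply/matrixP => i j; rewrite !mxE mul0rn.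
by move/(congr1 (mulmx (invmx N0))); rewrite mulmx0 mulKmx.
Qed.

(** Applying w to the linearized equations J z + e P_eta = z and w^T z = 0 gives
    e = 0, and then z = 0 because 1 is simple: the implicit function theorem
    applies with (s, mu) as parameters and (u, eta) as unknown. The last
    conclusion is the same injectivity at the other points of the surface. *)
Lemma fixed_point_curve : exists (A : set (R * R)) (B : set ('cV[R]_m * R))
    (h : R * R -> 'cV[R]_m * R),
  [/\ open A, A (0, 0), open B & forall e mu q, A (e, mu) -> B q -> U ((q.1, mu), q.2)] /\
  [/\ h (0, 0) = (u0, 0), Ck k.+2 A h, forall q, A q -> B (h q),
      forall s mu u e, A (s, mu) -> B (u, e) ->
        (P ((u, mu), e) = u /\ dotv w (u - u0) = s) <-> (u, e) = h (s, mu) &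
      forall q z e, A q -> jac_state P (at_curve h q) *m z + e *: param_derivative P (at_curve h q) = z ->
        dotv w z = 0 -> z = 0 /\ e = 0].
Proof.
have kG : Ck k.+2 GU G by exact: (Ck_pair oGU kG1 kG2).
have G0 : G ((0, 0), (u0, 0)) = 0.
  by rewrite /G /lift /= P0 !subrr linear0 subrr.
have [A [B [h [[oA A0 oB B0 AB] [Bh GE Greg kh]]]]] :=
  implicit_function oGU (Up0 : GU ((0, 0), (u0, 0))) kG G0 G_regular.
have Geq s mu u e : A (s, mu) -> B (u, e) ->
    (P ((u, mu), e) = u /\ dotv w (u - u0) = s) <-> (u, e) = h (s, mu).
  move=> Aq Bq; rewrite -(GE _ _ Aq Bq) /G /lift /=; split=> [[-> ->]|].
    by rewrite !subrr.
  by move=> /pair_equal_spec [/eqP + /eqP]; rewrite !subr_eq0 => /eqP -> /eqP ->.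
exists A, B, h; split; split => //.
- by move=> e mu q Aq Bq; exact: (AB _ _ Aq Bq).
- by apply/esym/Geq => //; rewrite subrr linear0.
move=> q z e Aq E wz; apply/pair_equal_spec; rewrite -[(0, 0)]/(0 : 'cV[R]_m * R).
apply: (Greg _ _ _ Aq (Bh _ Aq)).
by rewrite DG; [congr pair => //; apply/eqP; rewrite subr_eq0; apply/eqP|exact: AB (Bh _ Aq)].
Qed.

End FoldCurve.

Section CurveDerivatives.
Context {R : realType} {m : nat}.
Notation pt := ('cV[R]_m * R * R)%type.
Variables (P : pt -> 'cV[R]_m) (U : set pt) (w u0 : 'cV[R]_m).
Variables (A : set (R * R)) (h : R * R -> 'cV[R]_m * R).
Hypothesis oU : open U.
Hypothesis oA : open A.
Hypothesis kP : Ck 2 U P.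
Hypothesis kh : Ck 2 A h.
Hypothesis hU : forall q, A q -> U (at_curve h q).
Hypothesis hP : forall q, A q -> P (at_curve h q) = (h q).1.
Hypothesis hw : forall q, A q -> dotv w ((h q).1 - u0) = q.1.

Definition state_velocity : R * R -> 'cV[R]_m := 'D_(1, 0) (fun q => (h q).1).
Definition param_velocity : R * R -> R := 'D_(1, 0) (fun q => (h q).2).

Let kh1 : Ck 2 A (fun q => (h q).1). Proof. exact: (Ck_fst oA kh). Qed.
Let kh2 : Ck 2 A (fun q => (h q).2). Proof. exact: (Ck_snd oA kh). Qed.

Let kv : Ck 1 A state_velocity. Proof. exact: (kh1.2 (1, 0)). Qed.
Let ke : Ck 1 A param_velocity. Proof. exact: (kh2.2 (1, 0)). Qed.

Let dir q : pt := ((state_velocity q, 0), param_velocity q).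

Let kc : Ck 2 A (at_curve h).
Proof.
apply: (Ck_pair oA _ kh2); apply: (Ck_pair oA kh1).
by apply: (Ck_snd oA); exact: Ck_id.
Qed.

Let kdir : Ck 1 A dir.
Proof.
apply: (Ck_pair oA _ ke).
by apply: (Ck_pair oA kv); exact: Ck_cst.
Qed.

Let Dc q : A q -> 'D_(1, 0) (at_curve h) q = dir q.
Proof.
move=> Aq; have d1 := Ck_diff kh1 Aq; have d2 := Ck_diff kh2 Aq.
have ds : differentiable (fun q : R * R => q.2) q.
  by apply: (Ck_diff (k := 0) (A := setT)) => //; apply: (Ck_snd openT); exact: Ck_id.
rewrite /at_curve (derive_pair (f := fun q => ((h q).1, q.2)) _ (differentiable_pair d1 ds) d2).
rewrite (derive_pair _ d1 ds) /dir; congr ((_, _), _).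
transitivity ('D_0 (fun x : R => x) q.2); last exact: derive_id.
exact: derive_congr.
Qed.

Let P_dir q : A q -> 'D_(dir q) P (at_curve h q) = state_velocity q.
Proof.
move=> Aq; rewrite -(Dc Aq) -(derive_comp (f := at_curve h) (g := P) (1, 0) (Ck_diff kc Aq) (Ck_diff kP (hU Aq))).
apply: near_eq_derive; near=> y; rewrite /= hP//.
by near: y; exact: open_nbhs_nbhs.
Unshelve. all: by end_near. Qed.

(** First derivative of P (h) = h with respect to s. *)
Lemma curve_tangent q : A q ->
  jac_state P (at_curve h q) *m state_velocity q
    + param_velocity q *: param_derivative P (at_curve h q) = state_velocity q.
Proof. by move=> Aq; rewrite -(derive_state_param oU _ _ (Ck_S kP) (hU Aq)); exact: P_dir. Qed.

Lemma curve_speed q : A q -> dotv w (state_velocity q) = 1.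
Proof.
move=> Aq; have cw : continuous (dotv w : 'cV[R]_m -> R^o) by exact: (lin_continuous (W := R^o)).
have d1 := Ck_diff kh1 Aq.
have dw : differentiable (dotv w : 'cV[R]_m -> R^o) (h q).1 by exact: linear_differentiable.
rewrite -(derive_linear (f := dotv w) (h q).1 _ cw).
rewrite -(derive_comp (f := fun q => (h q).1) (1, 0) d1 dw).
transitivity ('D_(1, 0) (fun q : R * R => (q.1 + dotv w u0) : R^o) q).
  apply: near_eq_derive; near=> y.
  have : A y by near: y; exact: open_nbhs_nbhs.
  by move=> /hw <-; rewrite linearB /= subrK.
transitivity ('D_1 (fun x : R => x + dotv w u0) q.1).
  by apply: derive_congr => t /=.
by rewrite deriveD//; rewrite derive_id derive_cst addr0.
Unshelve. all: by end_near. Qed.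

(** Second derivative of P (h) = h with respect to s. The acceleration of u is
    multiplied by I - J, which the left eigenvector w' annihilates. *)
Lemma curve_second w' q : A q -> param_velocity q = 0 ->
  w'^T *m jac_state P (at_curve h q) = w'^T ->
  dotv w' ('D_((state_velocity q, 0), 0) ('D_((state_velocity q, 0), 0) P) (at_curve h q))
    = - ('D_(1, 0) param_velocity q * dotv w' (param_derivative P (at_curve h q))).
Proof.
move=> Aq e0 wJ.
pose L (p : pt * pt) := 'D_(p.2) P p.1.
have kL : Ck 1 (U `*` setT) L by exact: Ck_dir.
have UA y : A y -> (U `*` [set: pt]) (at_curve h y, dir y) by move=> Ay; split; [exact: hU|].
have kcd : Ck 1 A (fun y => (at_curve h y, dir y)) by apply: (Ck_pair oA (Ck_S kc) kdir).
have E1 : 'D_(1, 0) (fun y => L (at_curve h y, dir y)) q = 'D_(1, 0) state_velocity q.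
  apply: near_eq_derive; near=> y.
  by apply: P_dir; near: y; exact: open_nbhs_nbhs.
have E2 := derive_comp (f := fun y => (at_curve h y, dir y)) (g := L) (1, 0)
  (Ck_diff kcd Aq) (Ck_diff kL (UA _ Aq)).
have dc := Ck_diff kc Aq; have dd := Ck_diff kdir Aq.
have Ddir : 'D_(1, 0) dir q = (('D_(1, 0) state_velocity q, 0), 'D_(1, 0) param_velocity q).
  have d1 := Ck_diff kv Aq; have d2 := Ck_diff ke Aq.
  have d0 : differentiable (fun _ : R * R => 0 : R) q by exact: differentiable_cst.
  rewrite /dir (derive_pair (f := fun q => (state_velocity q, 0)) _ (differentiable_pair d1 d0) d2).
  by rewrite (derive_pair _ d1 d0) derive_cst.
rewrite (derive_pair _ dc dd) (Dc Aq) Ddir (derive_dir (cV := _) _ _ _ oU kP (hU Aq)) in E2.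
have := etrans (esym E2) E1.
rewrite (derive_state_param oU _ _ (Ck_S kP) (hU Aq)) /dir e0.
move/(congr1 (dotv w')); set X := 'D__ ('D__ P) _.
rewrite !linearD /= linearZ /=.
have -> : dotv w' (jac_state P (at_curve h q) *m 'D_(1, 0) state_velocity q) =
    dotv w' ('D_(1, 0) state_velocity q) by rewrite /dotv mulmxA wJ.
move=> E; apply/eqP; rewrite -addr_eq0; apply/eqP; move: E.
rewrite addrCA -[X in _ = X]addr0 => /addrI E.
exact: E.
Unshelve. all: by end_near. Qed.

End CurveDerivatives.

Section LeftEigenvector.
Context {R : realType} {m : nat}.

(** The left eigenvector is w^T times the inverse of N = I - J + v w^T. It is
    orthogonal to x only if the solution z of N z = x satisfies w^T z = 0, and
    then N z = z - J z. *)
Lemma left_unit_eigenvector (J : 'M[R]_m) (w v : 'cV[R]_m) :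
  J *m v = v -> dotv w v = 1 -> 1%:M - J + v *m w^T \in unitmx ->
  exists2 w' : 'cV[R]_m, unit_eigenvectors J w' v &
    forall x, dotv w' x = 0 -> exists2 z, J *m z + x = z & dotv w z = 0.
Proof.
move=> Jv wv; set N := _ + _ => uN.
have wx (x : 'cV[R]_m) : v *m w^T *m x = dotv w x *: v.
  by rewrite -mulmxA dotvE mul_mx_scalar.
have Nv : N *m v = v by rewrite /N mulmxDl mulmxBl mul1mx Jv subrr add0r wx wv scale1r.
exists (w^T *m invmx N)^T; last first.
  move=> x; rewrite /dotv trmxK -mulmxA -/(dotv w _) => wz; exists (invmx N *m x) => //.
  have := mulKVmx uN x; rewrite {1}/N mulmxDl mulmxBl mul1mx wx wz scale0r addr0 => E.
  by rewrite -[X in _ + X = _]E addrC subrK.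
have wNv : w^T *m invmx N *m v = 1%:M by rewrite -mulmxA -{1}Nv mulKmx// dotvE wv.
split=> //; last by rewrite /dotv trmxK wNv mxE.
rewrite trmxK; have -> : J = 1%:M - N + v *m w^T.
  by rewrite /N opprD addrA subrK subKr.
by rewrite mulmxDr mulmxBr mulmx1 mulmxA wNv mul1mx mulmxKV// subrK.
Qed.

End LeftEigenvector.

Section FoldBranch.
Context {R : realType} {m : nat}.
Notation pt := ('cV[R]_m * R * R)%type.
Variables (P : pt -> 'cV[R]_m) (U : set pt) (k : nat) (u0 : 'cV[R]_m) (w v : 'cV[R]_m).
Let p0 : pt := ((u0, 0), 0).
Hypothesis oU : open U.
Hypothesis Up0 : U p0.
Hypothesis kP : Ck k.+2 U P.
Hypothesis P0 : P p0 = u0.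
Hypothesis simple1 : simple_unit_eigenvalue (jac_state P p0).
Hypothesis wv : unit_eigenvectors (jac_state P p0) w v.
Hypothesis Pe0 : dotv w (param_derivative P p0) != 0.
Hypothesis Pvv0 : dotv w ('D_((v, 0), 0) ('D_((v, 0), 0) P) p0) != 0.

Variables (A : set (R * R)) (B : set ('cV[R]_m * R)) (h : R * R -> 'cV[R]_m * R).
Hypothesis oA : open A.
Hypothesis A0 : A (0, 0).
Hypothesis AB : forall e mu q, A (e, mu) -> B q -> U ((q.1, mu), q.2).
Hypothesis h0 : h (0, 0) = (u0, 0).
Hypothesis kh : Ck k.+2 A h.
Hypothesis Bh : forall q, A q -> B (h q).
Hypothesis hE : forall s mu u e, A (s, mu) -> B (u, e) ->
  (P ((u, mu), e) = u /\ dotv w (u - u0) = s) <-> (u, e) = h (s, mu).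
Hypothesis hreg : forall q z e, A q ->
  jac_state P (at_curve h q) *m z + e *: param_derivative P (at_curve h q) = z ->
  dotv w z = 0 -> z = 0 /\ e = 0.

Let kP2 : Ck 2 U P. Proof. exact: Ck_le kP. Qed.
Let kh2 : Ck 2 A h. Proof. exact: Ck_le kh. Qed.

Let hU q : A q -> U (at_curve h q).
Proof. by case: q => s mu Aq; exact: AB Aq (Bh Aq). Qed.

Let hPw q : A q -> P (at_curve h q) = (h q).1 /\ dotv w ((h q).1 - u0) = q.1.
Proof.
case: q => s mu Aq; have Bq := Bh Aq; apply/(hE Aq); by rewrite -surjective_pairing.
Qed.
Let hP q (Aq : A q) := (hPw Aq).1.
Let hw q (Aq : A q) := (hPw Aq).2.

Let at0 : at_curve h (0, 0) = p0. Proof. by rewrite /at_curve h0. Qed.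

Let param_velocity0 : param_velocity h (0, 0) = 0.
Proof.
have [wJ _ _] := wv; have := curve_tangent oU oA kP2 kh2 hU hP A0.
rewrite at0 => /(congr1 (dotv w)); rewrite linearD linearZ /=.
have -> : dotv w (jac_state P p0 *m state_velocity h (0, 0)) = dotv w (state_velocity h (0, 0)).
  by rewrite /dotv mulmxA wJ.
by rewrite -[X in _ = X]addr0 => /addrI/eqP; rewrite mulf_eq0 (negbTE Pe0) orbF => /eqP.
Qed.

Let state_velocity0 : state_velocity h (0, 0) = v.
Proof.
have [_ Jv wv1] := wv; have := curve_tangent oU oA kP2 kh2 hU hP A0.
rewrite at0 param_velocity0 scale0r addr0 => E; apply/eqP; rewrite -subr_eq0; apply/eqP.
have [//|//|//] := hreg (z := state_velocity h (0, 0) - v) (e := 0) A0.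
  by rewrite at0 scale0r addr0 mulmxBr E Jv.
by rewrite linearB /= (curve_speed oA kh2 hw A0) wv1 subrr.
Qed.

Let param_acceleration0 : 'D_(1, 0) (param_velocity h) (0, 0) != 0.
Proof.
have [wJ _ _] := wv.
have := curve_second oU oA kP2 kh2 hU hP A0 param_velocity0 (w' := w).
rewrite at0 state_velocity0 => /(_ wJ) E; apply: contraNneq Pvv0 => e0.
by rewrite E e0 mul0r oppr0.
Qed.

(** At the base point the identity of [curve_second] makes the acceleration of the
    parameter nonzero, so that param_velocity = 0 can be solved for s. *)
Lemma fold_branch : exists (A2 : set R) (sigma : R -> R),
  [/\ open A2, A2 0, sigma 0 = 0, Ck k.+1 A2 sigma &
      forall mu, A2 mu -> [/\ A (sigma mu, mu), param_velocity h (sigma mu, mu) = 0 &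
                          'D_(1, 0) (param_velocity h) (sigma mu, mu) != 0]].
Proof.
pose sw (q : R * R) := (q.2, q.1).
have ksw j (S : set (R * R)) : open S -> Ck j S sw.
  by move=> oS; apply: (Ck_pair oS); [apply: (Ck_snd oS)|apply: (Ck_fst oS)]; exact: Ck_id.
pose A' := sw @^-1` A.
have oA' : open A' by apply: open_comp => // q _; exact: (Ck_cont (ksw 0 _ openT)).
have kv : Ck k.+1 A (param_velocity h) by exact: ((Ck_snd oA kh).2 (1, 0)).
pose G q := param_velocity h (sw q).
have kG : Ck k.+1 A' G by exact: (Ck_comp oA' _ (ksw _ _ oA') kv).
have DG mu s z : A (s, mu) -> 'D_(0, z) G (mu, s) = z * 'D_(1, 0) (param_velocity h) (s, mu).
  move=> Aq; rewrite -[RHS](derive_dirZ _ _ (Ck_diff kv Aq)).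
  apply: derive_congr => t; rewrite /G /sw /=; congr (param_velocity h _).
  apply: injective_projections => /=; last by rewrite !scaler0.
  by congr (_ *: _ + _); exact: (esym (mulr1 z)).
have inj z : 'D_(0, z) G (0, 0) = 0 -> z = 0.
  by rewrite DG// => /eqP; rewrite mulf_eq0 (negbTE param_acceleration0) orbF => /eqP.
have [A2 [B2 [sg [[oA2 A20 oB2 B20 AB2] [Bsg GE reg ksg]]]]] :=
  implicit_function oA' (A0 : A' (0, 0)) kG param_velocity0 inj.
have Asg mu : A2 mu -> A (sg mu, mu) by move=> Amu; exact: AB2 Amu (Bsg _ Amu).
exists A2, sg; split; [exact: oA2|exact: A20| |exact: ksg|].
  by apply/esym/(GE _ _ A20 B20); exact: param_velocity0.
move=> mu Amu; split; first exact: Asg.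
  exact/(GE _ _ Amu (Bsg _ Amu)).
apply/eqP => e0; have := reg _ _ 1 Amu (Bsg _ Amu).
by rewrite DG ?e0 ?mulr0; [move=> /(_ erefl)/eqP; rewrite oner_eq0|exact: Asg].
Qed.

End FoldBranch.

Section FoldPoint.
Context {R : realType} {m : nat}.
Notation pt := ('cV[R]_m * R * R)%type.
Variables (P : pt -> 'cV[R]_m) (U : set pt) (u0 w : 'cV[R]_m) (D : 'cV[R]_m -> R -> Prop).
Variables (A : set (R * R)) (B : set ('cV[R]_m * R)) (h : R * R -> 'cV[R]_m * R) (s0 mu : R).
Hypothesis oU : open U.
Hypothesis oA : open A.
Hypothesis oB : open B.
Hypothesis kP : Ck 2 U P.
Hypothesis kh : Ck 2 A h.
Hypothesis AB : forall e mu' q, A (e, mu') -> B q -> U ((q.1, mu'), q.2).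
Hypothesis Bh : forall q, A q -> B (h q).
Hypothesis hE : forall s mu' u e, A (s, mu') -> B (u, e) ->
  (P ((u, mu'), e) = u /\ dotv w (u - u0) = s) <-> (u, e) = h (s, mu').
Hypothesis UD : forall x e, U ((x, mu), e) -> D x e.
Hypothesis As0 : A (s0, mu).
Hypothesis critical : param_velocity h (s0, mu) = 0.
Hypothesis nondegenerate : 'D_(1, 0) (param_velocity h) (s0, mu) != 0.

Let x_ s := (h (s, mu)).1.
Let e_ s := (h (s, mu)).2.

Let hPw s : A (s, mu) -> P ((x_ s, mu), e_ s) = x_ s /\ dotv w (x_ s - u0) = s.
Proof. by move=> Aq; have Bq := Bh Aq; apply/(hE Aq); rewrite -surjective_pairing. Qed.

Let A1 := [set s | A (s, mu)].

Let kline j (S : set R) : open S -> Ck j S (fun s : R => (s, mu)).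
Proof. by move=> oS; apply: (Ck_pair oS); [exact: Ck_id|exact: Ck_cst]. Qed.

Let oA1 : open A1.
Proof.
by apply: (@open_comp _ _ (fun s : R => (s, mu))) => // s _; exact: (Ck_cont (kline 0 openT)).
Qed.

Let kx : Ck 2 A1 (fun s => h (s, mu)).
Proof. exact: (Ck_comp oA1 _ (kline _ oA1) kh). Qed.

Let e_1 : 'D_1 e_ = fun s => param_velocity h (s, mu).
Proof.
apply/funext => s; apply: derive_congr => t; congr (h _).2.
by apply: injective_projections => //=; rewrite scaler0 add0r.
Qed.

Let e_2 : 'D_1 ('D_1 e_) s0 = 'D_(1, 0) (param_velocity h) (s0, mu).
Proof.
rewrite e_1; apply: derive_congr => t; congr (param_velocity h _).
by apply: injective_projections => //=; rewrite scaler0 add0r.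
Qed.

(** Near the fold the fixed points for the parameter e are the points of the curve
    with parameter value e, and w^T (u - u0) recovers the position s on the
    curve: counting them is counting solutions of a scalar equation. *)
Lemma curve_fold_unfolding : fold_unfolding D (fun x e => P ((x, mu), e)) (x_ s0) (e_ s0).
Proof.
have E1 : 'D_1 e_ s0 = 0 by exact: etrans (congr1 (fun f => f s0) e_1) critical.
have E2 : 'D_1 ('D_1 e_) s0 != 0 by rewrite e_2.
have [sg sg1 [r0 r00 Hr]] := parabola oA1 As0 (Ck_snd oA1 kx) E1 E2.
exists sg; split; [exact: sg1|move=> N0 nN0].
have cw : continuous (dotv w : 'cV[R]_m -> R^o) by exact: (lin_continuous (W := R^o)).
(* close to the fold, uniqueness of h applies and N0 is not left *)
have [eta eta0 Heta] : exists2 eta : R, 0 < eta & forall x e, `|x_ s0 - x| < eta -> `|e_ s0 - e| < eta ->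
    B (x, e) /\ N0 x.
  have nB : nbhs (x_ s0, e_ s0) B.
    apply: (open_nbhs_nbhs (conj oB _)).
    by rewrite /x_ /e_ -surjective_pairing; exact: Bh.
  move/nbhs_normP: nB => [a /= a0 Ha]; move/nbhs_normP: nN0 => [b /= b0 Hb].
  exists (Num.min a b); first by rewrite lt_min a0.
  move=> x e; rewrite !lt_min => /andP[xa xb] /andP[ea _]; split; last exact: Hb.
  by apply: Ha; rewrite /= prod_normE /= gt_max xa.
have [rho1 rho10 Hrho1] : exists2 rho1 : R, 0 < rho1 & forall s, `|s - s0| < rho1 ->
    A (s, mu) /\ `|x_ s0 - x_ s| < eta.
  have nA : \forall s \near s0, A (s, mu) by exact: (open_nbhs_nbhs (conj oA1 As0)).
  have nx : \forall s \near s0, `|x_ s0 - x_ s| < eta.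
    have := Ck_cont (Ck_fst oA1 kx) As0.
    by move=> /cvgrPdist_lt; apply.
  have : \forall s \near s0, A (s, mu) /\ `|x_ s0 - x_ s| < eta.
    near=> s; split; [near: s; exact: nA|near: s; exact: nx].
  move=> /nbhs_normP[d /= d0 Hd]; exists d; [exact: d0|move=> s sd; apply: Hd].
  by rewrite /= distrC.
pose rho := Num.min rho1 r0 / 2.
have m0 : 0 < Num.min rho1 r0 by rewrite lt_min rho10.
have rho0 : 0 < rho by rewrite divr_gt0.
have rhom : rho < Num.min rho1 r0 by rewrite (ltr_pdivrMr _ _ (ltr0Sn R 1)) (ltr_pMr _ m0) ltr1n.
have [rho_rho1 rho_r0] : rho < rho1 /\ rho < r0 by apply/andP; rewrite -lt_min.
have Hrho s : `|s - s0| < rho -> A (s, mu) /\ `|x_ s0 - x_ s| < eta.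
  by move=> sr; apply: Hrho1; exact: lt_trans rho_rho1.
have [h1 h10 [F1 F2 F3]] := Hr rho rho0 rho_r0.
pose N := [set x | `|x_ s0 - x| < eta /\ `|dotv w (x - u0) - s0| < rho].
have NE x e : `|e_ s0 - e| < eta -> (N x /\ D x e /\ P ((x, mu), e) = x) <->
    exists2 s, `|s - s0| < rho & e_ s = e /\ x_ s = x.
  move=> ee; split=> [[[xe xr] [_ Px]]|[s sr [<- <-]]].
    have [As _] := Hrho _ xr; have [Bx _] := Heta _ _ xe ee.
    exists (dotv w (x - u0)); first exact: xr.
    have := (hE As Bx).1 (conj Px erefl).
    by rewrite /e_ /x_ => <-; split.
  have [As xe] := Hrho _ sr; have [Px wx] := hPw As.
  split; first by split; [exact: xe|rewrite wx].
  by split; [exact/UD/(AB As (Bh As))|exact: Px].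
have x_inj s t : `|s - s0| < rho -> `|t - s0| < rho -> x_ s = x_ t -> s = t.
  move=> /Hrho[As _] /Hrho[At _] xst.
  by have [_ <-] := hPw As; have [_ <-] := hPw At; rewrite xst.
have nN : nbhs (x_ s0) N.
  have n1 : \forall x \near x_ s0, `|x_ s0 - x| < eta by apply/nbhs_normP; exists eta.
  have n2 : \forall x \near x_ s0, `|dotv w (x - u0) - s0| < rho.
    have [_ wx] := hPw As0.
    have /cvgrPdist_lt/(_ _ rho0) := cw (x_ s0); apply: filterS => x.
    have -> : dotv w (x - u0) - s0 = dotv w x - dotv w (x_ s0).
      by rewrite -[X in _ - X = _]wx -[RHS](linearB (dotv w)) -[LHS](linearB (dotv w)) opprB addrA subrK.
    by rewrite distrC.
  near=> x; split; [near: x; exact: n1|near: x; exact: n2].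
have sgh t : 0 < t -> `|e_ s0 - (e_ s0 + sg * t)| = t /\ `|e_ s0 - (e_ s0 - sg * t)| = t.
  move=> t0; have nsg : `|sg * t| = t.
    by rewrite normrM (gtr0_norm t0); case: sg1 => ->; rewrite ?normrN normr1 mul1r.
  by split; [rewrite opprD addrA subrr sub0r normrN|rewrite subKr]; exact: nsg.
have ss0 : `|s0 - s0| < rho by rewrite subrr normr0.
exists N, (Num.min h1 eta); split; [exact: nN| | | |].
- move=> x [xe _]; have ee : `|e_ s0 - e_ s0| < eta by rewrite subrr normr0.
  by case: (Heta _ _ xe ee).
- by rewrite lt_min h10.
- have ee : `|e_ s0 - e_ s0| < eta by rewrite subrr normr0.
  apply/seteqP; split=> [x [Nx Dx Px]|x ->].
    have [s sr [es <-]] := (NE _ _ ee).1 (conj Nx (conj Dx Px)).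
    by rewrite (F1 _ sr es).
  have [Nx [Dx Px]] := (NE (x_ s0) _ ee).2 (ex_intro2 _ _ s0 ss0 (conj erefl erefl)).
  by split; [exact: Nx|exact: Dx|exact: Px].
move=> t /andP[t0]; rewrite lt_min => /andP[th te].
have [ep em] := sgh _ t0; split.
  have ee : `|e_ s0 - (e_ s0 + sg * t)| < eta by rewrite ep.
  have [|s1 [s2 [s12 r1 r2 F]]] := F3 t; first by rewrite t0.
  exists (x_ s1), (x_ s2); split; first by move=> /(x_inj _ _ r1 r2).
  apply/seteqP; split=> [x [Nx Dx Px]|x].
    have [s sr [es <-]] := (NE _ _ ee).1 (conj Nx (conj Dx Px)).
    by have [->|->] := (F _ sr).1 es; [left|right].
  have G s : `|s - s0| < rho -> s = s1 \/ s = s2 -> x = x_ s ->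
      [/\ N x, D x (e_ s0 + sg * t) & P ((x, mu), e_ s0 + sg * t) = x].
    move=> sr s12' ->; have es := (F _ sr).2 s12'.
    have [Nx [Dx Px]] := (NE (x_ s) _ ee).2 (ex_intro2 _ _ s sr (conj es erefl)).
    by split; [exact: Nx|exact: Dx|exact: Px].
  by move=> [|] /= xs; [apply: (G s1 r1 _ xs); left|apply: (G s2 r2 _ xs); right].
have ee : `|e_ s0 - (e_ s0 - sg * t)| < eta by rewrite em.
apply/seteqP; split=> [x [Nx Dx Px]|x []].
have [s sr [es _]] := (NE _ _ ee).1 (conj Nx (conj Dx Px)).
exact: (F2 _ _ t0 sr es).
Unshelve. all: by end_near. Qed.

End FoldPoint.

Section FoldPersistence.
Context {R : realType} {m : nat}.
Notation pt := ('cV[R]_m * R * R)%type.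
Variables (P : pt -> 'cV[R]_m) (U : set pt) (k : nat) (u0 : 'cV[R]_m) (w v : 'cV[R]_m).
Variable D : R -> 'cV[R]_m -> R -> Prop.
Let p0 : pt := ((u0, 0), 0).
Hypothesis oU : open U.
Hypothesis Up0 : U p0.
Hypothesis kP : Ck k.+2 U P.
Hypothesis P0 : P p0 = u0.
Hypothesis simple1 : simple_unit_eigenvalue (jac_state P p0).
Hypothesis wv : unit_eigenvectors (jac_state P p0) w v.
Hypothesis Pe0 : dotv w (param_derivative P p0) != 0.
Hypothesis Pvv0 : dotv w ('D_((v, 0), 0) ('D_((v, 0), 0) P) p0) != 0.
Hypothesis UD : forall p, U p -> D p.1.2 p.1.1 p.2.

Lemma param_derivative_slice (p : pt) :
  'D_1 (fun s : R => P ((p.1.1, p.1.2), s)) p.2 = param_derivative P p.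
Proof.
apply: derive_congr => t; congr P.
by case: p => [[x mu] e]; apply: injective_projections => /=;
  [apply: injective_projections|]; rewrite /= ?scaler0 ?add0r.
Qed.

Lemma second_derivative_slice (p : pt) z :
  'D_z ('D_z (fun x : 'cV[R]_m => P ((x, p.1.2), p.2))) p.1.1
    = 'D_((z, 0), 0) ('D_((z, 0), 0) P) p.
Proof.
pose f := fun x : 'cV[R]_m => 'D_z (fun x : 'cV[R]_m => P ((x, p.1.2), p.2)) x.
pose g := fun q : pt => 'D_((z, 0), 0) P q.
have E x : f x = g ((x, p.1.2), p.2).
  apply: derive_congr => t; congr P.
  by apply: injective_projections => /=; [apply: injective_projections|]; rewrite /= ?scaler0 ?add0r.
suff fg t : f (t *: z + p.1.1) = g (t *: ((z, 0), 0) + p) by exact: (derive_congr fg).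
rewrite E; congr g.
by case: p {f g E} => [[x mu] e]; apply: injective_projections => /=;
  [apply: injective_projections|]; rewrite /= ?scaler0 ?add0r.
Qed.

Lemma jac_state_entry i j p : Ck 1 U P -> U p ->
  jac_state P p i j = ('D_((delta_mx j 0, 0), 0) P p) i 0.
Proof. by move=> k1 Up; rewrite -(jac_state_mul oU _ k1 Up) -colE [RHS]mxE. Qed.

(** The velocity of u along the curve of folds serves as right eigenvector. The
    coefficient w'^T P_eta is nonzero because otherwise some (z, 1) would be in
    the kernel of the linearized equations of [fixed_point_curve]; the second
    coefficient is then nonzero by [curve_second]. *)
Theorem fold_persistence : exists (delta : R) (g : R -> R),
  [/\ 0 < delta, Ck k.+1 `](- delta), delta[ g, g 0 = 0 &
      forall mu, `|mu| < delta -> exists u, U ((u, mu), g mu) /\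
        saddle_node (D mu) (fun x e => P ((x, mu), e)) u (g mu)].
Proof.
have kP2 : Ck 2 U P by exact: Ck_le kP.
have [A [B [h [[oA A0 oB AB] [h0 kh Bh hE hreg]]]]] :=
  fixed_point_curve oU Up0 kP P0 simple1 wv Pe0.
have kh2 : Ck 2 A h by exact: Ck_le kh.
have [A2 [sg [oA2 A20 sg0 ksg Hsg]]] :=
  fold_branch oU kP wv Pe0 Pvv0 oA A0 AB h0 kh Bh hE hreg.
have hU q : A q -> U (at_curve h q) by case: q => s mu Aq; exact: AB Aq (Bh _ Aq).
have hPw q : A q -> P (at_curve h q) = (h q).1 /\ dotv w ((h q).1 - u0) = q.1.
  by case: q => s mu Aq; have Bq := Bh _ Aq; apply/(hE _ _ _ _ Aq); rewrite -surjective_pairing.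
pose c mu := (sg mu, mu); pose p mu := at_curve h (c mu).
have Ac mu : A2 mu -> A (c mu) by case/Hsg.
have kc : Ck k.+1 A2 c by apply: (Ck_pair oA2 ksg); exact: Ck_id.
have khc : Ck k.+1 A2 (fun mu => h (c mu)) by exact: (Ck_comp oA2 Ac kc (Ck_S kh)).
have kp : Ck k.+1 A2 p.
  apply: (Ck_pair oA2 _ (Ck_snd oA2 khc)); apply: (Ck_pair oA2 (Ck_fst oA2 khc)).
  exact: Ck_id.
have Up mu : A2 mu -> U (p mu) by move=> Amu; exact/hU/Ac.
have hP q (Aq : A q) := (hPw q Aq).1; have hw q (Aq : A q) := (hPw q Aq).2.
pose V mu := state_velocity h (c mu); pose J mu := jac_state P (p mu).
have JV mu : A2 mu -> J mu *m V mu = V mu.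
  move=> Amu; have [Aq e0 _] := Hsg _ Amu.
  by have := curve_tangent oU oA kP2 kh2 hU hP Aq; rewrite e0 scale0r addr0.
have wV mu : A2 mu -> dotv w (V mu) = 1.
  by move=> Amu; exact: (curve_speed oA kh2 hw (Ac _ Amu)).
have kJ i j : Ck 0 A2 (fun mu => J mu i j).
  have kD1 : Ck 1 U ('D_((delta_mx j 0, 0), 0) P) by exact: (kP2.2 _).
  have kD : Ck 0 U ('D_((delta_mx j 0, 0), 0) P) by exact: (Ck_S kD1).
  apply: (Ck_ext (f := fun mu => ('D_((delta_mx j 0, 0), 0) P (p mu)) i 0) oA2).
    by move=> mu Amu; rewrite -jac_state_entry; [|exact: (Ck_S kP2)|exact: Up].
  apply: (Ck_entry (M := fun mu => 'D_((delta_mx j 0, 0), 0) P (p mu)) _ _ oA2).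
  exact: (Ck_comp oA2 Up (Ck_le (leq0n _) kp) kD).
have kV i : Ck 0 A2 (fun mu => V mu i 0).
  apply: (Ck_entry (M := V) _ _ oA2).
  have ksv : Ck 0 A (state_velocity h).
    have ksv1 : Ck 1 A (state_velocity h) by exact: ((Ck_fst oA kh2).2 (1, 0)).
    exact: (Ck_S ksv1).
  exact: (Ck_comp oA2 Ac (Ck_le (leq0n _) kc) ksv).
have p00 : p 0 = p0 by rewrite /p /c sg0 /at_curve h0.
have base : simple_unit_eigenvalue (J 0) by rewrite /J p00.
have := simple_unit_eigenvalue_near oA2 A20 kJ kV JV wV base => nS.
have nA2 : \forall mu \near (0 : R), A2 mu by exact: (open_nbhs_nbhs (conj oA2 A20)).
have : \forall mu \near (0 : R), A2 mu /\ (simple_unit_eigenvalue (J mu) /\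
    1%:M - J mu + V mu *m w^T \in unitmx).
  near=> mu; split; [near: mu; exact: nA2|near: mu; exact: nS].
move=> /nbhs_normP[delta /= delta0 Hd].
have Hdelta mu : `|mu| < delta -> A2 mu /\ (simple_unit_eigenvalue (J mu) /\
    1%:M - J mu + V mu *m w^T \in unitmx).
  by move=> md; apply: Hd; rewrite /= sub0r normrN.
exists delta, (fun mu => (h (c mu)).2); split.
- exact: delta0.
- apply: (Ck_sub _ (Ck_snd oA2 khc)) => mu /=; rewrite in_itv /= -ltr_norml => md.
  by case: (Hdelta _ md).
- by rewrite /c sg0 h0.
move=> mu /Hdelta[Amu [Smu Nmu]]; have [Aq e0 n0] := Hsg _ Amu.
exists (h (c mu)).1; split; first exact: Up.
have [w' w'v w'0] := left_unit_eigenvector (JV _ Amu) (wV _ Amu) Nmu.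
have Pe' : dotv w' (param_derivative P (p mu)) != 0.
  apply/eqP => /w'0[z Jz wz].
  have [_ /eqP] : z = 0 /\ (1 : R) = 0 by apply: (hreg (c mu)); rewrite ?scale1r.
  by rewrite oner_eq0.
split.
- exists [set q : 'cV[R]_m * R | U ((q.1, mu), q.2)]; split.
  + exact: (slice_open (mu := mu) oU).
  + exact: (Up _ Amu).
  + by move=> [x e] /UD.
  + exact: (slice_Ck oU mu kP2).
- exact: hP.
- exact: Smu.
- exists w', (V mu); split; first exact: w'v.
  split; first by rewrite (param_derivative_slice (p mu)).
  rewrite (second_derivative_slice (p mu)); have [w'J _ _] := w'v.
  rewrite (curve_second oU oA kP2 kh2 hU hP Aq e0 w'J) oppr_eq0.
  by rewrite mulf_neq0.
apply: (curve_fold_unfolding (A := A) (B := B) (s0 := sg mu) (u0 := u0) (w := w)); try eassumption.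
by move=> x e /UD.
Unshelve. all: by end_near. Qed.

End FoldPersistence.

(** * Limit cycles of the impacting system *)

Section LimitCycles.
Context {R : realType} {m : nat}.
Notation state := 'cV[R]_m.+1.
Variables (F Reset W : state -> R -> R -> state) (C : state) (Q : 'M[R]_(m, m.+1)).
Hypothesis kG1 : Ck 1 setT (fun p : state * R * R => blowup_field F p.1.1 p.1.2 p.2).
Hypothesis Reset_surface : forall x mu eta, surface C x -> surface C (Reset x mu eta).
Hypothesis Q_frame : frame C Q \in unitmx.

Lemma frame_inj (x y : state) : dotv C x = dotv C y -> Q *m x = Q *m y -> x = y.
Proof.
move=> Cxy Qxy; have E : frame C Q *m x = frame C Q *m y.
  have : col_mx C^T Q *m x = col_mx C^T Q *m y by rewrite !mul_col_mx !dotvE Cxy Qxy.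
  by [].
by rewrite -(mulKmx Q_frame x) E mulKmx.
Qed.

Lemma blowup_field_scale mu eta (y : state) : mu != 0 ->
  F (mu *: y) mu eta = mu *: blowup_field F y mu eta.
Proof. by move=> mu0; rewrite /blowup_field (negbTE mu0) scalerA mulfV// scale1r. Qed.

Lemma velocity_scale mu eta (y : state) : mu != 0 ->
  velocity F C (mu *: y) mu eta = mu * velocity (blowup_field F) C y mu eta.
Proof. by move=> mu0; rewrite /velocity blowup_field_scale// linearZ. Qed.

Lemma surface_scale mu (y : state) : surface C y -> surface C (mu *: y).
Proof. by rewrite /surface /= linearZ /= => ->; rewrite scaler0. Qed.

(** Multiplication by mu carries solutions, surface and velocities of the blown-up
    system to those of the original one. The reset closes the orbit because a
    point of the surface is determined by its image under Q. *)
Lemma fixed_point_cycle mu eta u : 0 < mu -> poincare_graph F W Reset C Q mu eta u u ->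
  single_impact_limit_cycle F Reset C mu eta (mu *: zeta_inv C Q u).
Proof.
move=> mu0 [out [tau [y [[tau0 sy y0] [ns inc uE]]]]].
have mun0 : mu != 0 by rewrite gt_eqF.
have pos := return_positive kG1 out tau0 sy y0 ns.
exists tau, (fun t => mu *: y t); split.
  split; [exact: tau0| |by rewrite y0].
  have [cy dy] := sy; have cs : continuous (GRing.scale mu : state -> state).
    exact: lin_continuous.
  split=> [|t /dy dyt]; first exact: (within_comp (g := GRing.scale mu)).
  rewrite blowup_field_scale//; exact: (is_derive_lin (f := GRing.scale mu)).
have [Sout Vout] := out; have [Sin Vin] := inc; split.
- by split; [exact: surface_scale|rewrite velocity_scale// mulr_gt0].
- by move=> t /pos yt; rewrite linearZ /= mulr_gt0.
- by split; [exact: surface_scale|rewrite velocity_scale// nmulr_llt0].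
have E : Reset (mu *: y tau) mu eta = mu *: blowup_reset F W Reset C (y tau) mu eta.
  by rewrite /blowup_reset (negbTE mun0) scalerA mulfV// scale1r.
rewrite E; congr (_ *: _); apply: frame_inj.
  have : surface C (Reset (mu *: y tau) mu eta) by apply: Reset_surface; exact: surface_scale.
  rewrite E /surface /= linearZ /= => /eqP; rewrite scaler_eq0 (negbTE mun0) /= => /eqP ->.
  by apply/esym; exact: surface_zeta_inv.
by rewrite -uE (frame_zeta_inv Q_frame u).2.
Qed.

End LimitCycles.

Lemma poincareE (R : realType) (m : nat) (F W Reset : 'cV[R]_m.+1 -> R -> R -> 'cV[R]_m.+1)
    (C : 'cV[R]_m.+1) (Q : 'M[R]_(m, m.+1)) (u u' : 'cV[R]_m) (mu eta : R) :
  Ck 1 setT (fun p : 'cV[R]_m.+1 * R * R => blowup_field F p.1.1 p.1.2 p.2) ->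
  poincare_graph F W Reset C Q mu eta u u' -> poincare F W Reset C Q u mu eta = u'.
Proof.
move=> kG g; rewrite /poincare; have [u2 _ g2|/(_ u') []//] := xgetP 0 (poincare_graph F W Reset C Q mu eta u).
exact: (return_graph_functional kG g2 g).
Qed.

Theorem theorem2 (R : realType) (m k : nat)
  (C : 'cV[R]_m.+1)
  (F Reset W : 'cV[R]_m.+1 -> R -> R -> 'cV[R]_m.+1)
  (r : 'cV[R]_m.+1 -> R -> R -> R)
  (Q : 'M[R]_(m, m.+1))
  (uhat w v : 'cV[R]_m)
  (C_neq0 : C != 0)
  (k_ge3 : (3 <= k)%N)
  (F_Ck : Ck k setT
     (fun p : 'cV[R]_m.+1 * R * R => F p.1.1 p.1.2 p.2))
  (Reset_Ck : Ck k setT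
     (fun p : 'cV[R]_m.+1 * R * R => Reset p.1.1 p.1.2 p.2))
  (W_C1 : Ck 1 setT
     (fun p : 'cV[R]_m.+1 * R * R => W p.1.1 p.1.2 p.2))
  (r_cont : continuous
     (fun p : 'cV[R]_m.+1 * R * R => r p.1.1 p.1.2 p.2))
  (ResetE : forall x mu eta,
     Reset x mu eta = x + velocity F C x mu eta *: W x mu eta)
  (Reset_surface : forall x mu eta,
     surface C x -> surface C (Reset x mu eta))
  (rE : forall x mu eta, surface C x ->
     velocity F C (Reset x mu eta) mu eta
       = - r x mu eta * velocity F C x mu eta)
  (r_gt0 : forall x mu eta,
     (incoming F C mu eta `|` grazing F C mu eta) x -> 0 < r x mu eta)
  (F_equilibrium : forall eta, F 0 0 eta = 0)
  (Q_frame : frame C Q \in unitmx)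
  (uhat_defined : poincare_defined F W Reset C Q uhat 0 0)
  (uhat_fixed : poincare F W Reset C Q uhat 0 0 = uhat)
  (DP_spectrum : simple_unit_eigenvalue
     (jac (fun u => poincare F W Reset C Q u 0 0) uhat))
  (DP_eigenvectors : unit_eigenvectors
     (jac (fun u => poincare F W Reset C Q u 0 0) uhat) w v)
  (P_eta : dotv w
     ('D_1 (fun eta : R => poincare F W Reset C Q uhat 0 eta) 0) != 0)
  (P_uu : dotv w
     ('D_v ('D_v (fun u => poincare F W Reset C Q u 0 0)) uhat) != 0) :
  exists (delta : R) (g : R -> R),
    [/\ 0 < delta,
        Ck (k - 2) `](- delta), delta[ g,
        g 0 = 0 &
        forall mu : R, 0 < mu < delta ->
          saddle_node_of_limit_cycles F W Reset C Q mu (g mu)].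
Proof.
case: k k_ge3 F_Ck Reset_Ck => [|[|[|j]]] // _ F_Ck' Reset_Ck'.
rewrite subSS subSS subn0.
have Reset0 eta : Reset 0 0 eta = 0.
  by rewrite ResetE /velocity F_equilibrium linear0 scale0r addr0.
have kF1 : Ck 1 setT (fun p : 'cV[R]_m.+1 * R * R => F p.1.1 p.1.2 p.2) by exact: Ck_le F_Ck'.
have kG : Ck j.+2 setT (fun p : 'cV[R]_m.+1 * R * R => blowup_field F p.1.1 p.1.2 p.2).
  apply: (Ck_ext openT _ (blowup_Ck F_equilibrium F_Ck')) => -[[y mu] eta] _.
  by rewrite blowup_fieldE.
have kRt : Ck j.+2 setT
    (fun p : 'cV[R]_m.+1 * R * R => blowup_reset F W Reset C p.1.1 p.1.2 p.2).
  apply: (Ck_ext openT _ (blowup_Ck Reset0 Reset_Ck')) => -[[y mu] eta] _.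
  by rewrite (blowup_resetE F_equilibrium ResetE).
have kG1 : Ck 1 setT (fun p : 'cV[R]_m.+1 * R * R => blowup_field F p.1.1 p.1.2 p.2).
  exact: Ck_le kG.
have [uhat' guhat] := uhat_defined.
have [U [P [oU Uu kP PU]]] := return_map_smooth kG kRt Q_frame guhat.
pose Pi (p : 'cV[R]_m * R * R) := poincare F W Reset C Q p.1.1 p.1.2 p.2.
have PiP p : U p -> Pi p = P p by move=> /PU gp; exact: poincareE kG1 gp.
have kPi : Ck j.+2 U Pi by apply: (Ck_ext oU _ kP) => p /PiP.
have Pe : dotv w (param_derivative Pi ((uhat, 0), 0)) != 0.
  exact: (eq_ind _ (fun x => dotv w x != 0) P_eta _ (param_derivative_slice Pi ((uhat, 0), 0))).
have Pvv : dotv w ('D_((v, 0), 0) ('D_((v, 0), 0) Pi) ((uhat, 0), 0)) != 0.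
  exact: (eq_ind _ (fun x => dotv w x != 0) P_uu _ (second_derivative_slice Pi ((uhat, 0), 0) v)).
have UD p : U p -> poincare_defined F W Reset C Q p.1.1 p.1.2 p.2.
  by move=> /PU gp; exists (P p).
have [delta [g [delta0 kg g0 Hg]]] := fold_persistence
  (D := fun mu x e => poincare_defined F W Reset C Q x mu e)
  oU Uu kPi uhat_fixed DP_spectrum DP_eigenvectors Pe Pvv UD.
exists delta, g; split; [exact: delta0|exact: kg|exact: g0|].
move=> mu /andP[mu0 mud].
have [u [Up SN]] := Hg mu (etrans (congr1 (fun x => x < delta) (gtr0_norm mu0)) mud).
exists u; split; last exact: SN.
have gu : poincare_graph F W Reset C Q mu (g mu) u (P ((u, mu), g mu)) := PU _ Up.
have Pu : P ((u, mu), g mu) = u by rewrite -(PiP _ Up); case: SN.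
by rewrite Pu in gu; exact: (fixed_point_cycle kG1 Reset_surface Q_frame mu0 gu).
Qed.
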